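(* Let $\eta\in\mathbb{R}$. If $f\in\mathcal{P}(\mathbb{S}^2)$ is a $W^{1,q}$-local minimiser of $\mathcal{F}$ for some $q\in[1,\infty)$, then $f$ is an $L^1$-local minimiser of $\mathcal{F}$. In particular, local minimisation of $\mathcal{F}$ with respect to $L^q$ ($q\in[1,\infty]$), $C^\alpha$ ($0\le\alpha<1$) and $W^{1,q}$ ($q\in[1,\infty)$) are all equivalent: for any two spaces $X,X'$ from these families, $f$ is an $X$-local minimiser if and only if $f$ is an $X'$-local minimiser.
   Context: $\mathbb{S}^2\subset\mathbb{R}^3$ is the unit sphere and $dp$ is the 2-dimensional Hausdorff measure on it. $\mathcal{P}(\mathbb{S}^2)=\{f\in L^1(\mathbb{S}^2): f\ge 0 \text{ a.e.},\ \int_{\mathbb{S}^2}f\,dp=1\}$. For $\eta\in\mathbb{R}$, the energy $\mathcal{F}:\mathcal{P}(\mathbb{S}^2)\to\mathbb{R}\cup\{+\infty\}$ is $$\mathcal{F}(f)=\int_{\mathbb{S}^2}f(p)\ln f(p)-f(p)\ln\left(\int_{\mathbb{S}^2}\left((p\cdot q)^2-\tfrac13\right)f(q)\,dq-\eta\right)dp,$$ where $-\ln$ is extended by $+\infty$ for non-positive arguments, $0\times(+\infty)=0$ and $0\ln 0=0$. For a Banach space $X$ of functions on $\mathbb{S}^2$ continuously embedded in $L^1(\mathbb{S}^2)$, $f^*\in\mathcal{P}(\mathbb{S}^2)\cap X$ with $\mathcal{F}(f^* )<+\infty$ is an $X$-local minimiser of $\mathcal{F}$ if there is $\epsilon>0$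 such that $\mathcal{F}(f^* )\le\mathcal{F}(f)$ for all $f\in\mathcal{P}(\mathbb{S}^2)\cap X$ with $\|f-f^*\|_X<\epsilon$. All function spaces are over $\mathbb{S}^2$; $C^\alpha$ is the Hölder space ($C^0$ the continuous functions). *)

(* Defs.v *)
From HB Require Import structures.
From mathcomp Require Import all_boot all_order all_algebra.
From mathcomp Require Import all_classical all_reals all_analysis.
From mathcomp Require Import ring lra.

Set Implicit Arguments.
Unset Strict Implicit.
Unset Printing Implicit Defensive.

Import Order.TTheory GRing.Theory Num.Def Num.Theory.
Import numFieldNormedType.Exports.

Local Open Scope classical_set_scope.
Local Open Scope ring_scope.

Section hausdorff_outer_measure.
Context {R : realType} {T : pointedType}.
Local Open Scope ereal_scope.
Implicit Types (dist : T -> T -> R) (A : set T) (U : (set T)^nat).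

(* The supremum of the empty set is -oo, whence the maximum with 0. *)
Definition diam dist A : \bar R :=
  maxe 0 (ereal_sup [set (dist x y)%:E | x in A & y in A]).

(* With the factor pi / 4, the area of the disc of diameter 1, the Hausdorff
   measure of a smooth surface is its area. *)
Definition disc_area dist A : \bar R := (pi / 4)%:E * diam dist A ^+ 2.

Definition hausdorff2_at dist (delta : R) A : \bar R :=
  ereal_inf [set \sum_(k <oo) disc_area dist (U k) | U in
    [set U | (forall k, diam dist (U k) <= delta%:E) /\
             A `<=` \bigcup_k U k]].

Definition hausdorff2 dist A : \bar R :=
  ereal_sup [set hausdorff2_at dist delta A | delta in [set d : R | (0 < d)%R]].

Lemma diam_ge0 dist A : 0 <= diam dist A.
Proof. by rewrite /diam le_max lexx. Qed.

Lemma diam0 dist : diam dist set0 = 0.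
Proof.
rewrite /diam (_ : [set _ | _ in _ & _ in _] = set0) ?ereal_sup0 ?maxeNy//.
by rewrite -subset0 => _ [x []].
Qed.

Lemma le_diam dist A B : A `<=` B -> diam dist A <= diam dist B.
Proof.
move=> AB; rewrite /diam ge_max le_max lexx/= le_max; apply/orP; right.
apply: ereal_sup_le => _ [x Ax [y Ay <-]].
by exists x; [exact: AB|exists y => //; exact: AB].
Qed.

Lemma disc_area_ge0 dist A : 0 <= disc_area dist A.
Proof.
by rewrite mule_ge0 ?expe_ge0 ?diam_ge0// lee_fin divr_ge0 ?pi_ge0.
Qed.

Lemma disc_area0 dist : disc_area dist set0 = 0.
Proof. by rewrite /disc_area diam0 expe2 mul0e mule0. Qed.

End hausdorff_outer_measure.

(* The sets of diameter at most delta form a semiring of sets, for which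
   hausdorff2_at is the outer measure mu_ext of the library. *)
Definition small_sets (R : realType) (T : Type) (dist : T -> T -> R)
  (delta : R) := T.

Section small_sets.
Context (R : realType) (T : pointedType) (dist : T -> T -> R).
Variables (delta : R) (delta_ge0 : 0 <= delta).
Let small (A : set T) := (diam dist A <= delta%:E)%E.

Lemma small0 : small set0. Proof. by rewrite /small diam0 lee_fin. Qed.

Lemma smallW A B : A `<=` B -> small B -> small A.
Proof. by move=> AB; exact/le_trans/le_diam. Qed.

Lemma smallI : setI_closed small.
Proof. by move=> A B sA _; exact: smallW sA. Qed.

Lemma smallD : semi_setD_closed small.
Proof.
move=> A B sA sB; exists [set A `\` B]; split.
- exact: finite_set1.
- by move=> _ ->; exact: smallW sA.
- by rewrite bigcup_set1.
- by move=> X Y -> ->.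
Qed.

HB.instance Definition _ := Pointed.copy (small_sets dist delta) T.
HB.instance Definition _ := isSemiRingOfSets.Build default_measure_display
  (small_sets dist delta) small0 smallI smallD.

Let U : semiRingOfSetsType _ := small_sets dist delta.

Lemma hausdorff2_atE :
  hausdorff2_at dist delta = mu_ext (disc_area dist : set U -> \bar R).
Proof. by []. Qed.

Lemma hausdorff2_at_ge0 A : (0 <= hausdorff2_at dist delta A)%E.
Proof. by rewrite hausdorff2_atE; apply: mu_ext_ge0 => X; exact: disc_area_ge0. Qed.

Lemma hausdorff2_at0 : hausdorff2_at dist delta set0 = 0%E.
Proof.
by rewrite hausdorff2_atE; apply: mu_ext0 => [|X];
  [exact: disc_area0|exact: disc_area_ge0].
Qed.

Lemma le_hausdorff2_at A B : A `<=` B ->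
  (hausdorff2_at dist delta A <= hausdorff2_at dist delta B)%E.
Proof. by move=> AB; rewrite hausdorff2_atE; exact: le_mu_ext. Qed.

Lemma hausdorff2_at_sigma_subadditive :
  sigma_subadditive (hausdorff2_at dist delta).
Proof. exact: (@mu_ext_sigma_subadditive _ U _ _ (disc_area_ge0 dist)). Qed.

End small_sets.

Section hausdorff_measure.
Context {R : realType} {T : pointedType} (dist : T -> T -> R).
Local Open Scope ereal_scope.

Lemma hausdorff2_ge0 A : 0 <= hausdorff2 dist A.
Proof.
apply: le_trans (hausdorff2_at_ge0 dist ler01 A) _.
by apply: ereal_sup_ubound; exists 1%R => //=.
Qed.

Lemma hausdorff20 : hausdorff2 dist set0 = 0.
Proof.
apply/eqP; rewrite eq_le hausdorff2_ge0 andbT.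
apply: ge_ereal_sup => _ [d /= d0 <-].
by rewrite hausdorff2_at0// ltW.
Qed.

Lemma le_hausdorff2 : {homo hausdorff2 dist : A B / A `<=` B >-> A <= B}.
Proof.
move=> A B AB; apply: ge_ereal_sup => _ [d /= d0 <-].
apply: le_trans (le_hausdorff2_at dist (ltW d0) AB) _.
by apply: ereal_sup_ubound; exists d.
Qed.

Lemma hausdorff2_sigma_subadditive : sigma_subadditive (hausdorff2 dist).
Proof.
move=> F; apply: ge_ereal_sup => _ [d /= d0 <-].
apply: (le_trans (@hausdorff2_at_sigma_subadditive _ _ dist d (ltW d0) F)).
apply: lee_nneseries => [k _ _|k _]; first exact/hausdorff2_at_ge0/ltW.
by apply: ereal_sup_ubound; exists d.
Qed.

HB.instance Definition _ := isOuterMeasure.Build R T (hausdorff2 dist)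
  hausdorff20 hausdorff2_ge0 le_hausdorff2 hausdorff2_sigma_subadditive.

End hausdorff_measure.

Section euclidean_space.
Context {R : realType}.
Implicit Types u v w : 'rV[R]_3.

Definition dot u v : R := \sum_(i < 3) u 0 i * v 0 i.

(* The norm of the library on 'rV[R]_3 is the maximum norm. *)
Definition enorm u : R := Num.sqrt (dot u u).

Definition edist u v : R := enorm (u - v).

Lemma dotE u v :
  dot u v = u 0 0 * v 0 0 + u 0 1 * v 0 1 + u 0 2%:R * v 0 2%:R.
Proof.
rewrite /dot !big_ord_recr big_ord0 /= add0r.
by congr (_ * _ + _ * _ + _ * _); congr (_ 0 _); apply/val_inj.
Qed.

Lemma dot_ge0 u : 0 <= dot u u.
Proof. by apply: sumr_ge0 => i _; rewrite -expr2 sqr_ge0. Qed.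

Lemma enorm_ge0 u : 0 <= enorm u. Proof. exact: sqrtr_ge0. Qed.

Lemma sqr_enorm u : enorm u ^+ 2 = dot u u.
Proof. by rewrite sqr_sqrtr// dot_ge0. Qed.

Lemma cauchy_schwarz u v : dot u v <= enorm u * enorm v.
Proof.
apply: le_trans (ler_norm _) _.
rewrite -[leLHS]sqrtr_sqr /enorm -sqrtrM ?dot_ge0// ler_sqrt ?mulr_ge0 ?dot_ge0//.
rewrite !dotE -subr_ge0.
set a := u 0 0; set b := u 0 1; set c := u 0 _.
set d := v 0 0; set e := v 0 1; set f := v 0 _.
rewrite (_ : _ - _ = (a * e - b * d) ^+ 2 + (a * f - c * d) ^+ 2 +
                     (b * f - c * e) ^+ 2); last by ring.
by rewrite !addr_ge0// sqr_ge0.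
Qed.

Lemma enormD u v : enorm (u + v) <= enorm u + enorm v.
Proof.
rewrite -(@ler_pXn2r _ 2) ?nnegrE ?addr_ge0 ?enorm_ge0// sqrrD !sqr_enorm.
have := cauchy_schwarz u v; rewrite !dotE !mxE; lra.
Qed.

Lemma enormN u : enorm (- u) = enorm u.
Proof. by rewrite /enorm !dotE !mxE !mulrNN. Qed.

Lemma enorm0_eq0 u : enorm u = 0 -> u = 0.
Proof.
move=> /eqP; rewrite sqrtr_eq0 => u0; apply/rowP => i; rewrite mxE.
have /eqP : dot u u = 0 by apply/eqP; rewrite eq_le u0 dot_ge0.
rewrite psumr_eq0 => [/allP/(_ i)|j _]; last by rewrite -expr2 sqr_ge0.
by rewrite mem_index_enum -expr2 sqrf_eq0 => /(_ isT)/eqP.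
Qed.

Lemma edistxx u : edist u u = 0.
Proof. by rewrite /edist subrr /enorm dotE !mxE !mul0r !addr0 sqrtr0. Qed.

Lemma edist_sym u v : edist u v = edist v u.
Proof. by rewrite /edist -enormN opprB. Qed.

Lemma edist_triangle v u w : edist u w <= edist u v + edist v w.
Proof. by rewrite /edist -[u - w](subrKA v) enormD. Qed.

End euclidean_space.

Definition sphere (R : realType) := {p : 'rV[R]_3 | dot p p == 1}.

Section sphere_structures.
Context (R : realType).
Notation S2 := (sphere R).
Implicit Types p q r : S2.

HB.instance Definition _ := SubType.on S2.
HB.instance Definition _ := Choice.on S2.

Lemma dot_north : dot (delta_mx 0 0 : 'rV[R]_3) (delta_mx 0 0) == 1.
Proof. by rewrite dotE !mxE/= mulr1 !mulr0 !addr0. Qed.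

HB.instance Definition _ := isPointed.Build S2
  (exist (fun p : 'rV[R]_3 => is_true (dot p p == 1)) _ dot_north).

Definition sdist p q : R := edist (val p) (val q).

Lemma sdistxx p : sdist p p = 0. Proof. exact: edistxx. Qed.

Lemma sdist_positivity p q : sdist p q = 0 -> p = q.
Proof. by move=> /enorm0_eq0/eqP; rewrite subr_eq0 => /eqP/val_inj. Qed.

Lemma sdist_sym p q : sdist p q = sdist q p. Proof. exact: edist_sym. Qed.

Lemma sdist_triangle q p r : sdist p r <= sdist p q + sdist q r.
Proof. exact: edist_triangle. Qed.

HB.instance Definition _ :=
  isMetric.Build R S2 sdistxx sdist_positivity sdist_sym sdist_triangle.

(* The sigma-algebra is that of the Caratheodory-measurable sets of the
   Hausdorff outer measure. *)
HB.instance Definition _ :=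
  Measurable.copy S2 (caratheodory_type (hausdorff2 sdist)).

Definition surface_measure : set S2 -> \bar R := hausdorff2 sdist.

HB.instance Definition _ := isMeasure.Build _ S2 R surface_measure
  (@caratheodory_measure0 R S2 (hausdorff2 sdist))
  (@caratheodory_measure_ge0 R S2 (hausdorff2 sdist))
  (@caratheodory_measure_sigma_additive R S2 (hausdorff2 sdist)).

End sphere_structures.
Arguments surface_measure {R}.

Section function_spaces.
Context {R : realType}.
Notation S2 := (sphere R).
Notation mu := surface_measure.
Implicit Types (f g : S2 -> R) (p q : S2).

(* A normed space of functions on the sphere, modulo equality almost
   everywhere: fs_mem and fs_norm are meant to be invariant under it. *)
Record fun_space := FunSpace {
  fs_mem : set (S2 -> R) ;
  fs_norm : (S2 -> R) -> \bar R }.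

Definition Lebesgue_space (s : \bar R) := FunSpace
  [set f | f \in Lfun mu s] (fun f => 'N[mu]_s[EFin \o f]%E).

Definition sup_norm g : \bar R := ereal_sup (range (fun p => `|g p|%:E)).

Definition hoelder_seminorm (alpha : R) g : \bar R :=
  ereal_sup [set (`|g pq.1 - g pq.2| / sdist pq.1 pq.2 `^ alpha)%:E |
    pq in [set pq | pq.1 != pq.2]].

Definition hoelder_norm (alpha : R) g : \bar R :=
  (sup_norm g + if alpha == 0%R then 0 else hoelder_seminorm alpha g)%E.

(* Nonempty open sets having positive measure, the continuous representative g
   of f is unique, and the norm of f is that of g. *)
Definition Hoelder_space (alpha : R) := FunSpace
  [set f | exists g, [/\ continuous g, f = g %[ae mu] &
                         (hoelder_norm alpha g < +oo)%E]]
  (fun f => ereal_inf [set hoelder_norm alpha g | g in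
                         [set g | continuous g /\ f = g %[ae mu]]]).

Definition C1_field (Phi : 'rV[R]_3 -> 'rV[R]_3) :=
  (forall x, differentiable Phi x) /\ continuous (jacobian Phi).

(* The trace of the differential on the tangent plane: the full divergence minus
   the contribution of the normal p. *)
Definition surface_div (Phi : 'rV[R]_3 -> 'rV[R]_3) p : R :=
  \tr (jacobian Phi (val p)) - dot ('d Phi (val p) (val p)) (val p).

(* The sphere having no boundary, every C^1 tangent field is a test field, and
   each is the restriction of a C^1 field on the ambient space. *)
Definition weak_gradient f (G : S2 -> 'rV[R]_3) :=
  [/\ forall i, (fun p => G p 0 i) \in Lfun mu 1,
      (\forall p \ae mu, dot (G p) (val p) = 0) &
      forall Phi, C1_field Phi -> (forall p, dot (Phi (val p)) (val p) = 0) ->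
        \int[mu]_p (f p * surface_div Phi p) =
        - \int[mu]_p (dot (G p) (Phi (val p)))].

(* The weak gradient of f is unique almost everywhere. *)
Definition Sobolev_space (s : R) := FunSpace
  [set f | f \in Lfun mu s%:E /\
     exists2 G, weak_gradient f G & (enorm \o G) \in Lfun mu s%:E]
  (fun f => ereal_inf
     [set ('N[mu]_s%:E[EFin \o f] + 'N[mu]_s%:E[EFin \o (enorm \o G)])%E |
       G in weak_gradient f]).

Inductive usual_space : fun_space -> Prop :=
| usual_Lebesgue (s : \bar R) : (1 <= s)%E -> usual_space (Lebesgue_space s)
| usual_Hoelder (alpha : R) : 0 <= alpha < 1 ->
    usual_space (Hoelder_space alpha)
| usual_Sobolev (s : R) : 1 <= s -> usual_space (Sobolev_space s).

End function_spaces.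
Arguments fun_space : clear implicits.

Section energy.
Context {R : realType}.
Notation S2 := (sphere R).
Notation mu := surface_measure.
Implicit Types (f g : S2 -> R) (p q : S2).

Definition prob_density f :=
  [/\ f \in Lfun mu 1, (\forall p \ae mu, 0 <= f p) & \int[mu]_p f p = 1].

Definition neg_ln (x : R) : \bar R := if 0 < x then (- ln x)%:E else +oo%E.

Definition potential f p : R :=
  \int[mu]_q ((dot (val p) (val q) ^+ 2 - 3^-1) * f q).

(* ln 0 = 0 in the library, and 0 * +oo = 0 in \bar R. *)
Definition energy (eta : R) f : \bar R :=
  (\int[mu]_p ((f p * ln (f p))%:E + (f p)%:E * neg_ln (potential f p - eta)))%E.

Definition local_minimiser (eta : R) (X : fun_space R) f :=
  [/\ prob_density f, fs_mem X f, (energy eta f < +oo)%E &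
      exists2 eps : R, 0 < eps &
        forall g, prob_density g -> fs_mem X g ->
          (fs_norm X (g \- f)%R < eps%:E)%E -> (energy eta f <= energy eta g)%E].

End energy.

(* Main.v *)
Require Import Defs.
From mathcomp Require Import all_boot all_order all_algebra.
From mathcomp Require Import all_classical all_reals all_analysis.
From mathcomp Require Import ess_sup_inf measurable_realfun ring lra.
Import Order.TTheory GRing.Theory Num.Def Num.Theory.
Import numFieldNormedType.Exports.
Set Implicit Arguments.
Unset Strict Implicit.
Unset Printing Implicit Defensive.
Local Open Scope classical_set_scope.
Local Open Scope ring_scope.

(* The potential of f is the quadratic form u given by the second moments of f, so
   that among the densities with given moments the energy is a relative entropy.
   Its unique minimiser there is h = max(u, 0) exp(phi) with phi a quadratic form,
   a critical point of the partition function b |-> int max(u, 0) exp(phi_b),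
   which is coercive and strictly convex in five real parameters.
   An X-local minimiser f coincides with its h: moments are constant on the segment
   from f to h, and the energy is convex there. If g is close to f in L^1, then so
   are its moments, the critical point b moves little, and the h' of g is close to
   h in X, whence F(f) <= F(h') <= F(g). The last closeness holds in every X under
   consideration since h is Lipschitz and its gradient jumps only across the zero
   set of u, which is null. *)

(** * Surface measure *)

(** Origin of h: with the moments frozen, the energy is int f ln f - f ln u under linear
    constraints, and phi collects their Lagrange multipliers. The moments form a symmetric 3 by 3
    matrix whose trace is fixed by |p| = 1, whence five parameters besides the normalisation. The
    obstacle is that u may vanish or change sign, so that ln u is unbounded and the energy may be
    infinite. Optimality is therefore never obtained by differentiating the energy, but by
    integrating x ln x - x ln y >= x - y with y the value of a profile. Likewise no implicit
    function theorem is applied to b: existence and stability of the critical point come from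
    comparing values of the partition function on spheres and balls of the parameter space. No area
    formula enters. Apart from finiteness and the measurability of open sets, the surface measure is
    used through its invariance under rotations, which yields both analytic facts needed: the zero
    set of a nonconstant quadratic form is null, and profiles can be integrated by parts against
    tangent fields. *)

Section metric_outer_measure.
Context {R : realType} {T : pointedType} (dist : T -> T -> R).
Local Open Scope ereal_scope.
Implicit Types A B : set T.

Lemma le_disc_area A B : A `<=` B -> disc_area dist A <= disc_area dist B.
Proof.
move=> AB; rewrite /disc_area lee_pmul2l ?fin_numE// ?lte_fin ?divr_gt0 ?pi_gt0//.
by rewrite !expe2 lee_pmul ?diam_ge0 ?le_diam.
Qed.

(** A covering set of diameter at most [delta] meets at most one of A and B, so each term of a cover
    of the union is spent on only one of them. *)
Lemma hausdorff2_at_separated (delta : R) A B :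
  (forall x y, A x -> B y -> (delta < dist x y)%R) ->
  hausdorff2_at dist delta A + hausdorff2_at dist delta B <=
  hausdorff2_at dist delta (A `|` B).
Proof.
move=> AB; apply: le_ereal_inf_tmp => _ [U [Ud ABU] <-].
have h C : C `<=` A `|` B -> hausdorff2_at dist delta C <=
    \sum_(k <oo) disc_area dist (U k `&` C).
  move=> CAB; apply: ereal_inf_lbound; exists (fun k => U k `&` C) => //; split.
    by move=> k; apply: le_trans (Ud k); apply: le_diam => x [].
  by move=> x Cx; have [k _ Ux] := ABU _ (CAB _ Cx); exists k.
apply: (le_trans (leeD (h A _) (h B _))); [by move=> x; left|by move=> x; right|].
rewrite -nneseriesD; try by move=> *; exact: disc_area_ge0.
apply: lee_nneseries => [k _ _|k _].
  by apply: adde_ge0; exact: disc_area_ge0.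
have [/eqP UA0|/set0P[x [Ux Ax]]] := boolP (U k `&` A == set0).
  by rewrite UA0 disc_area0 add0e le_disc_area.
have -> : U k `&` B = set0.
  rewrite -subset0 => y [Uy By]; have := AB _ _ Ax By; rewrite ltNge => /negP; apply.
  rewrite -lee_fin; apply: le_trans (Ud k); rewrite /diam le_max; apply/orP; right.
  by apply: ereal_sup_ubound; exists x => //; exists y.
by rewrite disc_area0 adde0 le_disc_area.
Qed.

Lemma le_hausdorff2_at_delta (d e : R) A : (d <= e)%R ->
  hausdorff2_at dist e A <= hausdorff2_at dist d A.
Proof.
move=> de; apply: ereal_inf_le_tmp => _ [U [Ud AU] <-]; exists U => //; split => // k.
by apply: le_trans (Ud k) _; rewrite lee_fin.
Qed.

Lemma hausdorff2_at_le (d : R) A : (0 < d)%R ->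
  hausdorff2_at dist d A <= hausdorff2 dist A.
Proof. by move=> d0; apply: ereal_sup_ubound; exists d. Qed.

Lemma hausdorff2_separated (d : R) A B : (0 < d)%R ->
  (forall x y, A x -> B y -> (d <= dist x y)%R) ->
  hausdorff2 dist A + hausdorff2 dist B <= hausdorff2 dist (A `|` B).
Proof.
move=> d0 AB.
have [->|ABy] := eqVneq (hausdorff2 dist (A `|` B)) +oo; first by rewrite leey.
have fin C : C `<=` A `|` B -> hausdorff2 dist C \is a fin_num.
  move=> CAB; rewrite ge0_fin_numE ?hausdorff2_ge0//.
  by apply: le_lt_trans (le_hausdorff2 dist CAB) _; rewrite lt_neqAle ABy leey.
have finA : hausdorff2 dist A \is a fin_num by apply: fin; left.
have finB : hausdorff2 dist B \is a fin_num by apply: fin; right.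
rewrite -leeBrDr// [X in X <= _]/hausdorff2.
apply: ge_ereal_sup => _ [a /= a0 <-]; rewrite leeBrDr// addeC.
rewrite -leeBrDr; last first.
  rewrite ge0_fin_numE ?hausdorff2_at_ge0// ?ltW//.
  by rewrite (le_lt_trans (hausdorff2_at_le _ a0))// -ge0_fin_numE ?hausdorff2_ge0.
apply: ge_ereal_sup => _ [b /= b0 <-].
rewrite leeBrDr; last first.
  rewrite ge0_fin_numE ?hausdorff2_at_ge0// ?ltW//.
  by rewrite (le_lt_trans (hausdorff2_at_le _ a0))// -ge0_fin_numE ?hausdorff2_ge0.
(* A scale finer than both [a] and [b], and strictly below [d] because the lemma at a fixed scale
   asks for strict separation. *)
pose c : R := Num.min (Num.min a b) (d / 2)%R.
have c0 : (0 < c)%R by rewrite /c !lt_min a0 b0 divr_gt0.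
have ca : (c <= a)%R by rewrite /c !ge_min lexx.
have cb : (c <= b)%R by rewrite /c !ge_min lexx orbT.
have cd : (c < d)%R by rewrite /c gt_min; apply/orP; right; lra.
apply: le_trans (hausdorff2_at_le _ c0).
apply: le_trans (hausdorff2_at_separated _).
  by rewrite addeC leeD// le_hausdorff2_at_delta.
by move=> x y Ax By; apply: lt_le_trans cd (AB _ _ Ax By).
Qed.

(** The Caratheodory criterion for metric outer measures, with a 1-Lipschitz [phi] in place of the
    distance to a closed set. The layers [t k.+1 <= phi <= t k] accumulate at the level c; their
    measures are summable, so the layers close to c can be neglected. *)
Lemma caratheodory_sublevel (phi : T -> R) (c : R) :
  (forall x y, phi x - phi y <= dist y x)%R -> hausdorff2 dist setT < +oo ->
  caratheodory_measurable (hausdorff2 dist) [set x | (phi x <= c)%R].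
Proof.
move=> lip fin.
apply: le_caratheodory_measurable => X.
set H := hausdorff2 dist.
have Hfin A : H A \is a fin_num.
  rewrite ge0_fin_numE ?hausdorff2_ge0//.
  by apply: le_lt_trans fin; exact: le_hausdorff2.
pose t k : R := (c + k.+1%:R^-1)%R.
pose a k := H (X `&` [set x | (phi x <= t k)%R]).
pose r k := H (X `&` [set x | (t k.+1 <= phi x <= t k)%R]).
have tS k : (t k.+1 < t k)%R.
  by rewrite ltrD2l ltf_pV2 ?posrE// ltr_nat.
have ra k : r k + a k.+2 <= a k.
  rewrite addeC.
  apply: (le_trans (@hausdorff2_separated (t k.+1 - t k.+2) _ _ _ _)).
  - by rewrite subr_gt0.
  - move=> x y [_ /= hx] [_ /= /andP[hy _]].
    by apply: le_trans (lip y x); rewrite lerB.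
  - apply: le_hausdorff2 => x [[Xx /= hx]|[Xx /= /andP[_ hx]]]; split => //=.
    by rewrite (le_trans hx)// (le_trans (ltW (tS _)))// ltW.
(* Layer k is separated from the sublevel set at [t k.+2], not from the one at [t k.+1]. Hence the
   recursion has step two, and two consecutive values of [a] are kept to telescope over both
   parities. *)
have ps n : \sum_(0 <= k < n) r k + (a n + a n.+1) <= a 0%N + a 1%N.
  elim: n => [|n IH]; first by rewrite big_nil add0e.
  rewrite big_nat_recr//=; apply: le_trans IH; rewrite -addeA leeD2l//.
  by rewrite addeCA addeC leeD2r.
have rge0 k : 0 <= r k by exact: hausdorff2_ge0.
have sr : \sum_(0 <= k <oo) r k < +oo.
  apply: (@le_lt_trans _ _ (a 0%N + a 1%N)); last first.
    by rewrite -ge0_fin_numE ?adde_ge0 ?hausdorff2_ge0// fin_numD !Hfin.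
  apply: lime_le; first by apply: is_cvg_nneseries.
  apply: nearW => n; apply: le_trans (ps n).
  by rewrite leeDl// adde_ge0// hausdorff2_ge0.
have tail := nneseries_tail_cvg sr (fun k _ => rge0 k).
set A := [set x | (phi x <= c)%R].
(* The part [B] of X where phi is at least [t n] lies at distance [t n - c] from the sublevel set;
   what remains of X above c is covered by the layers from n on. *)
have key n : H (X `&` A) + H (X `&` ~` A) <= H X + \sum_(n <= k <oo) r k.
  pose B := X `&` [set x | (t n <= phi x)%R].
  have AB : H (X `&` A) + H B <= H X.
    apply: (le_trans (@hausdorff2_separated (t n - c) _ _ _ _)).
    - by rewrite /t addrC addKr invr_gt0.
    - move=> x y [_ /= hx] [_ /= hy].
      by apply: le_trans (lip y x); rewrite lerB.
    - by apply: le_hausdorff2 => x [[]|[]].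
  apply: le_trans (leeD AB (lexx _)); rewrite -addeA leeD2l//.
  pose S k := if k is k'.+1 then X `&` [set x | t (n + k').+1 <= phi x <= t (n + k')%N]%R
              else B.
  have cov : X `&` ~` A `<=` \bigcup_k S k.
    move=> x [Xx] /= /negP; rewrite -ltNge => cx.
    have [tx|xt] := leP (t n) (phi x); first by exists 0%N.
    have ex : exists m, (t m <= phi x)%R.
      exists (truncn (phi x - c)^-1).
      rewrite /t -lerBrDl -[leRHS]invrK lef_pV2 ?posrE ?invr_gt0 ?subr_gt0//.
      by rewrite ltW// truncnS_gt.
    case: (ex_minnP ex) => m tm mmin.
    have nm : (n < m)%N.
      rewrite ltnNge; apply/negP => mn.
      suff : (t n <= t m)%R by move=> /(le_trans)/(_ tm); rewrite leNgt xt.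
      by rewrite lerD2l lef_pV2 ?posrE// ler_nat.
    case: m => // m in tm mmin nm *.
    exists (m - n).+1 => //=; split => //=.
    rewrite subnKC// tm/= leNgt; apply/negP => /ltW /mmin; by rewrite ltnn.
  apply: le_trans (le_hausdorff2 dist cov) _.
  apply: le_trans (hausdorff2_sigma_subadditive dist S) _.
  rewrite nneseries_recl//; last by move=> *; exact: hausdorff2_ge0.
  rewrite leeD2l//= -(nneseries_addn 1)//; last by move=> ?; exact: hausdorff2_ge0.
  rewrite -(nneseries_addn n)//; apply: lee_nneseries => k _ //.
    by move=> _; exact: hausdorff2_ge0.
  by rewrite /r addn1 addnC.
have cv : (fun n => H X + \sum_(n <= k <oo) r k) @ \oo --> H X + 0.
  apply: cvgeD; [|exact: cvg_cst|exact: tail].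
  by rewrite fin_num_adde_defr.
rewrite -[leRHS]adde0 -(cvg_lim _ cv)//.
by apply: lime_ge; [apply/cvg_ex; exists (H X + 0)|exact: nearW].
Qed.

(** Pulling a cover back by an isometry does not increase diameters. Surjectivity is not assumed,
    whence only an inequality. *)
Lemma hausdorff2_preimage (f : T -> T) A :
  (forall x y, dist (f x) (f y) = dist x y) ->
  hausdorff2 dist (f @^-1` A) <= hausdorff2 dist A.
Proof.
move=> fd; apply: ge_ereal_sup => _ [d /= d0 <-].
apply: (le_trans _ (hausdorff2_at_le _ d0)).
have dm U : diam dist (f @^-1` U) <= diam dist U.
  rewrite /diam ge_max !le_max lexx/=; apply/orP; right.
  apply: ereal_sup_le => _ [x Ux [y Uy <-]].
  by exists (f x) => //; exists (f y) => //; rewrite fd.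
apply: le_ereal_inf_tmp => _ [U [Ud AU] <-]; apply: ge_ereal_inf.
exists (\sum_(k <oo) disc_area dist (f @^-1` U k)).
  exists (fun k => f @^-1` U k) => //; split.
    by move=> k; exact: le_trans (Ud k).
  by move=> x /AU[k _ Ux]; exists k.
apply: lee_nneseries => [k _ _|k _]; first exact: disc_area_ge0.
rewrite /disc_area lee_pmul2l ?fin_numE// ?lte_fin ?divr_gt0 ?pi_gt0//.
by rewrite !expe2 lee_pmul ?diam_ge0.
Qed.

End metric_outer_measure.

Section finite_covers.
Context {R : realType} {T : pointedType} (dist : T -> T -> R).
Local Open Scope ereal_scope.

Lemma hausdorff2_at_finite_cover (delta : R) (I : finType) (U : I -> set T) A :
  (0 <= delta)%R ->
  (forall i, diam dist (U i) <= delta%:E) -> A `<=` \bigcup_i U i ->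
  hausdorff2_at dist delta A <= (#|I|%:R * (pi / 4 * delta ^+ 2))%:E.
Proof.
move=> d0 Ud AU.
pose V k := oapp (fun j : 'I_#|I| => U (enum_val j)) set0 (insub k).
have Vd k : diam dist (V k) <= delta%:E.
  by rewrite /V; case: insubP => [j _ _|_] //=; rewrite diam0 lee_fin.
apply: (@le_trans _ _ (\sum_(k <oo) disc_area dist (V k))).
  apply: ereal_inf_lbound; exists V => //; split => // x /AU[i _ Uix].
  exists (enum_rank i) => //; rewrite /V.
  by case: insubP => [j _ /val_inj -> /=|]; rewrite ?enum_rankK ?ltn_ord.
rewrite (nneseries_split 0 #|I|); last by move=> k _; exact: disc_area_ge0.
rewrite [X in _ + X]eseries0 ?adde0; last first.
  move=> k; rewrite add0n => Ik _; rewrite /V insubF ?disc_area0//.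
  by apply/negbTE; rewrite -leqNgt.
rewrite add0n mulr_natl; apply: (@le_trans _ _ (\sum_(0 <= k < #|I|) (pi / 4 * delta ^+ 2)%:E)).
  apply: lee_sum => k _; rewrite /disc_area [leRHS]EFinM lee_pmul2l ?fin_numE// ?lte_fin ?divr_gt0 ?pi_gt0//.
  by rewrite expe2 expr2 EFinM lee_pmul ?diam_ge0.
by rewrite sumEFin sumr_const_nat subn0.
Qed.

End finite_covers.

(** * Finite area of the sphere and measurability of its open sets *)

Section sphere_coordinates.
Context {R : realType}.
Notation S2 := (sphere R).
Implicit Types p q : S2.

Lemma enorm_coord (u : 'rV[R]_3) i : `|u 0 i| <= enorm u.
Proof.
rewrite -sqrtr_sqr ler_sqrt ?dot_ge0// /dot (bigD1 i)//= -expr2 lerDl.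
by apply: sumr_ge0 => j _; rewrite -expr2 sqr_ge0.
Qed.

Lemma normr_le_enorm (u : 'rV[R]_3) : `|u| <= enorm u.
Proof.
rewrite /Num.Def.normr/= mx_normrE; apply: bigmax_le => [|[i j] _ /=]; first exact: enorm_ge0.
by rewrite (ord1 i) enorm_coord.
Qed.

Lemma ord3P (P : 'I_3 -> Prop) : P 0 -> P 1 -> P 2%:R -> forall i, P i.
Proof.
move=> P0 P1 P2 [[|[|[|//]]] hi].
- by rewrite (_ : Ordinal hi = 0)//; exact: val_inj.
- by rewrite (_ : Ordinal hi = 1)//; exact: val_inj.
- by rewrite (_ : Ordinal hi = 2%:R)//; exact: val_inj.
Qed.

Lemma sphere_dot p : dot (val p) (val p) = 1.
Proof. exact/eqP/(valP p). Qed.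

Lemma enorm_sphere p : enorm (val p) = 1.
Proof. by rewrite /enorm sphere_dot sqrtr1. Qed.

Lemma sphere_coord_le1 p i : `|val p 0 i| <= 1.
Proof. by apply: le_trans (enorm_coord _ i) _; rewrite enorm_sphere. Qed.

Lemma sphere_coord_lip p q i : `|val p 0 i - val q 0 i| <= sdist p q.
Proof.
by have := enorm_coord (val p - val q) i; rewrite mxE [X in _ + X]mxE.
Qed.

(** Addition in ['I_3] is modulo 3: writing the coordinates as i, i + 1, i + 2 lets a single
    computation serve all three axes. *)
Lemma dot_cyclic (u : 'rV[R]_3) i :
  dot u u = u 0 i ^+ 2 + u 0 (i + 1) ^+ 2 + u 0 (i + 2%:R) ^+ 2.
Proof.
rewrite dotE.
have [e1 [e2 [e3 e4]]] : (1 + 1 = 2%:R :> 'I_3) /\ (1 + 2%:R = 0 :> 'I_3) /\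
    (2%:R + 1 = 0 :> 'I_3) /\ (2%:R + 2%:R = 1 :> 'I_3).
  by do !split; exact: val_inj.
by elim/ord3P: i; rewrite ?add0r ?e1 ?e2 ?e3 ?e4; ring.
Qed.

Lemma sphere_sqr p i :
  val p 0 i ^+ 2 + val p 0 (i + 1) ^+ 2 + val p 0 (i + 2%:R) ^+ 2 = 1.
Proof.
by rewrite -dot_cyclic sphere_dot.
Qed.

Lemma continuous_lipschitz_sphere (V : normedModType R) (f : S2 -> V) (L : R) :
  (forall p q, `|f p - f q| <= L * sdist p q) -> continuous f.
Proof.
move=> fL p; apply/(@cvgrPdist_lt _ _ _ _ (fmap_filter _ (nbhs_filter p))) => e e0; apply/nbhs_ballP.
exists (e / (`|L| + 1)); first by rewrite /= divr_gt0// ltr_wpDl.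
move=> q; rewrite ballEmdist/= => pq; apply: le_lt_trans (fL p q) _.
rewrite ltr_pdivlMr ?ltr_wpDl// in pq; apply: le_lt_trans pq.
by rewrite mulrC ler_wpM2l ?enorm_ge0// (le_trans (ler_norm _))// lerDl.
Qed.

Lemma continuous_sphere_val : continuous (fun p => val p : 'rV[R]_3).
Proof.
apply: (@continuous_lipschitz_sphere _ _ 1) => p q; rewrite mul1r.
exact: normr_le_enorm.
Qed.

(* A cell of the grid of mesh [1 / n] on the spherical cap on which the [i]-th
   coordinate has sign [s] and absolute value at least 1/2. *)
Let cell n (k : 'I_3 * bool * 'I_(2 * n).+1 * 'I_(2 * n).+1) : set S2 :=
  let: (i, s, a, b) := k in
  [set p : S2 | [/\ 1 / 2 <= (-1) ^+ s * val p 0 i,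
    a%:R <= (val p 0 (i + 1) + 1) * n%:R <= a.+1%:R &
    b%:R <= (val p 0 (i + 2%:R) + 1) * n%:R <= b.+1%:R]].

Let cell_cover n : setT `<=` \bigcup_k cell (n := n) k.
Proof.
move=> p _.
have [i hi] : exists i, 1 / 2 <= `|val p 0 i|.
  apply: contrapT => /forallNP h.
  have := sphere_sqr p 0; rewrite -!(real_normK (num_real (val p 0 _))).
  have hh i : `|val p 0 i| ^+ 2 <= 1 / 4.
    have := h i => /negP; rewrite -ltNge => {}h.
    have := normr_ge0 (val p 0 i); nra.
  have := hh 0; have := hh (0 + 1); have := hh (0 + 2%:R); lra.
have tr (j : 'I_3) : (trunc ((val p 0 j + 1) * n%:R)%R < (2 * n).+1)%N.
  have := sphere_coord_le1 p j; rewrite ler_norml => /andP[_ h].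
  have n0 := ler0n R n.
  rewrite ltnS truncn_le_nat -natr1 natrM; nra.
have tr0 (j : 'I_3) : 0 <= (val p 0 j + 1) * n%:R.
  have := sphere_coord_le1 p j; rewrite ler_norml => /andP[h _].
  rewrite mulr_ge0//; lra.
exists (i, val p 0 i < 0, Ordinal (tr (i + 1)), Ordinal (tr (i + 2%:R))) => //=.
split.
- by case: (ltP (val p 0 i) 0) hi => h; rewrite ?expr1 ?expr0 ?mulN1r ?mul1r ?(ltr0_norm h)// ger0_norm.
- by have /andP[-> /ltW] := truncn_itv (tr0 (i + 1)).
- by have /andP[-> /ltW] := truncn_itv (tr0 (i + 2%:R)).
Qed.

(** Two coordinates vary by at most 1/n in a cell. For the remaining one, x^2 - x'^2 is controlled
    by the other two and |x + x'| >= 1, since x and x' have the same sign and modulus at least 1/2;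
    this gives |x - x'| <= 4/n. Finally 16 + 1 + 1 <= 25. *)
Let cell_diam n k p q : (0 < n)%N ->
  cell (n := n) k p -> cell k q -> sdist p q <= 5 / n%:R.
Proof.
move: k => [[[i s] a] b] n0 /= [p1 /andP[p2 p3] /andP[p4 p5]] [q1 /andP[q2 q3] /andP[q4 q5]].
have n0' : 0 < n%:R :> R by rewrite ltr0n.
rewrite ler_pdivlMr// -(@ler_pXn2r _ 2) ?nnegrE ?mulr_ge0 ?enorm_ge0// exprMn /sdist /edist sqr_enorm.
have -> : dot (val p - val q) (val p - val q) = (val p 0 i - val q 0 i) ^+ 2 +
    (val p 0 (i + 1) - val q 0 (i + 1)) ^+ 2 + (val p 0 (i + 2%:R) - val q 0 (i + 2%:R)) ^+ 2.
  by rewrite (dot_cyclic _ i) !mxE.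
have := sphere_sqr p i; have := sphere_sqr q i.
have := sphere_coord_le1 p (i + 1); have := sphere_coord_le1 q (i + 1).
have := sphere_coord_le1 p (i + 2%:R); have := sphere_coord_le1 q (i + 2%:R).
move: p1 p2 p3 p4 p5 q1 q2 q3 q4 q5.
set x := val p 0 i; set y := val p 0 (i + 1); set z := val p 0 (i + 2%:R).
set x' := val q 0 i; set y' := val q 0 (i + 1); set z' := val q 0 (i + 2%:R).
move=> p1 p2 p3 p4 p5 q1 q2 q3 q4 q5.
rewrite !ler_norml => /andP[z1 z2] /andP[z3 z4] /andP[z5 z6] /andP[z7 z8] e' e.
have sqr_le (c t : R) : -c <= t <= c -> t ^+ 2 <= c ^+ 2.
  by move=> /andP[h1 h2]; rewrite !expr2; nra.
have yy : -1 <= (y - y') * n%:R <= 1.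
  rewrite -natr1 in p3 q3 *; apply/andP; split; lra.
have zz : -1 <= (z - z') * n%:R <= 1.
  by rewrite -natr1 in p5 q5 *; apply/andP; split; lra.
have xx : -4 <= (x - x') * n%:R <= 4.
  have : (x - x') * n%:R * (x + x') =
    - ((y - y') * n%:R * (y + y')) - ((z - z') * n%:R * (z + z')).
    have : x ^+ 2 - x' ^+ 2 = (y' ^+ 2 - y ^+ 2) + (z' ^+ 2 - z ^+ 2) by lra.
    move=> h; transitivity ((x ^+ 2 - x' ^+ 2) * n%:R); first by ring.
    by rewrite h; ring.
  move: yy zz; set X := (x - x') * n%:R; set Y := (y - y') * n%:R; set Z := (z - z') * n%:R.
  move=> /andP[Y1 Y2] /andP[Z1 Z2] h.
  have prod (v w : R) : -1 <= v -> v <= 1 -> -2 <= w -> w <= 2 -> -2 <= v * w <= 2.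
    by move=> v1 v2 w1 w2; apply/andP; split; nra.
  have Y4 : -2 <= Y * (y + y') <= 2 by apply: prod => //; lra.
  have Z4 : -2 <= Z * (z + z') <= 2 by apply: prod => //; lra.
  move: Y4 Z4 => /andP[Y5 Y6] /andP[Z5 Z6].
  by move: p1 q1; case: s => /=; rewrite ?expr1 ?expr0 => p1 q1;
    apply/andP; split; move: h p1 q1 Y5 Y6 Z5 Z6 {p2 p3 p4 p5 q2 q3 q4 q5};
    move: (Y * _) (Z * _) => A B h p1 q1 Y5 Y6 Z5 Z6; nra.
rewrite (_ : _ * n%:R ^+ 2 = ((x - x') * n%:R) ^+ 2 + ((y - y') * n%:R) ^+ 2 +
  ((z - z') * n%:R) ^+ 2); last by ring.
move: xx yy zz.
set X := (x - x') * n%:R; set Y := (y - y') * n%:R; set Z := (z - z') * n%:R.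
move=> /andP[X1 X2] /andP[Y1 Y2] /andP[Z1 Z2].
have h1 : X ^+ 2 <= 4 ^+ 2 by apply: sqr_le; rewrite X1.
have h2 : Y ^+ 2 <= 1 ^+ 2 by apply: sqr_le; rewrite Y1.
have h3 : Z ^+ 2 <= 1 ^+ 2 by apply: sqr_le; rewrite Z1.
by rewrite !expr2 in h1 h2 h3 *; lra.
Qed.

Lemma surface_measure_fin : surface_measure [set: S2] \is a fin_num.
Proof.
rewrite ge0_fin_numE ?hausdorff2_ge0//.
(* There are 6 (2n + 1)^2 <= 6 * 9 n^2 cells, each of disc area at most pi/4 * 25/n^2, so the
   factors n^2 cancel. *)
apply: (@le_lt_trans _ _ (6 * 9 * (pi / 4 * 25))%:E); last by rewrite ltry.
apply: ge_ereal_sup => _ [d /= d0 <-].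
pose n := (trunc (5 / d)).+1.
have n0 : 0 < n%:R :> R by rewrite ltr0n.
have nd : 5 / n%:R <= d.
  by rewrite ler_pdivrMr// mulrC -ler_pdivrMr// ltW// truncnS_gt.
apply: le_trans (le_hausdorff2_at_delta _ _ nd) _.
apply: le_trans (hausdorff2_at_finite_cover _ _ (@cell_cover n)) _.
- by rewrite divr_ge0.
- move=> k; rewrite /diam ge_max lee_fin divr_ge0//=.
  by apply: ge_ereal_sup => _ [p kp [q kq <-]]; rewrite lee_fin; apply: (@cell_diam n k).
- rewrite lee_fin !card_prod !card_ord card_bool.
  rewrite expr_div_n [X in _ * X <= _]mulrA [leLHS]mulrA ler_pdivrMr ?exprn_gt0//.
  rewrite !natrM (_ : (2 * n).+1%:R = 2 * n%:R + 1 :> R); last by rewrite -natr1 natrM.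
  have n1 : 1 <= n%:R :> R by rewrite ler1n.
  have p0 : 0 <= pi / 4 :> R by rewrite divr_ge0 ?pi_ge0.
  rewrite (_ : 5 ^+ 2 = 25 :> R); last by rewrite expr2 -natrM.
  rewrite [leRHS]mulrAC ler_wpM2r ?mulr_ge0 ?pi_ge0//.
  by rewrite expr2; nra.
Qed.

Lemma measurable_lipschitz_sublevel (phi : S2 -> R) c :
  (forall p q, phi p - phi q <= sdist q p) -> measurable [set p | phi p <= c].
Proof.
move=> h; apply: caratheodory_sublevel => //.
by rewrite -ge0_fin_numE ?hausdorff2_ge0//; exact: surface_measure_fin.
Qed.

(** The distance to the complement is 1-Lipschitz, and the complement of an open set is its sublevel
    set at 0. *)
Lemma measurable_open_sphere (O : set S2) : open O -> measurable O.
Proof.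
move=> oO; have [|/set0P[q0 q0O]] := eqVneq (~` O) set0.
  by move=> O0; rewrite -(setCK O) O0 setC0.
pose D p := [set sdist p q | q in ~` O].
pose phi p := inf (D p).
have lb p : has_inf (D p).
  split; first by exists (sdist p q0); exists q0.
  by exists 0 => _ [q _ <-]; exact: enorm_ge0.
have -> : O = ~` [set p | phi p <= 0].
  apply/seteqP; split => p /=.
    move=> Op /= ph.
    have /nbhs_ballP[e /= e0 pO] : nbhs p O by exact: open_nbhs_nbhs.
    suff : e <= phi p by apply/negP; rewrite -ltNge (le_lt_trans ph).
    apply: lb_le_inf; first by have [] := lb p.
    move=> _ [q /= Oq <-]; rewrite leNgt; apply/negP => pq; apply: Oq; apply: pO.
    by rewrite ballEmdist.
  move=> ph; apply: contrapT => Op; apply: ph.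
  apply: ge_inf; first by have [] := lb p.
  by exists p => //; rewrite sdistxx.
apply: measurableC; apply: measurable_lipschitz_sublevel => p q.
rewrite lerBlDl -lerBlDr; apply: lb_le_inf; first by have [] := lb q.
move=> _ [r Or <-]; rewrite lerBlDr.
apply: (@le_trans _ _ (sdist p r)); first by apply: ge_inf; [have [] := lb p|exists r].
by rewrite addrC (sdist_sym q p) sdist_triangle.
Qed.

Lemma measurable_continuous_sphere (g : S2 -> R) : continuous g ->
  measurable_fun setT g.
Proof.
move=> /continuousP cg; apply: (measurability _ (measurable_realfun.RGenOpens.measurableE R)).
move=> _ [_ [a [b -> <-]]]; rewrite setTI; apply: measurable_open_sphere.
by apply: cg; exact: interval_open.
Qed.

End sphere_coordinates.

(** * Rotations about the coordinate axes and invariance of the surface measure *)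

Section rotations.
Context {R : realType}.
Notation S2 := (sphere R).
Notation mu := (@surface_measure R).
Implicit Types (p q : S2) (i j : 'I_3) (s : R).

(** The rotation by the angle 2 arctan s, with [c] its cosine and [d] its sine. Being rational in s,
    it turns a quadratic form along an orbit into a polynomial in s divided by (1 + s^2)^2. *)
Definition rotv i s (u : 'rV[R]_3) : 'rV[R]_3 :=
  let c := (1 - s ^+ 2) / (1 + s ^+ 2) in
  let d := 2 * s / (1 + s ^+ 2) in
  \row_j if j == i then u 0 i
         else if j == i + 1 then c * u 0 (i + 1) - d * u 0 (i + 2%:R)
         else d * u 0 (i + 1) + c * u 0 (i + 2%:R).

Lemma ord3_neq i : (i + 1 == i = false) * (i + 2%:R == i = false) *
  (i + 2%:R == i + 1 = false).
Proof. by elim/ord3P: i. Qed.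

Lemma rotvE i s (u : 'rV[R]_3) :
  [/\ rotv i s u 0 i = u 0 i,
      rotv i s u 0 (i + 1) = (1 - s ^+ 2) / (1 + s ^+ 2) * u 0 (i + 1) -
                             2 * s / (1 + s ^+ 2) * u 0 (i + 2%:R) &
      rotv i s u 0 (i + 2%:R) = 2 * s / (1 + s ^+ 2) * u 0 (i + 1) +
                                (1 - s ^+ 2) / (1 + s ^+ 2) * u 0 (i + 2%:R)].
Proof. by split; rewrite mxE ?eqxx ?ord3_neq. Qed.

Lemma onesqr_neq0 s : 1 + s ^+ 2 != 0.
Proof. by rewrite gt_eqF// ltr_wpDr// sqr_ge0. Qed.

Lemma row3P i (u v : 'rV[R]_3) : u 0 i = v 0 i -> u 0 (i + 1) = v 0 (i + 1) ->
  u 0 (i + 2%:R) = v 0 (i + 2%:R) -> u = v.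
Proof.
move=> e0 e1 e2; apply/rowP => j.
have : [|| j == i, j == i + 1 | j == i + 2%:R].
  by elim/ord3P: i {e0 e1 e2}; elim/ord3P: j.
by case/or3P => /eqP ->.
Qed.

Lemma rotvB i s (u v : 'rV[R]_3) : rotv i s (u - v) = rotv i s u - rotv i s v.
Proof.
have [a0 a1 a2] := rotvE i s (u - v).
have [b0 b1 b2] := rotvE i s u; have [c0 c1 c2] := rotvE i s v.
have e j (x y : 'rV[R]_3) : (x - y) 0 j = x 0 j - y 0 j by rewrite !mxE.
apply: (@row3P i); rewrite !e ?a0 ?a1 ?a2 ?b0 ?b1 ?b2 ?c0 ?c1 ?c2 ?e //; ring.
Qed.

Lemma dot_rotv i s (u : 'rV[R]_3) : dot (rotv i s u) (rotv i s u) = dot u u.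
Proof.
have [b0 b1 b2] := rotvE i s u.
rewrite !(dot_cyclic _ i) b0 b1 b2; field; exact: onesqr_neq0.
Qed.

Lemma rotvK i s : cancel (rotv i s) (rotv i (- s)).
Proof.
move=> u; have [b0 b1 b2] := rotvE i s u.
have [c0 c1 c2] := rotvE i (- s) (rotv i s u).
have s0 := onesqr_neq0 s.
apply: (@row3P i); rewrite ?c0 ?c1 ?c2 ?b0 ?b1 ?b2 ?sqrrN//; by field.
Qed.

Lemma rotv_sphere i s p : dot (rotv i s (val p)) (rotv i s (val p)) == 1.
Proof. by rewrite dot_rotv; exact: (valP p). Qed.

Definition rot i s p : S2 :=
  exist (fun u : 'rV[R]_3 => is_true (dot u u == 1)) _ (rotv_sphere i s p).

Lemma rotK i s : cancel (rot i s) (rot i (- s)).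
Proof. by move=> p; apply: val_inj; rewrite /= rotvK. Qed.

Lemma rotNK i s : cancel (rot i (- s)) (rot i s).
Proof. by move=> p; have := rotK i (- s) p; rewrite opprK. Qed.

Lemma sdist_rot i s p q : sdist (rot i s p) (rot i s q) = sdist p q.
Proof.
change (enorm (rotv i s (val p) - rotv i s (val q)) = enorm (val p - val q)).
by rewrite -rotvB /enorm dot_rotv.
Qed.

Lemma surface_measure_rot i s (A : set S2) : mu (rot i s @^-1` A) = mu A.
Proof.
apply/eqP; rewrite eq_le hausdorff2_preimage; last exact: sdist_rot.
rewrite -[X in (mu X <= _)%E](_ : rot i (- s) @^-1` (rot i s @^-1` A) = A).
  by rewrite hausdorff2_preimage//; exact: sdist_rot.
by apply/seteqP; split => p /=; rewrite rotNK.
Qed.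

(** Continuity would settle Borel sets only. The measurable sets being those that cut every X
    additively, the condition for the preimage at X is transported to the condition for A at the
    rotated set [Y]. *)
Lemma measurable_rot i s : measurable_fun setT (rot i s).
Proof.
move=> _ A mA; rewrite setTI; apply: le_caratheodory_measurable => X.
pose Y := rot i (- s) @^-1` X.
have e B : X `&` rot i s @^-1` B = rot i s @^-1` (Y `&` B).
  by apply/seteqP; split => p /=; rewrite /Y/= rotK.
rewrite e -[~` _](_ : rot i s @^-1` (~` A) = _)// e.
rewrite [X in (X + _ <= _)%E](surface_measure_rot i s).
rewrite [X in (_ + X <= _)%E](surface_measure_rot i s).
rewrite [X in (_ <= X)%E](_ : _ = mu Y); last by rewrite surface_measure_rot.
by rewrite -[leRHS]/(hausdorff2 (@sdist R) Y) (mA Y).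
Qed.

Lemma integral_rot i s (f : S2 -> R) : measurable_fun setT f ->
  \int[mu]_p f (rot i s p) = \int[mu]_p f p.
Proof.
move=> mf; rewrite /Rintegral; congr fine.
have ge0 (g : S2 -> \bar R) : measurable_fun setT g -> (forall p, 0 <= g p)%E ->
    (\int[mu]_p g (rot i s p) = \int[mu]_p g p)%E.
  move=> mg g0.
  transitivity (\int[pushforward mu (rot i s)]_p g p)%E.
    by rewrite (ge0_integral_pushforward (measurable_rot i s)).
  have mr := measurable_rot i s.
  by apply: (eq_measure_integral mu) => A mA _; exact: surface_measure_rot.
have mf' : measurable_fun setT (EFin \o f) by exact/measurable_EFinP.
rewrite [LHS]integralE [RHS]integralE; congr (_ - _)%E.
  apply: etrans (ge0 _ (measurable_funepos mf') _) => [|p]; last exact: funepos_ge0.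
  by apply: eq_integral => p _; rewrite !funeposE.
apply: etrans (ge0 _ (measurable_funeneg mf') _) => [|p]; last exact: funeneg_ge0.
by apply: eq_integral => p _; rewrite !funenegE.
Qed.

(* Summing the indicators of M rotated copies of E gives M mu(E) <= k mu(S^2). *)
Lemma null_of_bounded_returns i (E : set S2) (k : nat) : measurable E ->
  (forall p (M : nat), (\sum_(m < M) \1_E (rot i m%:R p) <= k%:R :> R)) ->
  mu E = 0%E.
Proof.
move=> mE h.
have key M : (M%:R%:E * mu E <= k%:R%:E * mu setT)%E.
  have -> : (M%:R%:E * mu E = \int[mu]_p (\sum_(m < M) \1_E (rot i m%:R p))%:E)%E.
    have mI m : measurable_fun setT (fun p => (\1_E (rot i m%:R p) : R)%:E).
      by apply/measurable_EFinP; apply: measurableT_comp;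
        [exact: measurable_indic|exact: measurable_rot].
    transitivity (\sum_(m < M) \int[mu]_p (\1_E (rot i m%:R p))%:E)%E; last first.
      rewrite -(@ge0_integral_sum _ _ _ mu _ measurableT _
        (fun m : 'I_M => fun p => (\1_E (rot i m%:R p))%:E)).
      - by apply: eq_integral => p _; rewrite sumEFin.
      - by move=> m; exact: mI.
      - by move=> m p _; rewrite lee_fin.
    rewrite (eq_bigr (fun=> mu E)).
      by rewrite sumr_const card_ord mule_natl.
    move=> m _.
    have mrE : measurable (rot i m%:R @^-1` E).
      by rewrite -[_ @^-1` _]setTI; exact: (measurable_rot i m%:R measurableT mE).
    transitivity (\int[mu]_p (\1_(rot i m%:R @^-1` E) p)%:E)%E.
      by apply: eq_integral.
    rewrite integral_indic// setIT; exact: surface_measure_rot.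
  have -> : (k%:R%:E * mu setT = \int[mu]_p (k%:R)%:E)%E by rewrite integral_cst.
  apply: ge0_le_integral; first by [].
  - by move=> p _; rewrite lee_fin sumr_ge0.
  - apply/measurable_EFinP; apply: measurable_sum => m.
    by apply: measurableT_comp; [exact: measurable_indic|exact: measurable_rot].
  - exact: measurable_cst.
  - by move=> p _; rewrite lee_fin.
have fin : mu E \is a fin_num.
  have : (mu setT < +oo)%E by rewrite -ge0_fin_numE ?surface_measure_fin.
  by rewrite ge0_fin_numE//; apply: le_lt_trans; apply: le_measure; rewrite ?inE.
rewrite -(fineK fin); congr EFin.
have fin' := @surface_measure_fin R.
rewrite -(fineK fin) -(fineK fin') in key.
set e := fine (mu E) in key *; set C := fine (mu setT) in key.
have e0 : 0 <= e by exact: fine_ge0.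
apply/eqP; rewrite eq_le e0 andbT leNgt; apply/negP => e1.
have := key (trunc (k%:R * C / e)).+1; rewrite -!EFinM lee_fin leNgt => /negP; apply.
by rewrite -ltr_pdivrMr// truncnS_gt.
Qed.

End rotations.

(** * Zero sets of quadratic forms on the sphere *)

Section quadrics.
Context {R : realType}.
Notation S2 := (sphere R).
Notation mu := (@surface_measure R).
Implicit Types (p q : S2) (i j : 'I_3) (s : R) (A : 'M[R]_3) (c : R).

Definition quad A c (u : 'rV[R]_3) : R :=
  \sum_i \sum_j A i j * (u 0 i * u 0 j) + c.

Lemma big_ord3 (F : 'I_3 -> R) i :
  \sum_j F j = F i + F (i + 1) + F (i + 2%:R).
Proof.
rewrite (_ : \sum_j F j = F 0 + F 1 + F 2%:R); last first.
  rewrite !big_ord_recr big_ord0 /= add0r.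
  by congr (_ + _ + _); congr F; exact: val_inj.
have [e1 [e2 [e3 e4]]] : (1 + 1 = 2%:R :> 'I_3) /\ (1 + 2%:R = 0 :> 'I_3) /\
    (2%:R + 1 = 0 :> 'I_3) /\ (2%:R + 2%:R = 1 :> 'I_3).
  by do !split; exact: val_inj.
by elim/ord3P: i; rewrite ?add0r ?e1 ?e2 ?e3 ?e4; ring.
Qed.

Lemma quadE A c (u : 'rV[R]_3) i : quad A c u =
  A i i * u 0 i ^+ 2 + A (i + 1) (i + 1) * u 0 (i + 1) ^+ 2 +
  A (i + 2%:R) (i + 2%:R) * u 0 (i + 2%:R) ^+ 2 +
  (A i (i + 1) + A (i + 1) i) * (u 0 i * u 0 (i + 1)) +
  (A i (i + 2%:R) + A (i + 2%:R) i) * (u 0 i * u 0 (i + 2%:R)) +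
  (A (i + 1) (i + 2%:R) + A (i + 2%:R) (i + 1)) * (u 0 (i + 1) * u 0 (i + 2%:R)) + c.
Proof. by rewrite /quad (big_ord3 _ i) !(big_ord3 (fun j => A _ j * _) i); ring. Qed.

Lemma measurable_sphere_coord i : measurable_fun setT (fun p => val p 0 i : R).
Proof.
apply: measurable_continuous_sphere.
apply: (@continuous_lipschitz_sphere _ R^o _ 1) => p q; rewrite mul1r.
exact: sphere_coord_lip.
Qed.

Lemma measurable_quad A c : measurable_fun setT (fun p : S2 => quad A c (val p)).
Proof.
apply: measurable_funD; last exact: measurable_cst.
apply: measurable_sum => i; apply: measurable_sum => j.
apply: measurable_funM; first exact: measurable_cst.
by apply: measurable_funM; exact: measurable_sphere_coord.
Qed.

Lemma count_roots (Q : {poly R}) k (M : nat) : Q != 0 -> (size Q <= k.+1)%N ->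
  \sum_(m < M) (root Q m%:R)%:R <= k%:R :> R.
Proof.
move=> Q0 Qk; rewrite -natr_sum ler_nat -ltnS; apply: leq_trans Qk.
pose rs := [seq m%:R | m <- iota 0 M & root Q m%:R] : seq R.
have -> : (\sum_(m < M) root Q m%:R)%N = size rs.
  transitivity (\sum_(0 <= m < M) (root Q m%:R : nat))%N; first by rewrite big_mkord.
  rewrite /index_iota subn0 size_map size_filter -sum1_count [RHS]big_mkcond.
  by apply: eq_bigr => m _; case: root.
apply: max_poly_roots => //.
  by apply/allP => _ /mapP[m + ->]; rewrite mem_filter => /andP[].
rewrite map_inj_uniq ?filter_uniq ?iota_uniq// => m n /eqP.
by rewrite eqr_nat => /eqP.
Qed.

(** [Q] is (1 + s^2)^2 times the form at the rotated point. If it vanishes identically for one p off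
    the poles and the equator of the axis, then the form is invariant under all rotations about that
    axis, which is what the four equations say. *)
Lemma quad_rot_root A c i p : exists2 Q : {poly R}, (size Q <= 5)%N &
  (forall s, quad A c (rotv i s (val p)) = 0 -> root Q s) /\
  (Q = 0 -> val p 0 i != 0 -> val p 0 i ^+ 2 != 1 ->
    [/\ A (i + 1) (i + 1) = A (i + 2%:R) (i + 2%:R),
        A i (i + 1) + A (i + 1) i = 0, A i (i + 2%:R) + A (i + 2%:R) i = 0 &
        A (i + 1) (i + 2%:R) + A (i + 2%:R) (i + 1) = 0]).
Proof.
set B := A (i + 1) (i + 1); set C := A (i + 2%:R) (i + 2%:R).
set D := A i (i + 1) + _; set E := A i (i + 2%:R) + _.
set F := A (i + 1) (i + 2%:R) + _.
have := sphere_sqr p i.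
set x := val p 0 i; set y := val p 0 (i + 1); set z := val p 0 (i + 2%:R).
move=> xyz.
pose a0 := A i i * x ^+ 2 + c.
pose u := x * (D * y + E * z).
pose v := x * (E * y - D * z).
pose g := B * y ^+ 2 + C * z ^+ 2 + F * (y * z).
pose h := 2 * (C - B) * (y * z) + F * (y ^+ 2 - z ^+ 2).
pose k := B * z ^+ 2 + C * y ^+ 2 - F * (y * z).
(* Expansion in powers of s: [a0] comes from the terms fixed by the rotation, [u] and [v] from those
   linear in the two rotating coordinates, [g], [h] and [k] from the quadratic ones. *)
pose l := [:: a0 + u + g; 2 * v + 2 * h; 2 * a0 - 2 * g + 4 * k; 2 * v - 2 * h; a0 - u + g].
exists (Poly l); first exact: size_Poly.
split.
  move=> s; rewrite (quadE _ _ _ i) -/B -/C -/D -/E -/F.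
  have [-> -> ->] := rotvE i s (val p); rewrite -/x -/y -/z => qs.
  rewrite /root horner_Poly /=; apply/eqP.
  have s0 := onesqr_neq0 s.
  transitivity ((1 + s ^+ 2) ^+ 2 * 0 : R); last by rewrite mulr0.
  by rewrite -[in RHS]qs /a0 /u /v /g /h /k; field.
move=> Q0 x0 x1.
have cf n : (Poly l)`_n = 0 by rewrite Q0 coef0.
have := cf 0%N; have := cf 1%N; have := cf 2%N; have := cf 3%N; have := cf 4%N.
rewrite !coef_Poly /= => c4 c3 c2 c1 c0.
have u0 : u = 0 by lra.
have v0 : v = 0 by lra.
have h0 : h = 0 by lra.
have gk : g = k by lra.
have r0 : y ^+ 2 + z ^+ 2 != 0.
  by apply: contra x1 => /eqP yz; apply/eqP; lra.
(* The equations form two linear systems, in (D, E) and in (B - C, F), with determinants y^2 + z^2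
   and (y^2 + z^2)^2, nonzero off the poles. *)
have cancel (t w : R) : t != 0 -> t * w = 0 -> w = 0.
  by move=> t0 /eqP; rewrite mulf_eq0 (negbTE t0) => /eqP.
have DE1 : D * y + E * z = 0 by exact: (cancel x).
have DE2 : E * y - D * z = 0 by exact: (cancel x).
have BC1 : (B - C) * (y ^+ 2 - z ^+ 2) + 2 * F * (y * z) = 0.
  by move: gk; rewrite /g /k => gk; lra.
split.
- apply/eqP; rewrite -subr_eq0; apply/eqP; apply: (cancel ((y ^+ 2 + z ^+ 2) ^+ 2)).
    by rewrite expf_neq0.
  transitivity ((y ^+ 2 - z ^+ 2) * ((B - C) * (y ^+ 2 - z ^+ 2) + 2 * F * (y * z)) - 2 * (y * z) * h); first by rewrite /h; ring.
  by rewrite BC1 h0; ring.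
- apply: (cancel (y ^+ 2 + z ^+ 2)) => //.
  transitivity (y * (D * y + E * z) - z * (E * y - D * z)); first by ring.
  by rewrite DE1 DE2; ring.
- apply: (cancel (y ^+ 2 + z ^+ 2)) => //.
  transitivity (z * (D * y + E * z) + y * (E * y - D * z)); first by ring.
  by rewrite DE1 DE2; ring.
- apply: (cancel ((y ^+ 2 + z ^+ 2) ^+ 2)); first by rewrite expf_neq0.
  transitivity (2 * (y * z) * ((B - C) * (y ^+ 2 - z ^+ 2) + 2 * F * (y * z)) + (y ^+ 2 - z ^+ 2) * h); first by rewrite /h; ring.
  by rewrite BC1 h0; ring.
Qed.

(** The set is at most one point, and is covered by itself as a set of diameter 0. *)
Lemma surface_measure_pole i c : c ^+ 2 = 1 -> mu [set p : S2 | val p 0 i = c] = 0%E.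
Proof.
move=> c1; apply/eqP; rewrite eq_le hausdorff2_ge0 andbT.
apply: ge_ereal_sup => _ [d /= d0 <-].
apply: le_trans (le_hausdorff2_at_delta _ _ (ltW d0)) _.
pose U (_ : unit) := [set p : S2 | val p 0 i = c].
apply: (le_trans (@hausdorff2_at_finite_cover _ _ _ 0 _ U _ _ _ _)) => //.
- case; rewrite /diam ge_max lexx/=; apply: ge_ereal_sup => _ [p pc [q qc <-]].
  rewrite lee_fin.
  suff -> : p = q by rewrite sdistxx.
  apply: val_inj; have := sphere_sqr p i; have := sphere_sqr q i.
  rewrite /U /= in pc qc; rewrite pc qc c1 => q0 p0.
  have z2 (a b : R) : 1 + a ^+ 2 + b ^+ 2 = 1 -> a = 0 /\ b = 0.
    move=> h; have := sqr_ge0 a; have := sqr_ge0 b => b0 a0.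
    by split; apply/eqP; rewrite -[_ == 0](sqrf_eq0); apply/eqP; lra.
  have [q1 q2] := z2 _ _ q0; have [p1 p2] := z2 _ _ p0.
  by apply: (@row3P _ i); rewrite ?pc ?qc ?p1 ?q1 ?p2 ?q2.
- by move=> p pc; exists tt.
- by rewrite expr0n/= !mulr0.
Qed.

(** The i-th coordinate is constant along an orbit. So either the orbit avoids the set altogether,
    or [Q] is a nonzero polynomial of degree at most 4 and there are at most four returns. *)
Lemma quad_null_off_axis A c i :
  ~ [/\ A (i + 1) (i + 1) = A (i + 2%:R) (i + 2%:R),
        A i (i + 1) + A (i + 1) i = 0, A i (i + 2%:R) + A (i + 2%:R) i = 0 &
        A (i + 1) (i + 2%:R) + A (i + 2%:R) (i + 1) = 0] ->
  mu [set p : S2 | [/\ quad A c (val p) = 0, val p 0 i != 0 & val p 0 i ^+ 2 != 1]] = 0%E.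
Proof.
move=> nA; set E := [set p | _].
apply: (@null_of_bounded_returns _ i E 4).
  have -> : E = (fun p => quad A c (val p)) @^-1` [set 0] `&`
      (fun p => val p 0 i) @^-1` (~` [set 0; 1; -1]).
    apply/seteqP; split => p /=.
      move=> [-> x0 x1]; split => //=; case=> [[|] /eqP|/eqP]; first by rewrite (negbTE x0).
        by move=> /eqP e; move: x1; rewrite e expr1n eqxx.
      by move=> /eqP e; move: x1; rewrite e sqrrN expr1n eqxx.
    move=> [qp x01]; split; first exact: qp.
      by apply/eqP => e; apply: x01; left; left.
    by rewrite sqrf_eq1; apply/negP => /orP[] /eqP e; apply: x01; [left; right|right].
  apply: measurableI.
    by rewrite -[_ @^-1` _]setTI; apply: (measurable_quad A c measurableT); exact: measurable_set1.
  rewrite -[_ @^-1` _]setTI; apply: (measurable_sphere_coord i measurableT).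
  by apply: measurableC; do ![apply: measurableU]; exact: measurable_set1.
move=> p M.
have [[x0 x1]|] := pselect (val p 0 i != 0 /\ val p 0 i ^+ 2 != 1).
  have [Q Q5 [Qr Q0]] := quad_rot_root A c i p.
  have Qn0 : Q != 0 by apply/eqP => Qz; apply: nA; exact: Q0.
  apply: le_trans (count_roots M Qn0 Q5); apply: ler_sum => m _.
  rewrite indicE ler_nat; case: (boolP (_ \in E)) => //.
  by rewrite inE => -[/= /Qr ->].
move=> nx; rewrite big1 ?ler0n// => m _; rewrite indicE memNset//.
have [e _ _] := rotvE i m%:R (val p).
by move=> [_ /=]; rewrite e => a b; apply: nx.
Qed.

Let null_subU (A B C : set S2) :
  A `<=` B `|` C -> mu B = 0%E -> mu C = 0%E -> mu A = 0%E.
Proof.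
move=> ABC B0 C0; apply/eqP; rewrite eq_le hausdorff2_ge0 andbT.
apply: le_trans (le_hausdorff2 _ ABC) _.
by apply: le_trans (outer_measureU2 _ _ _) _; rewrite [X in (X + _)%E]B0 [X in (_ + X)%E]C0 adde0.
Qed.

Let null_sqr_coord1 i : mu [set p : S2 | val p 0 i ^+ 2 = 1] = 0%E.
Proof.
apply: (null_subU _ (surface_measure_pole i (expr1n _ 2))
                    (surface_measure_pole i (sqrr_sign R 1))).
by move=> p /= /eqP; rewrite expr1 sqrf_eq1 => /orP[] /eqP; [left|right].
Qed.

(** The equator is invariant under the rotations about its own axis, so it is seen as the zero set
    of the squared coordinate and rotated about the next axis. The points that this leaves out are
    poles of the two other axes. *)
Lemma surface_measure_coord0 i : mu [set p : S2 | val p 0 i = 0] = 0%E.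
Proof.
have [e1 [e2 e3]] : (i + 1) + 1 = i + 2%:R :> 'I_3 /\ (i + 1) + 2%:R = i :> 'I_3 /\ True.
  by elim/ord3P: i; do !split; exact: val_inj.
have := @quad_null_off_axis (delta_mx i i) 0 (i + 1).
rewrite e1 e2 => /(_ _)/wrap[|N0].
  by rewrite !mxE !ord3_neq eqxx /= => -[] /eqP; rewrite eq_sym oner_eq0.
have C0 : mu ([set p : S2 | val p 0 (i + 1) ^+ 2 = 1] `|` [set p : S2 | val p 0 (i + 2%:R) ^+ 2 = 1]) = 0%E.
  exact: (@null_subU _ _ _ _ (null_sqr_coord1 (i + 1)) (null_sqr_coord1 (i + 2%:R))).
apply: (@null_subU _ _ _ _ N0 C0).
move=> p /= pi0; have := sphere_sqr p i; rewrite pi0 expr0n/= add0r => yz.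
  have [y0|y0] := eqVneq (val p 0 (i + 1)) 0.
    by right; right; rewrite -[RHS]yz y0 expr0n/= add0r.
  have [y1|y1] := eqVneq (val p 0 (i + 1) ^+ 2) 1; first by right; left.
  left; split => //; rewrite /quad addr0 (big_ord3 _ i) !(big_ord3 _ i) !mxE !ord3_neq !eqxx/=.
  by rewrite pi0; ring.
Qed.

Let quad_null_axis A c i :
  ~ [/\ A (i + 1) (i + 1) = A (i + 2%:R) (i + 2%:R),
        A i (i + 1) + A (i + 1) i = 0, A i (i + 2%:R) + A (i + 2%:R) i = 0 &
        A (i + 1) (i + 2%:R) + A (i + 2%:R) (i + 1) = 0] ->
  mu [set p : S2 | quad A c (val p) = 0] = 0%E.
Proof.
move=> /(quad_null_off_axis c) N0.
have C0 : mu ([set p : S2 | val p 0 i = 0] `|` [set p : S2 | val p 0 i ^+ 2 = 1]) = 0%E.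
  exact: (@null_subU _ _ _ _ (surface_measure_coord0 i) (null_sqr_coord1 i)).
apply: (@null_subU _ _ _ _ N0 C0) => p /= qp.
have [x0|x0] := eqVneq (val p 0 i) 0; first by right; left.
by have [x1|x1] := eqVneq (val p 0 i ^+ 2) 1; [right; right|left].
Qed.

(* A nonconstant form is nonconstant along the rotations about some axis, and then
   has boundedly many zeros on almost every orbit. *)
Lemma surface_measure_quad0 A c : (exists p : S2, quad A c (val p) != 0) ->
  mu [set p : S2 | quad A c (val p) = 0] = 0%E.
Proof.
move=> [p0 qp0].
have [h0|/(quad_null_axis c)//] := pselect [/\ A (0 + 1) (0 + 1) = A (0 + 2%:R) (0 + 2%:R),
        A 0 (0 + 1) + A (0 + 1) 0 = 0, A 0 (0 + 2%:R) + A (0 + 2%:R) 0 = 0 &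
        A (0 + 1) (0 + 2%:R) + A (0 + 2%:R) (0 + 1) = 0].
have [h1|/(quad_null_axis c)//] := pselect [/\ A (1 + 1) (1 + 1) = A (1 + 2%:R) (1 + 2%:R),
        A 1 (1 + 1) + A (1 + 1) 1 = 0, A 1 (1 + 2%:R) + A (1 + 2%:R) 1 = 0 &
        A (1 + 1) (1 + 2%:R) + A (1 + 2%:R) (1 + 1) = 0].
(* Invariance about two axes equates the diagonal entries and cancels the off-diagonal sums, so the
   form is constant on the sphere. *)
suff q p : quad A c (val p) = A 0 0 + c.
  rewrite (_ : [set p | _] = set0) ?measure0// -subset0 => p /=.
  by rewrite q => q0; move: qp0; rewrite q q0 eqxx.
have [e1 e2] : (1 + 1 = 2%:R :> 'I_3) /\ (1 + 2%:R = 0 :> 'I_3) by split; exact: val_inj.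
have := sphere_sqr p 0; rewrite (quadE _ _ _ 0).
move: h0 h1; rewrite !add0r e1 e2 => -[a1 a2 a3 a4] [a5 _ _ _].
rewrite a2 a3 a4 a1 a5 => h; rewrite !mul0r !addr0 -!mulrDr h mulr1//.
Qed.

End quadrics.

(** * Weak gradients of the profiles *)

Section bounded_functions.
Context {R : realType}.
Notation S2 := (sphere R).
Notation mu := (@surface_measure R).
Implicit Types (f g : S2 -> R).

Lemma integrable_bounded f C : measurable_fun setT f ->
  (forall p, `|f p| <= C) -> mu.-integrable setT (EFin \o f).
Proof.
move=> mf fC; apply: measurable_bounded_integrable; [exact: measurableT| |exact: mf|].
  by rewrite -ge0_fin_numE ?surface_measure_fin.
exists C; split; first exact: num_real.
by move=> M CM p _; apply: le_trans (fC p) (ltW CM).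
Qed.

Lemma Rintegral_cvg (f_ : nat -> S2 -> R) f C :
  (forall n, measurable_fun setT (f_ n)) -> measurable_fun setT f ->
  (forall n p, `|f_ n p| <= C) ->
  (\forall p \ae mu, (fun n => f_ n p) @ \oo --> f p) ->
  (fun n => \int[mu]_p f_ n p) @ \oo --> \int[mu]_p f p.
Proof.
move=> mf_ mf fC cv.
have C0 : 0 <= C by apply: le_trans (fC 0%N point); exact: normr_ge0.
have [fi _ h] : [/\ mu.-integrable setT (EFin \o f),
    [sequence \int[mu]_p `|(EFin \o f_ n) p - (EFin \o f) p|]_n @ \oo --> 0 &
    [sequence \int[mu]_p (EFin \o f_ n) p]_n @ \oo --> \int[mu]_p (EFin \o f) p]%E.
  apply: (@dominated_convergence _ _ _ mu _ measurableT
      (fun n => EFin \o f_ n) (EFin \o f) (EFin \o cst C)).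
  - by move=> n; exact/measurable_EFinP.
  - exact/measurable_EFinP.
  - by apply: filterS cv => p pcv _; apply: cvg_EFin => //; exact: nearW.
  - apply: (@integrable_bounded _ C); first exact: measurable_cst.
    by move=> p; rewrite ger0_norm.
  - by apply/aeW => p n _; rewrite lee_fin.
apply: fine_cvg; rewrite /Rintegral fineK; first exact: h.
exact: integrable_fin_num.
Qed.

(** Upper bound: (1 - d) exp d <= 1 from exp (- d) >= 1 - d, while (1 - d) (1 + d + 2 d^2) = 1 + d^2
    (1 - 2 d) >= 1 for d <= 1/2. *)
Lemma expR_bounds (d : R) : d <= 1 / 2 -> 0 <= expR d - 1 - d <= 2 * d ^+ 2.
Proof.
move=> d1; apply/andP; split; first by have := expR_ge1Dx d; lra.
have := expR_ge1Dx (- d); rewrite expRN => h.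
have e0 := expR_gt0 d.
have : (1 - d) * expR d <= 1 by rewrite -ler_pdivlMr// mul1r.
rewrite expr2; set e := expR d in e0 *; move=> h2.
suff : (1 - d) * e <= (1 - d) * (1 + d + 2 * (d * d)).
  by rewrite ler_pM2l; lra.
by have := sqr_ge0 d; rewrite expr2; nra.
Qed.

End bounded_functions.

(** * Calculus of derivatives along a sequence of parameters *)

Section sequential_derivative.
Context {R : realType}.
Variable s : nat -> R.

(** Value and derivative at 0 of a function of a real parameter, seen only along the sequence [s]:
    sequences are what dominated convergence takes. *)
Definition sder (a : nat -> R) (a0 a' : R) :=
  (fun n => a n) @ \oo --> a0 /\ (fun n => (a n - a0) / s n) @ \oo --> a'.

Lemma sder_cst (k : R) : sder (fun=> k) k 0.
Proof.
split; first exact: cvg_cst.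
rewrite (_ : (fun n => _) = cst 0); first exact: cvg_cst.
by apply/funext => n; rewrite subrr mul0r.
Qed.

Lemma sderD a a0 a' b b0 b' : sder a a0 a' -> sder b b0 b' ->
  sder (fun n => a n + b n) (a0 + b0) (a' + b').
Proof.
move=> [a1 a2] [b1 b2]; split; first exact: cvgD.
rewrite (_ : (fun n => _) = (fun n => (a n - a0) / s n + (b n - b0) / s n)).
  exact: cvgD.
by apply/funext => n; ring.
Qed.

Lemma sderM a a0 a' b b0 b' : sder a a0 a' -> sder b b0 b' ->
  sder (fun n => a n * b n) (a0 * b0) (a' * b0 + a0 * b').
Proof.
move=> [a1 a2] [b1 b2]; split; first exact: cvgM.
rewrite (_ : (fun n => _) = (fun n => (a n - a0) / s n * b n + a0 * ((b n - b0) / s n))).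
  by apply: cvgD; apply: cvgM => //; exact: cvg_cst.
by apply/funext => n; ring.
Qed.

Lemma sderN a a0 a' : sder a a0 a' -> sder (fun n => - a n) (- a0) (- a').
Proof.
move=> /(sderM (sder_cst (-1))); rewrite mul0r add0r !mulN1r.
by rewrite (_ : (fun n => -1 * _) = (fun n => - a n)) //; apply/funext => n; rewrite mulN1r.
Qed.

Lemma sder_sum (F : 'I_3 -> nat -> R) F0 F' : (forall i, sder (F i) (F0 i) (F' i)) ->
  sder (fun n => \sum_i F i n) (\sum_i F0 i) (\sum_i F' i).
Proof.
move=> h; rewrite !(big_ord3 _ 0).
rewrite (_ : (fun n => _) = (fun n => F 0 n + F (0 + 1) n + F (0 + 2%:R) n)).
  by apply: sderD => //; apply: sderD.
by apply/funext => n; rewrite (big_ord3 _ 0).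
Qed.

Hypotheses (s0 : forall n, s n != 0) (scv : s @ \oo --> 0).

Lemma sder_expR a a0 a' : sder a a0 a' ->
  sder (fun n => expR (a n)) (expR a0) (expR a0 * a').
Proof.
move=> [a1 a2]; split; first by apply: (cvg_comp _ _ a1); exact: continuous_expR.
have d0 : (fun n => a n - a0) @ \oo --> 0.
  by rewrite -(subrr a0); apply: cvgB a1 _; exact: cvg_cst.
(* The remainder of the exponential is at most 2 |d| |d / s| with d = a n - a0; the first factor
   tends to 0 and the second converges. *)
pose e n := (expR (a n - a0) - 1 - (a n - a0)) / s n.
have ecv : e @ \oo --> 0.
  have : (fun n => 2 * `|a n - a0| * `|(a n - a0) / s n|) @ \oo --> 2 * `|0 : R| * `|a'|.
    by apply: cvgM; [apply: cvgM; [exact: cvg_cst|exact: cvg_norm]|exact: cvg_norm].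
  rewrite normr0 mulr0 mul0r => /cvgr0_norm_lt h.
  apply/cvgr0Pnorm_lt => eps eps0; near=> n.
  apply: (@le_lt_trans _ _ (2 * `|a n - a0| * `|(a n - a0) / s n|)); last first.
    apply: le_lt_trans (ler_norm _) _; near: n; exact: h.
  rewrite /e !normrM mulrA ler_wpM2r//.
  have /expR_bounds/andP[h1 h2] : a n - a0 <= 1 / 2.
    apply: le_trans (ler_norm _) _; near: n.
    by have := cvgr0_norm_le; move=> /(_ _ _ _ _ _ _ d0); apply; rewrite divr_gt0.
  by rewrite ger0_norm// (le_trans h2)// -mulrA -normrM -expr2 ger0_norm ?sqr_ge0.
rewrite (_ : (fun n => _) = (fun n => expR a0 * ((a n - a0) / s n + e n))); last first.
  apply/funext => n; rewrite /e (_ : expR (a n) = expR a0 * expR (a n - a0)).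
    by ring.
  by rewrite -expRD subrKC.
apply: cvgM; first exact: cvg_cst.
by rewrite -[X in _ --> X]addr0; apply: cvgD.
Unshelve. all: by end_near. Qed.

Lemma sder_max0 a (a0 a' : R) : a0 != 0 -> sder a a0 a' ->
  sder (fun n => maxr (a n) 0) (maxr a0 0) ((0 < a0)%R%:R * a').
Proof.
move=> an0 [a1 a2]; have [a0p|a0n] := ltP 0 a0.
  have pos : \forall n \near \oo, 0 < a n by exact: cvgr_gt a1 _ a0p.
  rewrite mul1r; split.
    apply: cvg_trans a1; apply: near_eq_cvg; near=> n.
    by rewrite /= max_l// ltW//; near: n.
  apply: cvg_trans a2; apply: near_eq_cvg; near=> n.
  by rewrite /= max_l// ltW//; near: n.
have a0n' : a0 < 0 by rewrite lt_neqAle an0.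
have neg : \forall n \near \oo, a n < 0 by exact: cvgr_lt a1 _ a0n'.
rewrite mul0r; split.
  apply: (@cvg_trans _ (cst 0 @ \oo)); last exact: cvg_cst.
  apply: near_eq_cvg; near=> n.
  by rewrite /= max_r// ltW//; near: n.
apply: (@cvg_trans _ (cst 0 @ \oo)); last exact: cvg_cst.
apply: near_eq_cvg; near=> n.
by rewrite /= [in RHS]max_r ?subrr ?mul0r// ltW//; near: n.
Unshelve. all: by end_near. Qed.

Lemma differentiable_seq (W : normedModType R) (F : 'rV[R]_3 -> W)
    (x : nat -> 'rV[R]_3) x0 w :
  differentiable F x0 -> (fun n => (s n)^-1 *: (x n - x0)) @ \oo --> w ->
  (fun n => F (x n)) @ \oo --> F x0 /\
  (fun n => (s n)^-1 *: (F (x n) - F x0)) @ \oo --> 'd F x0 w.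
Proof.
move=> dF xw.
have xd : (fun n => x n - x0) @ \oo --> (0 : 'rV[R]_3).
  rewrite (_ : (fun n => _) = (fun n => s n *: ((s n)^-1 *: (x n - x0)))).
    by rewrite -(scale0r w); apply: cvgZ.
  by apply/funext => n; rewrite scalerA divff// scale1r.
have xcv : x @ \oo --> x0.
  rewrite (_ : x = (fun n => x0 + (x n - x0))); last by apply/funext => n; rewrite subrKC.
  by rewrite -[X in _ --> X]addr0; apply: cvgD xd; exact: cvg_cst.
split; first by apply: (cvg_comp _ _ xcv); exact: (differentiable_continuous dF).
have /eqaddoP lo := diff_locally dF.
pose y n := (s n)^-1 *: (x n - x0).
pose e n := (s n)^-1 *: (F (x n) - F x0 - 'd F x0 (x n - x0)).
have ecv : e @ \oo --> 0.
  apply/cvgr0Pnorm_lt => eps eps0.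
  (* The quotients [y n] converge to [w], so their norm is eventually at most |w| + 1, strictly
     below |w| + 2. *)
  have k0 : 0 < eps / (`|w| + 2) by rewrite divr_gt0// ltr_wpDl.
  have lo' : \forall n \near \oo, `|F (x n) - F x0 - 'd F x0 (x n - x0)| <=
      eps / (`|w| + 2) * `|x n - x0|.
    apply: (@filterS _ \oo _ _ _ _ (xd _ (lo _ k0))) => n /=.
    by rewrite !fctE/= subrK opprD addrA.
  near=> n; rewrite /e normrZ normfV mulrC ltr_pdivrMr ?normr_gt0//.
  apply: (@le_lt_trans _ _ (eps / (`|w| + 2) * `|x n - x0|)); first by near: n.
  rewrite -mulrA ltr_pM2l// mulrC ltr_pdivrMr ?ltr_wpDl//.
  rewrite (_ : x n - x0 = s n *: y n); last by rewrite /y scalerA divff// scale1r.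
  rewrite normrZ ltr_pM2l ?normr_gt0//.
  apply: (@le_lt_trans _ _ (`|w| + 1)); last by rewrite ltrD2l ltr1n.
  by near: n; have := cvgr_norm_le; move=> /(_ _ _ _ _ _ _ _ xw); apply; rewrite ltrDl.
rewrite (_ : (fun n => _) = (fun n => 'd F x0 (y n) + e n)); last first.
  by apply/funext => n; rewrite /e /y linearZ /= -scalerDr subrKC.
rewrite -[X in _ --> X]addr0; apply: cvgD ecv.
by apply: (cvg_comp _ _ xw); exact: diff_continuous.
Unshelve. all: by end_near. Qed.

End sequential_derivative.

(** * Integration by parts from rotation invariance *)

Section rotation_derivative.
Context {R : realType}.
Notation S2 := (sphere R).
Notation mu := (@surface_measure R).
Implicit Types (p q : S2) (i j : 'I_3) (s : R).

(* The velocity of the rotations about the i-th axis, for the parametrisation by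
   the tangent of the half-angle, is twice this vector product of the i-th basis
   vector with u. *)
Definition axis_cross i (u : 'rV[R]_3) : 'rV[R]_3 :=
  \row_j if j == i then 0 else if j == i + 1 then - u 0 (i + 2%:R) else u 0 (i + 1).

Lemma axis_crossE i (u : 'rV[R]_3) : [/\ axis_cross i u 0 i = 0,
  axis_cross i u 0 (i + 1) = - u 0 (i + 2%:R) &
  axis_cross i u 0 (i + 2%:R) = u 0 (i + 1)].
Proof. by split; rewrite mxE ?eqxx ?ord3_neq. Qed.

Lemma sdist_le2 p q : sdist p q <= 2.
Proof.
apply: le_trans (enormD _ _) _; rewrite enormN !enorm_sphere.
by rewrite -natr1.
Qed.

Lemma ler_enorm (u : 'rV[R]_3) (C : R) : 0 <= C ->
  (enorm u <= C) = (dot u u <= C ^+ 2).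
Proof.
by move=> C0; rewrite -(@ler_pXn2r _ 2) ?nnegrE ?enorm_ge0// sqr_enorm.
Qed.

(** Uniform in p: it bounds the difference quotients of a Lipschitz function along rotations, hence
    provides the dominating constant. *)
Lemma sdist_rot_le i s p : sdist (rot i s p) p <= 2 * `|s|.
Proof.
change (enorm (rotv i s (val p) - val p) <= 2 * `|s|).
rewrite ler_enorm ?mulr_ge0// (dot_cyclic _ i).
have e j (x y : 'rV[R]_3) : (x - y) 0 j = x 0 j - y 0 j by rewrite !mxE.
rewrite !e; have [-> -> ->] := rotvE i s (val p).
have := sphere_sqr p i.
set x := val p 0 i; set y := val p 0 (i + 1); set z := val p 0 (i + 2%:R) => xyz.
have s0 := onesqr_neq0 s.
have s1 : 0 < 1 + s ^+ 2 by rewrite ltr_pwDl// sqr_ge0.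
rewrite exprMn real_normK ?num_real//.
rewrite [leLHS](_ : _ = 4 * s ^+ 2 * (y ^+ 2 + z ^+ 2) / (1 + s ^+ 2)); last by field.
rewrite ler_pdivrMr//.
have s2 := sqr_ge0 s; have x2 := sqr_ge0 x.
rewrite (_ : y ^+ 2 + z ^+ 2 = 1 - x ^+ 2); last by lra.
move: (s ^+ 2) (x ^+ 2) s2 x2 => a b a0 b0; nra.
Qed.

Lemma rot_derivative i p (s : nat -> R) : (forall n, s n != 0) -> s @ \oo --> 0 ->
  (fun n => (s n)^-1 *: (val (rot i (s n) p) - val p)) @ \oo --> 2 *: axis_cross i (val p).
Proof.
move=> s0 scv; apply/cvgrPdist_lt => e e0; near=> n.
apply: (@le_lt_trans _ _ (2 * `|s n|)); last first.
  rewrite -ltr_pdivlMl//; near: n.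
  by have := cvgr0_norm_lt; move=> /(_ _ _ _ _ _ _ scv); apply; rewrite mulr_gt0// invr_gt0.
apply: le_trans (normr_le_enorm _) _.
rewrite ler_enorm ?mulr_ge0// (dot_cyclic _ i).
have e1 j (x y : 'rV[R]_3) a b : (a *: x - b *: y) 0 j = a * x 0 j - b * y 0 j.
  by rewrite !mxE.
have e2 j (x y : 'rV[R]_3) : (x - y) 0 j = x 0 j - y 0 j by rewrite !mxE.
have [x0 x1 x2] := axis_crossE i (val p).
have [r0 r1 r2] := rotvE i (s n) (val p).
rewrite !e1 !e2 x0 x1 x2 r0 r1 r2.
have := sphere_sqr p i.
set x := val p 0 i; set y := val p 0 (i + 1); set z := val p 0 (i + 2%:R) => xyz.
have t0 := onesqr_neq0 (s n).
have t1 : 0 < 1 + s n ^+ 2 by rewrite ltr_pwDl// sqr_ge0.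
rewrite exprMn real_normK ?num_real//.
rewrite [leLHS](_ : _ = 4 * s n ^+ 2 * (y ^+ 2 + z ^+ 2) / (1 + s n ^+ 2)); last first.
  by field; rewrite ?s0 ?t0.
rewrite ler_pdivrMr//.
have s2 := sqr_ge0 (s n); have xx := sqr_ge0 x.
rewrite (_ : y ^+ 2 + z ^+ 2 = 1 - x ^+ 2); last by lra.
by move: (s n ^+ 2) (x ^+ 2) s2 xx => a b a0 b0; nra.
Unshelve. all: by end_near. Qed.

(** By invariance each difference quotient has integral 0, and the Lipschitz bound lets the limit
    pass under the integral. Summing over the three axes first, convergence is asked only of the
    sum. *)
Lemma integral_rot_derivative (h : 'I_3 -> S2 -> R) (Dh : S2 -> R) (L : R) (s : nat -> R) :
  (forall n, s n != 0) -> s @ \oo --> 0 -> 0 <= L ->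
  (forall i, measurable_fun setT (h i)) -> measurable_fun setT Dh ->
  (forall i p q, `|h i p - h i q| <= L * sdist p q) ->
  (\forall p \ae mu,
    (fun n => \sum_i (h i (rot i (s n) p) - h i p) / s n) @ \oo --> Dh p) ->
  \int[mu]_p Dh p = 0.
Proof.
move=> s0 scv L0 mh mDh hL cv.
have mhr i n : measurable_fun setT (fun p => h i (rot i (s n) p)).
  by apply: measurableT_comp; [exact: mh|exact: measurable_rot].
have mq i n : measurable_fun setT (fun p => (h i (rot i (s n) p) - h i p) / s n).
  apply: measurable_funM; last exact: measurable_cst.
  by apply: measurable_funB; [exact: mhr|exact: mh].
have qL i n p : `|(h i (rot i (s n) p) - h i p) / s n| <= 2 * L.
  rewrite normrM normfV ler_pdivrMr ?normr_gt0//.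
  apply: le_trans (hL _ _ _) _; rewrite mulrC -mulrA [L * _]mulrC mulrA.
  by rewrite ler_wpM2r// sdist_rot_le.
have int i n : \int[mu]_p ((h i (rot i (s n) p) - h i p) / s n) = 0.
  have hC p : `|h i p| <= `|h i point| + L * 2.
    rewrite -{1}(subrKC (h i point) (h i p)).
    apply: le_trans (ler_normD _ _) _; rewrite lerD2l.
    by apply: le_trans (hL _ _ _) _; rewrite ler_wpM2l// sdist_le2.
  have ih : mu.-integrable setT (EFin \o h i) by exact: (integrable_bounded (mh i) hC).
  have ihr : mu.-integrable setT (EFin \o (fun p => h i (rot i (s n) p))).
    by apply: (integrable_bounded (mhr i n)) => p; exact: hC.
  have ihd : mu.-integrable setT (EFin \o (fun p => h i (rot i (s n) p) - h i p)).
    apply: (@integrable_bounded _ _ (2 * L * `|s n|)).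
      by apply: measurable_funB; [exact: mhr|exact: mh].
    by move=> p; rewrite -ler_pdivrMr ?normr_gt0// -normfV -normrM.
  rewrite RintegralZr; [|exact: measurableT|exact: ihd].
  by rewrite (RintegralB measurableT ihr ih) (integral_rot _ _ (mh i)) subrr mul0r.
have := @Rintegral_cvg _ (fun n p => \sum_i (h i (rot i (s n) p) - h i p) / s n) Dh (2 * L + 2 * L + 2 * L).
move=> /(_ _ mDh _ cv)/wrap[n|n p|].
- by apply: measurable_sum => i; exact: mq.
- rewrite (big_ord3 _ 0); apply: le_trans (ler_normD _ _) _; apply: lerD => //.
  by apply: le_trans (ler_normD _ _) _; apply: lerD.
have int0 n : \int[mu]_p (\sum_i (h i (rot i (s n) p) - h i p) / s n) = 0.
  have iq i := integrable_bounded (mq i n) (qL i n).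
  under eq_Rintegral do rewrite (big_ord3 _ 0).
  rewrite (@RintegralD _ _ _ mu setT (fun p => _ + _)) //; last first.
    apply: (integrable_bounded (measurable_funD (mq 0 n) (mq (0 + 1) n)) (C := 2 * L + 2 * L)).
    by move=> p; apply: le_trans (ler_normD _ _) _; apply: lerD.
  rewrite (@RintegralD _ _ _ mu setT) //.
  by rewrite !int !addr0.
under eq_fun do rewrite int0.
by move=> /(cvg_lim (@Rhausdorff R)) <-; rewrite lim_cst.
Qed.

End rotation_derivative.

Section elementary_estimates.
Context {R : realType}.

Lemma expR_lipschitz (K a b : R) : a <= K -> b <= K ->
  `|expR a - expR b| <= expR K * `|a - b|.
Proof.
wlog ba : a b / b <= a.
  by move=> h aK bK; case: (leP b a) => [/h->//|/ltW/h h']; rewrite distrC [`|a - b|]distrC h'.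
move=> aK bK; rewrite !ger0_norm ?subr_ge0 ?ler_expR//.
have := expR_ge1Dx (b - a); rewrite expRB => h1.
have a0 := expR_gt0 a.
apply: (@le_trans _ _ (expR a * (a - b))).
  have : expR a * (1 + (b - a)) <= expR a * (expR b / expR a) by rewrite ler_wpM2l// ltW.
  rewrite mulrCA divff ?gt_eqF// mulr1; lra.
by rewrite ler_wpM2r ?subr_ge0// ler_expR.
Qed.

Lemma max0_lipschitz (a b : R) : `|maxr a 0 - maxr b 0| <= `|a - b|.
Proof.
rewrite ler_norml; have h := ler_norm (a - b); have h' := ler_norm (b - a).
have h0 := normr_ge0 (a - b).
rewrite (distrC b a) in h'.
by case: (ltP a 0) => a0; case: (ltP b 0) => b0; apply/andP; split; lra.
Qed.

Lemma max0_ge0 (a : R) : 0 <= maxr a 0. Proof. by rewrite le_max lexx orbT. Qed.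

Lemma max0_le (a K : R) : `|a| <= K -> maxr a 0 <= K.
Proof. by move=> aK; rewrite ge_max (le_trans (ler_norm _) aK) (le_trans _ aK). Qed.

Lemma max0_expR_lipschitz (K x y v w : R) : `|x| <= K -> `|y| <= K -> v <= K -> w <= K ->
  `|maxr x 0 * expR v - maxr y 0 * expR w| <= expR K * `|x - y| + K * expR K * `|v - w|.
Proof.
move=> xK yK vK wK.
rewrite (_ : _ - _ = (maxr x 0 - maxr y 0) * expR v + maxr y 0 * (expR v - expR w)); last by ring.
apply: le_trans (ler_normD _ _) _; rewrite !normrM; apply: lerD.
  by rewrite mulrC ler_pM ?max0_lipschitz// ger0_norm ?expR_ge0 ?ler_expR.
rewrite -mulrA ler_pM// ?expR_lipschitz// ger0_norm ?max0_ge0//.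
exact: max0_le.
Qed.

End elementary_estimates.

Section quadratic_estimates.
Context {R : realType}.
Notation S2 := (sphere R).
Implicit Types (p q : S2) (A : 'M[R]_3) (c : R).

(** A norm on pairs (A, c) that controls the form on the sphere in supremum and, up to a factor 2,
    in Lipschitz constant; all continuity in the coefficients is expressed with it. *)
Definition quad_bound A c : R := \sum_i \sum_j `|A i j| + `|c|.

Lemma quad_bound_ge0 A c : 0 <= quad_bound A c.
Proof. by rewrite addr_ge0//; apply: sumr_ge0 => i _; apply: sumr_ge0. Qed.

Lemma quad_le A c p : `|quad A c (val p)| <= quad_bound A c.
Proof.
apply: le_trans (ler_normD _ _) _; rewrite lerD2r.
apply: le_trans (ler_norm_sum _ _ _) _; apply: ler_sum => i _.
apply: le_trans (ler_norm_sum _ _ _) _; apply: ler_sum => j _.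
by rewrite !normrM ler_piMr// mulr_ile1// sphere_coord_le1.
Qed.

Lemma quad_lipschitz A c p q :
  `|quad A c (val p) - quad A c (val q)| <= 2 * quad_bound A c * sdist p q.
Proof.
rewrite /quad opprD addrACA subrr addr0 -sumrB.
apply: (@le_trans _ _ (2 * quad_bound A 0 * sdist p q)); last first.
  by rewrite ler_wpM2r ?enorm_ge0// ler_wpM2l// lerD2l normr0.
rewrite /quad_bound normr0 addr0 mulr_sumr mulr_suml.
apply: le_trans (ler_norm_sum _ _ _) _; apply: ler_sum => i _.
rewrite -sumrB mulr_sumr mulr_suml.
apply: le_trans (ler_norm_sum _ _ _) _; apply: ler_sum => j _.
rewrite -mulrBr normrM [2 * _]mulrC -mulrA ler_wpM2l//.
rewrite (_ : _ - _ = (val p 0 i - val q 0 i) * val p 0 j + val q 0 i * (val p 0 j - val q 0 j)); last by ring.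
apply: le_trans (ler_normD _ _) _; rewrite !normrM mulrDl mul1r; apply: lerD.
  by rewrite -[leRHS]mulr1 ler_pM ?sphere_coord_lip ?sphere_coord_le1.
by rewrite -[leRHS]mul1r ler_pM ?sphere_coord_lip ?sphere_coord_le1.
Qed.

Lemma quadB A B c d (u : 'rV[R]_3) : quad A c u - quad B d u = quad (A - B) (c - d) u.
Proof. by rewrite !(quadE _ _ _ 0) !mxE; ring. Qed.

End quadratic_estimates.

Section C1_fields.
Context {R : realType}.
Notation S2 := (sphere R).
Implicit Types (p q : S2) (Phi : 'rV[R]_3 -> 'rV[R]_3).

Lemma ler_mx_norm_coord m n (M : 'M[R]_(m.+1, n.+1)) i j : `|M i j| <= `|M|.
Proof.
rewrite [leRHS]/Num.Def.normr/= mx_normrE.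
by rewrite (bigmaxD1 (i, j))//= le_max lexx.
Qed.

Lemma is_derive_line (V : normedModType R) (F : V -> 'rV[R]_3) (a v : V) (t : R) k :
  differentiable F (t *: v + a) ->
  is_derive t 1 (fun t => F (t *: v + a) 0 k) ('d F (t *: v + a) v 0 k).
Proof.
move=> dF.
have cv : (fun h => h^-1 *: ((F \o shift (t *: v + a)) (h *: v) - F (t *: v + a))) @ 0^' -->
    'd F (t *: v + a) v.
  by rewrite -deriveE//; exact: diff_derivable.
have cvk : (fun h : R => h^-1 *: (F ((h *: (1 : R) + t) *: v + a) 0 k - F (t *: v + a) 0 k)) @ 0^' -->
    'd F (t *: v + a) v 0 k.
  rewrite (_ : (fun h => _) = (fun M : 'rV[R]_3 => M 0 k) \o
     (fun h => h^-1 *: ((F \o shift (t *: v + a)) (h *: v) - F (t *: v + a)))).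
    by apply: (cvg_comp _ _ cv); exact: coord_continuous.
  by apply/funext => h /=; rewrite !mxE [h *: 1]mulr1 scalerDl -addrA.
by apply: DeriveDef; [apply/cvg_ex; exists ('d F (t *: v + a) v 0 k)|exact: cvg_lim cvk].
Qed.

(** The bound is taken on a cube because the mean value theorem will be used along chords, which
    leave the sphere but not the cube. *)
Lemma jacobian_bounded Phi : C1_field Phi -> exists2 C, 0 <= C &
  forall x : 'rV[R]_3, (forall i, `|x 0 i| <= 1) -> `|jacobian Phi x| <= C.
Proof.
move=> [_ cJ].
pose N (x : 'rV[R]_3) : R := `|jacobian Phi x|.
pose box : set 'rV[R]_3 := [set v | forall i, `[-1, 1]%classic (v 0 i)].
have [x0 _ x0max] : exists2 x, x \in box & forall t, t \in box -> N t <= N x.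
  apply: EVT_max_rV.
  - by exists 0 => i; rewrite /= mxE in_itv/=; apply/andP; split; lra.
  - exact: (@rV_compact R 3 (fun=> `[-1, 1]%classic) (fun=> @segment_compact R (-1) 1)).
  - apply: continuous_subspaceT => x.
    exact: (@continuous_comp _ _ _ (jacobian Phi) normr x (cJ x) (@norm_continuous _ _ _)).
exists (N x0); first exact: normr_ge0.
by move=> x x1; apply: x0max; rewrite inE => i; rewrite /= in_itv/= -ler_norml.
Qed.

Lemma C1_field_lipschitz Phi : C1_field Phi -> exists2 L, 0 <= L &
  forall p q k, `|Phi (val p) 0 k - Phi (val q) 0 k| <= L * sdist p q.
Proof.
move=> C1; have [C C0 JC] := jacobian_bounded C1; have [dPhi _] := C1.
exists (3 * C); first by rewrite mulr_ge0.
move=> p q k; pose v := val p - val q.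
pose g (t : R) := Phi (t *: v + val q) 0 k.
have gd (t : R) : is_derive t 1 g ('d Phi (t *: v + val q) v 0 k).
  exact: is_derive_line.
have gc : {within `[0, 1], continuous g}.
  apply: continuous_subspaceT => t; apply: differentiable_continuous.
  by apply/derivable1_diffP; case: (gd t).
have [c /andP[/= c0 c1]] := @MVT R g _ 0 1 ltr01 (fun t _ => gd t) gc.
rewrite !bnd_simp in c0 c1; rewrite /g subr0 mulr1 scale0r scale1r add0r /v subrK => ->.
rewrite -[in 'd _ _ _]/v; set y := c *: v + val q.
have -> : 'd Phi y v = v *m jacobian Phi y by rewrite mul_rV_lin1.
have yb : `|jacobian Phi y| <= C.
  apply: JC => i; rewrite /y /v !mxE.
  have := sphere_coord_le1 p i; have := sphere_coord_le1 q i.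
  rewrite !ler_norml => /andP[q1 q2] /andP[p1 p2].
  by apply/andP; split; nra.
rewrite mxE (big_ord3 _ 0); apply: le_trans (ler_normD _ _) _.
apply: le_trans (lerD (ler_normD _ _) (lexx _)) _.
have h j : `|v 0 j * jacobian Phi y j k| <= C * sdist p q.
  rewrite normrM mulrC ler_pM//; first by apply: le_trans yb; exact: ler_mx_norm_coord.
  exact: enorm_coord.
by have := h 0; have := h (0 + 1); have := h (0 + 2%:R); lra.
Qed.

Lemma measurable_jacobian Phi j k : C1_field Phi ->
  measurable_fun setT (fun p : S2 => jacobian Phi (val p) j k).
Proof.
move=> [_ cJ]; apply: measurable_continuous_sphere => p.
apply: (@continuous_comp _ _ _ (fun p : S2 => val p : 'rV[R]_3) (fun x => jacobian Phi x j k)).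
  exact: continuous_sphere_val.
apply: (@continuous_comp _ _ _ (jacobian Phi) (fun M => M j k)); first exact: cJ.
exact: coord_continuous.
Qed.

Lemma measurable_C1_field Phi k : C1_field Phi ->
  measurable_fun setT (fun p : S2 => Phi (val p) 0 k).
Proof.
move=> [dPhi _]; apply: measurable_continuous_sphere => p.
apply: (@continuous_comp _ _ _ (fun p : S2 => val p : 'rV[R]_3) (fun x => Phi x 0 k)).
  exact: continuous_sphere_val.
apply: (@continuous_comp _ _ _ Phi (fun M => M 0 k)).
  exact: differentiable_continuous.
exact: coord_continuous.
Qed.

Lemma C1_field_bounded Phi : C1_field Phi -> exists C, forall p k, `|Phi (val p) 0 k| <= C.
Proof.
move=> /C1_field_lipschitz[L L0 hL].
exists (L * 2 + \sum_j `|Phi (val (point : S2)) 0 j|) => p k.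
rewrite -{1}(subrK (Phi (val (point : S2)) 0 k) (Phi (val p) 0 k)).
apply: le_trans (ler_normD _ _) _; apply: lerD.
  by apply: le_trans (hL _ _ _) _; rewrite ler_wpM2l// sdist_le2.
by rewrite (bigD1 k)//= lerDl sumr_ge0.
Qed.

End C1_fields.

Section euclidean_estimates.
Context {R : realType}.
Implicit Types u v w : 'rV[R]_3.

Lemma enormZ (a : R) u : enorm (a *: u) = `|a| * enorm u.
Proof.
rewrite /enorm (_ : dot (a *: u) (a *: u) = a ^+ 2 * dot u u).
  by rewrite sqrtrM ?sqr_ge0// sqrtr_sqr.
by rewrite !dotE !mxE; ring.
Qed.

Lemma enorm_le_sum u : enorm u <= \sum_i `|u 0 i|.
Proof.
rewrite ler_enorm ?sumr_ge0// (dot_cyclic _ 0) (big_ord3 _ 0).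
rewrite -!(real_normK (num_real (u 0 _))).
have := normr_ge0 (u 0 0); have := normr_ge0 (u 0 (0 + 1)); have := normr_ge0 (u 0 (0 + 2%:R)).
move: `|_| `|_| `|_| => a b c a0 b0 c0; rewrite !expr2; nra.
Qed.

Lemma dotC u v : dot u v = dot v u.
Proof. by rewrite !dotE; ring. Qed.

Lemma dotDl u v w : dot (u + v) w = dot u w + dot v w.
Proof. by rewrite !dotE !mxE; ring. Qed.

Lemma dotZl a u v : dot (a *: u) v = a * dot u v.
Proof. by rewrite !dotE !mxE; ring. Qed.

End euclidean_estimates.

Section profiles.
Context {R : realType}.
Notation S2 := (sphere R).
Notation mu := (@surface_measure R).
Implicit Types (p q : S2) (A B : 'M[R]_3) (c d : R) (Phi : 'rV[R]_3 -> 'rV[R]_3).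

Definition profile A c B d p : R := maxr (quad A c (val p)) 0 * expR (quad B d (val p)).

Definition quad_grad A (u : 'rV[R]_3) : 'rV[R]_3 := u *m (A + A^T).

Definition tangent p (w : 'rV[R]_3) : 'rV[R]_3 := w - dot w (val p) *: val p.

(** The ambient gradient of the formula for [profile] where the form A, c does not vanish. At its
    zeros the value is 0, the gradient on the side where the profile is 0. *)
Definition profile_dir A c B d p : 'rV[R]_3 := expR (quad B d (val p)) *:
  ((0 < quad A c (val p))%R%:R *: quad_grad A (val p) +
   maxr (quad A c (val p)) 0 *: quad_grad B (val p)).

Definition profile_grad A c B d p := tangent p (profile_dir A c B d p).

Lemma quad_grad_coord A (u : 'rV[R]_3) k :
  quad_grad A u 0 k = \sum_j u 0 j * (A j k + A k j).
Proof. by rewrite mxE; apply: eq_bigr => j _; rewrite !mxE. Qed.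

Lemma dot_tangent p w (v : 'rV[R]_3) : dot v (val p) = 0 -> dot (tangent p w) v = dot w v.
Proof.
move=> vp; rewrite /tangent -scaleNr dotDl dotZl (dotC (val p)) vp.
by rewrite mulr0 addr0.
Qed.

Lemma tangent_dot0 p w : dot (tangent p w) (val p) = 0.
Proof. by rewrite /tangent -scaleNr dotDl dotZl sphere_dot mulr1 subrr. Qed.

Lemma enorm_tangent p w : enorm (tangent p w) <= enorm w.
Proof.
have e : dot (tangent p w) (tangent p w) = dot w w - dot w (val p) ^+ 2.
  have -> : dot (tangent p w) (tangent p w) = dot w (tangent p w).
    by rewrite {1}/tangent -scaleNr dotDl dotZl (dotC (val p)) tangent_dot0 mulr0 addr0.
  by rewrite dotC /tangent -scaleNr dotDl dotZl (dotC (val p)) mulNr -expr2.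
by rewrite ler_enorm ?enorm_ge0// sqr_enorm e gerBl sqr_ge0.
Qed.

Lemma enorm_quad_grad A p : enorm (quad_grad A (val p)) <= 6 * quad_bound A 0.
Proof.
apply: le_trans (enorm_le_sum _) _.
have h k : `|quad_grad A (val p) 0 k| <= 2 * quad_bound A 0.
  rewrite quad_grad_coord; apply: le_trans (ler_norm_sum _ _ _) _.
  have e j : `|val p 0 j * (A j k + A k j)| <= `|A j k| + `|A k j|.
    rewrite normrM -[leRHS]mul1r ler_pM ?ler_normD//; exact: sphere_coord_le1.
  apply: (@le_trans _ _ (\sum_j (`|A j k| + `|A k j|))); first exact: ler_sum.
  rewrite big_split /= /quad_bound normr0 addr0 [leRHS]mulr_natl mulr2n; apply: lerD.
    by apply: ler_sum => j _; rewrite (bigD1 k)//= lerDl sumr_ge0.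
  by rewrite [leRHS](bigD1 k)//= lerDl sumr_ge0// => i _; apply: sumr_ge0.
rewrite (big_ord3 _ 0); have := h 0; have := h (0 + 1); have := h (0 + 2%:R); lra.
Qed.

Lemma profile_ge0 A c B d p : 0 <= profile A c B d p.
Proof. by rewrite mulr_ge0 ?expR_ge0 ?max0_ge0. Qed.

Lemma measurable_max0_quad A c : measurable_fun setT (fun p : S2 => maxr (quad A c (val p)) 0).
Proof. by apply: measurable_maxr; [exact: measurable_quad|exact: measurable_cst]. Qed.

Lemma measurable_expR_quad A c : measurable_fun setT (fun p : S2 => expR (quad A c (val p))).
Proof. by apply: (measurableT_comp (@measurable_expR R)); exact: measurable_quad. Qed.

Lemma measurable_profile A c B d : measurable_fun setT (profile A c B d).
Proof.
by apply: measurable_funM; [exact: measurable_max0_quad|exact: measurable_expR_quad].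
Qed.

Lemma profile_lipschitz A c B d (K : R) : quad_bound A c <= K -> quad_bound B d <= K ->
  forall p q, `|profile A c B d p - profile A c B d q| <=
    (2 * K * expR K + 2 * K ^+ 2 * expR K) * sdist p q.
Proof.
move=> AK BK p q; have K0 : 0 <= K by exact: le_trans (quad_bound_ge0 A c) AK.
have e0 := expR_ge0 K.
apply: le_trans (@max0_expR_lipschitz _ K _ _ _ _ _ _ _ _) _.
- exact: le_trans (quad_le _ _ _) AK.
- exact: le_trans (quad_le _ _ _) AK.
- exact: le_trans (ler_norm _) (le_trans (quad_le _ _ _) BK).
- exact: le_trans (ler_norm _) (le_trans (quad_le _ _ _) BK).
rewrite mulrDl; apply: lerD.
  rewrite [2 * K * expR K]mulrC -mulrA ler_wpM2l//.
  by apply: le_trans (quad_lipschitz _ _ _ _) _; rewrite ler_wpM2r ?enorm_ge0// ler_wpM2l.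
rewrite (_ : 2 * K ^+ 2 * expR K * sdist p q = K * expR K * (2 * K * sdist p q)); last by ring.
rewrite ler_wpM2l ?mulr_ge0//.
by apply: le_trans (quad_lipschitz _ _ _ _) _; rewrite ler_wpM2r ?enorm_ge0// ler_wpM2l.
Qed.

Lemma profile_le A c B d (K : R) : quad_bound A c <= K -> quad_bound B d <= K ->
  forall p, `|profile A c B d p| <= K * expR K.
Proof.
move=> AK BK p; rewrite ger0_norm ?profile_ge0// ler_pM ?expR_ge0 ?max0_ge0//.
  exact: max0_le (le_trans (quad_le _ _ _) AK).
by rewrite ler_expR; exact: le_trans (ler_norm _) (le_trans (quad_le _ _ _) BK).
Qed.

Lemma enorm_profile_dir A c B d (K : R) : quad_bound A c <= K -> quad_bound B d <= K ->
  forall p, enorm (profile_dir A c B d p) <= expR K * (6 * K + 6 * K ^+ 2).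
Proof.
move=> AK BK p; have K0 : 0 <= K by exact: le_trans (quad_bound_ge0 A c) AK.
have g0 C e : quad_bound C e <= K -> enorm (quad_grad C (val p)) <= 6 * K.
  move=> CK; apply: le_trans (enorm_quad_grad _ _) _; rewrite ler_wpM2l//.
  by apply: le_trans CK; rewrite lerD2l normr0.
rewrite enormZ ger0_norm ?expR_ge0// ler_pM ?expR_ge0 ?enorm_ge0//.
  by rewrite ler_expR; exact: le_trans (ler_norm _) (le_trans (quad_le _ _ _) BK).
apply: le_trans (enormD _ _) _; rewrite !enormZ; apply: lerD.
  rewrite -[leRHS]mul1r ler_pM ?enorm_ge0//; last exact: g0 AK.
  by case: (0 < _); rewrite ?normr1 ?normr0.
rewrite (_ : 6 * K ^+ 2 = K * (6 * K)); last by ring.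
rewrite ler_pM ?enorm_ge0//; last exact: g0 BK.
by rewrite ger0_norm ?max0_ge0//; exact: max0_le (le_trans (quad_le _ _ _) AK).
Qed.

Lemma measurable_dot (f g : S2 -> 'rV[R]_3) :
  (forall k, measurable_fun setT (fun p => f p 0 k)) ->
  (forall k, measurable_fun setT (fun p => g p 0 k)) ->
  measurable_fun setT (fun p => dot (f p) (g p)).
Proof.
move=> mf mg; apply: measurable_sum => k.
by apply: measurable_funM; [exact: mf|exact: mg].
Qed.

Lemma measurable_enorm (f : S2 -> 'rV[R]_3) :
  (forall k, measurable_fun setT (fun p => f p 0 k)) ->
  measurable_fun setT (fun p => enorm (f p)).
Proof.
move=> mf; apply: (measurableT_comp (continuous_measurable_fun (@sqrt_continuous R))).
exact: measurable_dot.
Qed.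

Lemma measurable_quad_grad A k : measurable_fun setT (fun p => quad_grad A (val p) 0 k).
Proof.
under eq_fun do rewrite quad_grad_coord.
apply: measurable_sum => j.
by apply: measurable_funM; [exact: measurable_sphere_coord|exact: measurable_cst].
Qed.

Lemma measurable_profile_dir A c B d k :
  measurable_fun setT (fun p => profile_dir A c B d p 0 k).
Proof.
rewrite (_ : (fun p => _) = (fun p => expR (quad B d (val p)) *
  ((0 < quad A c (val p))%R%:R * quad_grad A (val p) 0 k +
   maxr (quad A c (val p)) 0 * quad_grad B (val p) 0 k))); last first.
  by apply/funext => p; rewrite /profile_dir !mxE.
apply: measurable_funM; first exact: measurable_expR_quad.
apply: measurable_funD.
  apply: measurable_funM; last exact: measurable_quad_grad.
  rewrite (_ : (fun p => _) = (fun p => if 0 < quad A c (val p) then 1 else 0)).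
    apply: measurable_fun_ifT; [|exact: measurable_cst|exact: measurable_cst].
    by apply: measurable_fun_ltr; [exact: measurable_cst|exact: measurable_quad].
  by apply/funext => p; case: (0 < _).
by apply: measurable_funM; [exact: measurable_max0_quad|exact: measurable_quad_grad].
Qed.

Lemma measurable_profile_grad A c B d k :
  measurable_fun setT (fun p => profile_grad A c B d p 0 k).
Proof.
rewrite (_ : (fun p => _) = (fun p => profile_dir A c B d p 0 k -
  dot (profile_dir A c B d p) (val p) * val p 0 k)); last first.
  by apply/funext => p; rewrite /profile_grad /tangent !mxE.
apply: measurable_funB; first exact: measurable_profile_dir.
apply: measurable_funM; last exact: measurable_sphere_coord.
by apply: measurable_dot => j; [exact: measurable_profile_dir|exact: measurable_sphere_coord].
Qed.

Lemma sder_quad (s : nat -> R) A c (x : nat -> 'rV[R]_3) (x0 w : 'rV[R]_3) :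
  (forall k, sder s (fun n => x n 0 k) (x0 0 k) (w 0 k)) ->
  sder s (fun n => quad A c (x n)) (quad A c x0) (dot w (quad_grad A x0)).
Proof.
move=> h.
have e : dot w (quad_grad A x0) = \sum_i \sum_j (0 * (x0 0 i * x0 0 j) +
    A i j * (w 0 i * x0 0 j + x0 0 i * w 0 j)) + 0.
  by rewrite !(big_ord3 _ 0) /dot (big_ord3 _ 0) !quad_grad_coord !(big_ord3 _ 0); ring.
rewrite e; apply: sderD; last exact: sder_cst.
apply: sder_sum => i; apply: sder_sum => j.
by apply: sderM; [exact: sder_cst|apply: sderM].
Qed.

Lemma surface_divE Phi p : surface_div Phi p =
  \sum_k jacobian Phi (val p) k k -
  \sum_k (\sum_j val p 0 j * jacobian Phi (val p) j k) * val p 0 k.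
Proof.
rewrite /surface_div; congr (_ - _).
have -> : 'd Phi (val p) (val p) = val p *m jacobian Phi (val p) by rewrite mul_rV_lin1.
by rewrite /dot; apply: eq_bigr => k _; rewrite mxE.
Qed.

Lemma measurable_surface_div Phi : C1_field Phi -> measurable_fun setT (surface_div Phi).
Proof.
move=> C1; rewrite (_ : surface_div Phi = (fun p => \sum_k jacobian Phi (val p) k k -
  \sum_k (\sum_j val p 0 j * jacobian Phi (val p) j k) * val p 0 k)); last first.
  by apply/funext => p; rewrite surface_divE.
apply: measurable_funB; apply: measurable_sum => k; first exact: measurable_jacobian.
apply: measurable_funM; last exact: measurable_sphere_coord.
apply: measurable_sum => j.
by apply: measurable_funM; [exact: measurable_sphere_coord|exact: measurable_jacobian].
Qed.

Lemma surface_div_bounded Phi : C1_field Phi -> exists C, forall p, `|surface_div Phi p| <= C.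
Proof.
move=> /jacobian_bounded[C C0 hC].
have h p j k : `|jacobian Phi (val p) j k| <= C.
  by apply: le_trans (ler_mx_norm_coord _ _ _) _; apply: hC => i; exact: sphere_coord_le1.
exists (3 * C + 9 * C) => p; rewrite surface_divE.
apply: le_trans (ler_normB _ _) _; apply: lerD.
  rewrite (big_ord3 _ 0); apply: le_trans (ler_normD _ _) _.
  apply: le_trans (lerD (ler_normD _ _) (lexx _)) _.
  by have := h p 0 0; have := h p (0 + 1) (0 + 1); have := h p (0 + 2%:R) (0 + 2%:R); lra.
have e k : `|(\sum_j val p 0 j * jacobian Phi (val p) j k) * val p 0 k| <= 3 * C.
  rewrite normrM -[leRHS]mulr1 ler_pM ?sphere_coord_le1//.
  have e1 j : `|val p 0 j * jacobian Phi (val p) j k| <= C.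
    by rewrite normrM -[leRHS]mul1r ler_pM ?sphere_coord_le1.
  rewrite (big_ord3 _ 0); apply: le_trans (ler_normD _ _) _.
  apply: le_trans (lerD (ler_normD _ _) (lexx _)) _.
  by have := e1 0; have := e1 (0 + 1); have := e1 (0 + 2%:R); lra.
rewrite (big_ord3 _ 0); apply: le_trans (ler_normD _ _) _.
apply: le_trans (lerD (ler_normD _ _) (lexx _)) _.
by have := e 0; have := e (0 + 1); have := e (0 + 2%:R); lra.
Qed.

Definition cross_coord (Phi : 'rV[R]_3 -> 'rV[R]_3) i (u : 'rV[R]_3) : R :=
  u 0 (i + 1) * Phi u 0 (i + 2%:R) - u 0 (i + 2%:R) * Phi u 0 (i + 1).

(* A tangent field Phi is the combination of the axial rotation fields with the
   coordinates of the vector product of the position with Phi as coefficients. *)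
Lemma tangent_field_axes (x g v : 'rV[R]_3) (J : 'M[R]_3) (f : R) : dot x x = 1 -> dot v x = 0 ->
  \sum_i (dot (2 *: axis_cross i x) g * (x 0 (i + 1) * v 0 (i + 2%:R) - x 0 (i + 2%:R) * v 0 (i + 1)) +
    f * (((2 *: axis_cross i x) 0 (i + 1) * v 0 (i + 2%:R) + x 0 (i + 1) * ((2 *: axis_cross i x) *m J) 0 (i + 2%:R)) -
         ((2 *: axis_cross i x) 0 (i + 2%:R) * v 0 (i + 1) + x 0 (i + 2%:R) * ((2 *: axis_cross i x) *m J) 0 (i + 1)))) =
  2 * (dot g v + f * (\sum_k J k k - \sum_k (\sum_j x 0 j * J j k) * x 0 k)).
Proof.
have [e1 [e2 [e3 e4]]] : (1 + 1 = 2%:R :> 'I_3) /\ (1 + 2%:R = 0 :> 'I_3) /\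
    (2%:R + 1 = 0 :> 'I_3) /\ (2%:R + 2%:R = 1 :> 'I_3).
  by do !split; exact: val_inj.
have [a0 a1 a2] := axis_crossE 0 x; have [b0 b1 b2] := axis_crossE 1 x.
have [c0 c1 c2] := axis_crossE 2%:R x.
rewrite ?add0r ?e1 ?e2 ?e3 ?e4 in a0 a1 a2 b0 b1 b2 c0 c1 c2.
have mz a (u : 'rV[R]_3) j : (a *: u) 0 j = a * u 0 j by rewrite mxE.
have mm (u : 'rV[R]_3) j : (u *m J) 0 j = u 0 0 * J 0 j + u 0 1 * J 1 j + u 0 2%:R * J 2%:R j.
  by rewrite mxE (big_ord3 _ 0) !add0r.
rewrite !(big_ord3 _ 0) !(dotE (2 *: _)) !dotE ?add0r ?e1 ?e2 ?e3 ?e4 !mm !mz !a0 !a1 !a2 !b0 !b1 !b2 !c0 !c1 !c2.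
move: (x 0 0) (x 0 1) (x 0 2%:R) => X0 X1 X2 {a0 a1 a2 b0 b1 b2 c0 c1 c2}.
move=> n1 t0; apply/eqP; rewrite -subr_eq0; apply/eqP.
(* The difference of the two sides is a combination of the constraints |x|^2 - 1 and v . x, with
   these explicit cofactors. *)
transitivity (2 * (g 0 0 * v 0 0 + g 0 1 * v 0 1 + g 0 2%:R * v 0 2%:R +
    f * (J 0 0 + J 1 1 + J 2%:R 2%:R)) * (X0 * X0 + X1 * X1 + X2 * X2 - 1) -
  (2 * (g 0 0 * X0 + g 0 1 * X1 + g 0 2%:R * X2) + 4 * f) *
  (v 0 0 * X0 + v 0 1 * X1 + v 0 2%:R * X2)); first by ring.
by rewrite n1 t0; ring.
Qed.

Lemma sderI (s : nat -> R) a a0 a' : (forall n, s n != 0) -> s @ \oo --> 0 ->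
  (fun n => (a n - a0) / s n) @ \oo --> a' -> sder s a a0 a'.
Proof.
move=> s0 scv h; split => //.
rewrite (_ : (fun n => a n) = (fun n => a0 + s n * ((a n - a0) / s n))).
  by rewrite -[X in _ --> X]addr0 -(mul0r a'); apply: cvgD; [exact: cvg_cst|exact: cvgM].
by apply/funext => n; field; exact: s0.
Qed.

Lemma sder_coord (s : nat -> R) n (y : nat -> 'rV[R]_n.+1) (y0 w : 'rV[R]_n.+1) k :
  (forall n, s n != 0) -> s @ \oo --> 0 ->
  (fun n => (s n)^-1 *: (y n - y0)) @ \oo --> w ->
  sder s (fun n => y n 0 k) (y0 0 k) (w 0 k).
Proof.
move=> s0 scv h; apply: sderI => //.
rewrite (_ : (fun m => _) = (fun M : 'rV[R]_n.+1 => M 0 k) \o (fun m => (s m)^-1 *: (y m - y0))).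
  by apply: (cvg_comp _ _ h); exact: coord_continuous.
by apply/funext => m; rewrite /= !mxE mulrC.
Qed.

Lemma cross_coord_lipschitz Phi : C1_field Phi -> exists2 L, 0 <= L & forall i p q,
  `|cross_coord Phi i (val p) - cross_coord Phi i (val q)| <= L * sdist p q.
Proof.
move=> C1; have [C hC] := C1_field_bounded C1.
have [L L0 hL] := C1_field_lipschitz C1.
have C0 : 0 <= C by apply: le_trans (hC point 0).
exists (2 * (C + L)); first by rewrite mulr_ge0// addr_ge0.
move=> i p q.
have e j k : `|val p 0 j * Phi (val p) 0 k - val q 0 j * Phi (val q) 0 k| <= (C + L) * sdist p q.
  rewrite (_ : _ - _ = (val p 0 j - val q 0 j) * Phi (val p) 0 k + val q 0 j * (Phi (val p) 0 k - Phi (val q) 0 k)); last by ring.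
  apply: le_trans (ler_normD _ _) _; rewrite [leRHS]mulrDl !normrM; apply: lerD.
    by rewrite mulrC ler_pM// sphere_coord_lip.
  by rewrite -[leRHS]mul1r ler_pM ?sphere_coord_le1.
rewrite /cross_coord (_ : _ - _ = (val p 0 (i + 1) * Phi (val p) 0 (i + 2%:R) - val q 0 (i + 1) * Phi (val q) 0 (i + 2%:R)) -
   (val p 0 (i + 2%:R) * Phi (val p) 0 (i + 1) - val q 0 (i + 2%:R) * Phi (val q) 0 (i + 1))); last by ring.
apply: le_trans (ler_normB _ _) _.
by have := e (i + 1) (i + 2%:R); have := e (i + 2%:R) (i + 1); lra.
Qed.

Lemma sder_profile (s : nat -> R) A c B d (p : S2) (x : nat -> S2) (w : 'rV[R]_3) :
  quad A c (val p) != 0 ->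
  (forall k, sder s (fun n => val (x n) 0 k) (val p 0 k) (w 0 k)) ->
  sder s (fun n => profile A c B d (x n)) (profile A c B d p) (dot w (profile_dir A c B d p)).
Proof.
move=> q0 h.
rewrite (_ : dot w _ = ((0 < quad A c (val p))%R%:R * dot w (quad_grad A (val p))) * expR (quad B d (val p)) +
  maxr (quad A c (val p)) 0 * (expR (quad B d (val p)) * dot w (quad_grad B (val p)))); last first.
  by rewrite dotC /profile_dir dotZl dotDl !dotZl -!(dotC w); ring.
apply: sderM.
  apply: (sder_max0 q0); exact: sder_quad h.
by apply: sder_expR; exact: sder_quad h.
Qed.

(** For tangent Phi, twice the sum of gradient term and divergence term is the sum over the axes of
    the rotational derivatives of f times the i-th coordinate of p x Phi, whose integral is 0. The
    profile is Lipschitz and fails to be differentiable only where its form vanishes, a null set;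
    this is where a form not identically zero is needed. *)
Lemma profile_weak_gradient A c B d : (exists p : S2, quad A c (val p) != 0) ->
  weak_gradient (profile A c B d) (profile_grad A c B d).
Proof.
move=> /surface_measure_quad0 null.
pose K := quad_bound A c + quad_bound B d.
have AK : quad_bound A c <= K by rewrite lerDl quad_bound_ge0.
have BK : quad_bound B d <= K by rewrite lerDr quad_bound_ge0.
have K0 : 0 <= K by exact: le_trans (quad_bound_ge0 A c) AK.
have Gb p k : `|profile_grad A c B d p 0 k| <= expR K * (6 * K + 6 * K ^+ 2).
  apply: le_trans (enorm_coord _ _) _; apply: le_trans (enorm_tangent _ _) _.
  exact: enorm_profile_dir.
split.
- move=> k; apply/Lfun1_integrable; apply: integrable_bounded.
    exact: measurable_profile_grad.
  by move=> p; exact: Gb.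
- by apply/aeW => p; exact: tangent_dot0.
move=> Phi C1 tPhi.
have [CP hCP] := C1_field_bounded C1.
have [L L0 hL] := C1_field_lipschitz C1.
have [CD hCD] := surface_div_bounded C1.
pose f := profile A c B d; pose G := profile_grad A c B d.
have mG : measurable_fun setT (fun p => dot (G p) (Phi (val p))).
  by apply: measurable_dot => k; [exact: measurable_profile_grad|exact: measurable_C1_field].
have mD : measurable_fun setT (fun p => f p * surface_div Phi p).
  by apply: measurable_funM; [exact: measurable_profile|exact: measurable_surface_div].
have iD : mu.-integrable setT (EFin \o (fun p => f p * surface_div Phi p)).
  apply: (@integrable_bounded _ _ (K * expR K * CD)); first exact: mD.
  by move=> p; rewrite normrM ler_pM//; exact: profile_le.
have iG : mu.-integrable setT (EFin \o (fun p => dot (G p) (Phi (val p)))).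
  pose M := expR K * (6 * K + 6 * K ^+ 2) * CP.
  apply: (@integrable_bounded _ _ (M + M + M)); first exact: mG.
  have h p k : `|G p 0 k * Phi (val p) 0 k| <= M by rewrite normrM ler_pM.
  move=> p; rewrite /dot (big_ord3 _ 0); apply: le_trans (ler_normD _ _) _; apply: lerD => //.
  by apply: le_trans (ler_normD _ _) _; apply: lerD.
suff : \int[mu]_p (2 * (dot (G p) (Phi (val p)) + f p * surface_div Phi p)) = 0.
  have iGD : mu.-integrable setT (EFin \o (fun p => dot (G p) (Phi (val p)) + f p * surface_div Phi p)).
    exact: (integrableD measurableT iG iD).
  rewrite RintegralZl; [|exact: measurableT|exact: iGD].
  rewrite (RintegralD measurableT iG iD) => /eqP; rewrite mulf_eq0 pnatr_eq0/= addrC addr_eq0.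
  by move=> /eqP.
pose s n : R := n.+1%:R^-1.
have s0 n : s n != 0 by rewrite invr_eq0 pnatr_eq0.
have scv : s @ \oo --> 0 by exact: cvg_harmonic.
pose h i p := f p * cross_coord Phi i (val p).
have mc i : measurable_fun setT (fun p => cross_coord Phi i (val p)).
  by apply: measurable_funB; apply: measurable_funM;
    [exact: measurable_sphere_coord|exact: measurable_C1_field|exact: measurable_sphere_coord|exact: measurable_C1_field].
pose L1 := 2 * K * expR K + 2 * K ^+ 2 * expR K.
have CP0 : 0 <= CP by apply: le_trans (hCP point 0).
have cb i p : `|cross_coord Phi i (val p)| <= 2 * CP.
  apply: le_trans (ler_normB _ _) _; rewrite [leRHS]mulr_natl mulr2n.
  by apply: lerD; rewrite normrM -[leRHS]mul1r ler_pM ?sphere_coord_le1.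
have [L2 L20 hL2] := cross_coord_lipschitz C1.
have L10 : 0 <= L1 by rewrite addr_ge0// !mulr_ge0 ?expR_ge0// exprn_ge0.
apply: (@integral_rot_derivative _ h _ (L1 * (2 * CP) + K * expR K * L2) s s0 scv).
- by rewrite addr_ge0// !mulr_ge0// expR_ge0.
- by move=> i; apply: measurable_funM; [exact: measurable_profile|exact: mc].
- by apply: measurable_funM; [exact: measurable_cst|apply: measurable_funD; [exact: mG|exact: mD]].
- move=> i p q; rewrite /h.
  rewrite (_ : _ - _ = (f p - f q) * cross_coord Phi i (val p) +
     f q * (cross_coord Phi i (val p) - cross_coord Phi i (val q))); last by ring.
  apply: le_trans (ler_normD _ _) _; rewrite [leRHS]mulrDl; apply: lerD; rewrite normrM.
    by rewrite mulrAC ler_pM//; exact: profile_lipschitz.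
  by rewrite -mulrA ler_pM//; exact: profile_le.
have : \forall p \ae mu, quad A c (val p) != 0.
  exists [set p | quad A c (val p) = 0]; split => //.
    by have := measurable_quad A c measurableT (measurable_set1 0); rewrite setTI.
  by move=> p /= /negP; rewrite negbK => /eqP.
apply: filterS => p qp.
pose w (i : 'I_3) : 'rV[R]_3 := 2 *: axis_cross i (val p).
have xw (i : 'I_3) := @rot_derivative _ i p _ s0 scv.
have sx (i k : 'I_3) : sder s (fun n => (val (rot i (s n) p) : 'rV[R]_3) 0 k) ((val p : 'rV[R]_3) 0 k) (w i 0 k).
  exact: (sder_coord k s0 scv (xw i)).
have sPhi (i k : 'I_3) : sder s (fun n => Phi (val (rot i (s n) p)) 0 k) (Phi (val p) 0 k)
    ((w i *m jacobian Phi (val p)) 0 k).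
  apply: (@sder_coord _ _ (fun n => Phi (val (rot i (s n) p))) (Phi (val p)) _ k s0 scv).
  rewrite mul_rV_lin1; have [_] := differentiable_seq s0 scv (C1.1 (val p)) (xw i).
  exact.
have sh (i : 'I_3) := sderM (sder_profile B d qp (sx i))
  (sderD (sderM (sx i (i + 1)) (sPhi i (i + 2%:R)))
         (sderN (sderM (sx i (i + 2%:R)) (sPhi i (i + 1))))).
have e := tangent_field_axes (profile_dir A c B d p) (jacobian Phi (val p)) (f p)
  (sphere_dot p) (tPhi p).
rewrite surface_divE /G dot_tangent; last exact: tPhi.
rewrite -e.
rewrite (big_ord3 _ 0).
rewrite (_ : (fun n => _) = (fun n => (h 0 (rot 0 (s n) p) - h 0 p) / s n +
  (h (0 + 1) (rot (0 + 1) (s n) p) - h (0 + 1) p) / s n +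
  (h (0 + 2%:R) (rot (0 + 2%:R) (s n) p) - h (0 + 2%:R) p) / s n)); last first.
  by apply/funext => n; rewrite (big_ord3 _ 0).
by apply: cvgD; [apply: cvgD|]; exact: (sh _).2.
Qed.

End profiles.

(** * The spaces X *)

Section Lnorm_finite_measure.
Context d (T : measurableType d) (R : realType) (mu : {measure set T -> \bar R}).
Hypothesis mufin : mu setT \is a fin_num.
Local Open Scope ereal_scope.
Implicit Types (f g : T -> R) (s : R).

Lemma Lfun_measurable (r : \bar R) f : f \in Lfun mu r -> measurable_fun setT f.
Proof. by rewrite inE => /andP[/[!inE]]. Qed.

Lemma Lfun_fin (r : \bar R) f : f \in Lfun mu r -> 'N[mu]_r[EFin \o f] < +oo.
Proof. by rewrite inE => /andP[_ /[!inE]]. Qed.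

Lemma LfunP' (r : \bar R) f : measurable_fun setT f -> 'N[mu]_r[EFin \o f] < +oo ->
  f \in Lfun mu r.
Proof. by move=> mf ff; rewrite inE; apply/andP; rewrite !inE. Qed.

Lemma measurable_powR_norm s f : measurable_fun setT f ->
  measurable_fun setT (fun x => (`|f x| `^ s)%:E).
Proof.
move=> mf; apply/measurable_EFinP.
by apply: (measurableT_comp (measurable_powR _)); exact: measurableT_comp.
Qed.

Lemma ae_eq_Lnorm (r : \bar R) f g : measurable_fun setT f -> measurable_fun setT g ->
  f = g %[ae mu] -> 'N[mu]_r[EFin \o f] = 'N[mu]_r[EFin \o g].
Proof.
move=> mf mg fg; rewrite unlock /Lnorm; case: r => [s| |].
- congr (_ `^ _); under eq_integral do rewrite -[`|_|]/(`|f _|%:E) poweR_EFin.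
  under [RHS]eq_integral do rewrite -[`|_|]/(`|g _|%:E) poweR_EFin.
  apply: ae_eq_integral => //; try exact: measurable_powR_norm.
  by apply: filterS fg => x /= + _ => /(_ I) ->.
- case: ifP => // _; apply: eq_ess_sup; apply: filterS fg => x /= /(_ I) ->//.
- case: ifP => // _; rewrite !ess_infEN; congr (- _); apply: eq_ess_sup.
  by apply: filterS fg => x /= /(_ I) ->.
Qed.

Lemma ae_eq_Lfun (r : \bar R) f g : measurable_fun setT g ->
  f = g %[ae mu] -> f \in Lfun mu r -> g \in Lfun mu r.
Proof.
move=> mg fg fr; apply: LfunP' => //.
by rewrite -(ae_eq_Lnorm r (Lfun_measurable fr) mg fg); exact: Lfun_fin.
Qed.

Lemma Lnorm1_le (r : \bar R) : 1 <= r -> exists2 C : R, (0 <= C)%R &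
  forall f, measurable_fun setT f -> 'N[mu]_1[EFin \o f] <= C%:E * 'N[mu]_r[EFin \o f].
Proof.
case: r => [s| |//]; last first.
  move=> _; exists (fine (mu setT) + 1)%R; first by rewrite addr_ge0// fine_ge0.
  (* Only for a measure that is not 0 does ['N[mu]_+oo] unfold to an essential supremum. *)
  move=> f mf; have [mu0|mu0] := eqVneq (mu setT) 0.
    rewrite Lnorm1 (_ : \int[mu]_x _ = 0).
      by rewrite mule_ge0 ?Lnorm_ge0// lee_fin addr_ge0// fine_ge0.
    apply: null_set_integral => //; apply: measurableT_comp => //; exact/measurable_EFinP.
  have mup : 0 < mu setT by rewrite lt0e mu0 measure_ge0.
  have N0 := Lnorm_ge0 mu +oo (EFin \o f).
  have aeN : \forall x \ae mu, `|(EFin \o f) x| <= 'N[mu]_+oo[EFin \o f].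
    by rewrite unlock /Lnorm mup; exact: ess_sup_ge.
  move: N0 aeN; case: ('N[mu]_+oo[EFin \o f]) => [M| |//] M0 aeM; last first.
    by rewrite gt0_muley ?leey// lte_fin ltr_wpDl// fine_ge0.
  rewrite Lnorm1; apply: (@le_trans _ _ (\int[mu]_x M%:E)).
    apply: ae_ge0_le_integral => //.
    - by apply: measurableT_comp => //; exact/measurable_EFinP.
    - by apply: filterS aeM => x + _.
  rewrite integral_cst//= -[mu setT]fineK// -!EFinM lee_fin mulrC.
  by rewrite ler_wpM2r// lerDl.
rewrite lee_fin le_eqVlt => /predU1P[<-|s1].
  by exists 1%R => // f mf; rewrite mul1e.
pose q := ((1 - s^-1)^-1)%R.
have s0 : (0 < s)%R by exact: lt_trans s1.
have q0 : (0 < q)%R by rewrite invr_gt0 subr_gt0 invf_lt1.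
exists (fine 'N[mu]_q%:E[cst 1]); first by rewrite fine_ge0// Lnorm_ge0.
move=> f mf.
have := @hoelder _ _ _ mu f (cst 1%R) s q mf (measurable_cst _) s0 q0.
rewrite (_ : (s^-1 + q^-1)%R = 1%R); last by rewrite /q invrK subrKC.
move=> /(_ erefl).
rewrite (_ : (f \* cst 1)%R = f); last by apply/funext => x /=; rewrite mulr1.
move=> /le_trans; apply; rewrite muleC lee_wpmul2r ?Lnorm_ge0//.
rewrite fineK// Lnorm_cst1 -[mu setT]fineK// poweR_EFin//.
Qed.

(** Suited to gradients of nearby profiles: they are uniformly close except near the zero set of the
    form, where the indicator may jump and only a bound L survives. The threshold [e] depends on f
    only through L. *)
Lemma Lnorm_small s (L eps : R) : (1 <= s)%R -> (0 <= L)%R -> (0 < eps)%R ->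
  exists2 e : R, (0 < e)%R & forall f (E : set T), measurable_fun setT f -> measurable E ->
    mu E <= e%:E -> (forall x, `|f x| <= L)%R -> (forall x, ~ E x -> `|f x| <= e)%R ->
    'N[mu]_s%:E[EFin \o f] < eps%:E.
Proof.
move=> s1 L0 eps0.
have s0 : (0 < s)%R by exact: lt_le_trans s1.
pose m := fine (mu setT).
have m0 : (0 <= m)%R by exact: fine_ge0.
have Ls0 : (0 <= L `^ s)%R by exact: powR_ge0.
(* Since e <= 1 gives e^s <= e, the integral of |f|^s is at most e (m + L^s), and this choice makes
   it smaller than eps^s. *)
pose e0 : R := (eps `^ s / (m + L `^ s + 1))%R.
have e00 : (0 < e0)%R by rewrite divr_gt0 ?powR_gt0// ltr_wpDl// addr_ge0.
pose e : R := Num.min 1%R e0.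
have ep : (0 < e)%R by rewrite lt_min ltr01.
exists e => // f E mf mE Ee fL fe.
have e1 : (e `^ s <= e)%R.
  by apply: ge1r_powR => //; rewrite ep ge_min lexx.
have bd x : (`|f x| `^ s <= e `^ s + L `^ s * \1_E x)%R.
  rewrite indicE; have [xE|xE] := boolP (x \in E).
    rewrite mulr1 ler_wpDl ?powR_ge0//; apply: ge0_ler_powR => //; first exact: ltW.
    rewrite mulr0 addr0; apply: ge0_ler_powR; rewrite ?nnegrE//; try exact: ltW.
    by apply: fe => Ex; move/negP: xE; apply; rewrite inE.
have mpow := measurable_powR_norm s mf.
have I : \int[mu]_x (`|f x| `^ s)%:E <= (e * m + L `^ s * e)%:E.
  apply: (@le_trans _ _ (\int[mu]_x ((e `^ s)%:E + (L `^ s)%:E * (\1_E x)%:E))).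
    apply: ge0_le_integral => //.
    - apply: emeasurable_funD; first exact: measurable_cst.
      apply: emeasurable_funM; first exact: measurable_cst.
      by apply/measurable_EFinP; exact: measurable_indic.
    - by move=> x _; rewrite -EFinM -EFinD lee_fin bd.
  rewrite ge0_integralD//; last 2 first.
  - by move=> x _; rewrite -EFinM lee_fin mulr_ge0.
  - apply: emeasurable_funM; first exact: measurable_cst.
    by apply/measurable_EFinP; exact: measurable_indic.
  rewrite integral_cst// ge0_integralZl_EFin//; last first.
    by apply/measurable_EFinP; exact: measurable_indic.
  rewrite integral_indic// setIT EFinD; apply: leeD.
    by rewrite -[mu setT]fineK// -EFinM lee_fin ler_wpM2r.
  by rewrite EFinM lee_wpmul2l// lee_fin.
  by move=> x _; rewrite lee_fin powR_ge0.
have lt : (e * m + L `^ s * e < eps `^ s)%R.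
  rewrite [(e * m)%R]mulrC -mulrDl; apply: (@le_lt_trans _ _ ((m + L `^ s) * e0)%R).
    by rewrite ler_wpM2l ?addr_ge0// ge_min lexx orbT.
  rewrite /e0 mulrCA gtr_pMr ?powR_gt0// ltr_pdivrMr ?mul1r ?ltrDl//.
  by rewrite ltr_wpDl// addr_ge0.
rewrite unlock /Lnorm.
under eq_integral do rewrite -[`|_|]/(`|f _|%:E) poweR_EFin.
set J := \int[mu]_x _ in I *.
have J0 : 0 <= J by apply: integral_ge0 => x _; rewrite lee_fin powR_ge0.
have Jfin : J \is a fin_num by rewrite ge0_fin_numE// (le_lt_trans I)// ltry.
rewrite -(fineK Jfin) poweR_EFin lte_fin.
have -> : eps = ((eps `^ s) `^ s^-1)%R by rewrite -powRrM mulfV ?gt_eqF// powRr1// ltW.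
apply: gt0_ltr_powR; rewrite ?nnegrE ?invr_gt0 ?powR_ge0 ?fine_ge0//.
by apply: le_lt_trans lt; rewrite -lee_fin fineK.
Qed.

Lemma Lnorm_oo_le f (e : R) : (0 <= e)%R -> (forall x, `|f x| <= e)%R ->
  'N[mu]_+oo[EFin \o f] <= e%:E.
Proof.
move=> e0 fe; rewrite unlock /Lnorm; case: ifP => // _.
apply/ess_supP; apply/aeW => x; exact: fe.
Qed.

Lemma Lnorm_bounded_fin (r : \bar R) f C : 1 <= r -> measurable_fun setT f ->
  (forall x, `|f x| <= C)%R -> f \in Lfun mu r.
Proof.
move=> r1 mf fC; apply: LfunP' => //.
case: r r1 => [s| |//] s1; last first.
  apply: (@le_lt_trans _ _ (Num.max C 0)%:E); last by rewrite ltry.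
  by apply: Lnorm_oo_le => // [|x]; rewrite le_max ?lexx ?orbT// fC.
rewrite lee_fin in s1; pose L := Num.max C 0%R.
have L0 : (0 <= L)%R by rewrite le_max lexx orbT.
have fL x : (`|f x| <= L)%R by rewrite le_max fC.
have s0 : (0 < s)%R by exact: lt_le_trans s1.
rewrite unlock /Lnorm poweR_lty//.
under eq_integral do rewrite -[`|_|]/(`|f _|%:E) poweR_EFin.
apply: (@le_lt_trans _ _ (\int[mu]_x (L `^ s)%:E)).
  have mpow := measurable_powR_norm s mf.
  apply: ge0_le_integral => //.
  move=> x _; rewrite lee_fin; apply: ge0_ler_powR => //.
  exact: ltW.
by rewrite integral_cst// -[mu setT]fineK// -EFinM ltry.
Qed.

End Lnorm_finite_measure.

(** * Continuity of the profiles and their gradients in the coefficients *)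

Section profile_continuity.
Context {R : realType}.
Notation S2 := (sphere R).
Notation mu := (@surface_measure R).
Implicit Types (p q : S2) (A B : 'M[R]_3) (c d : R).

Lemma quad_boundD A B c d : quad_bound (A + B) (c + d) <= quad_bound A c + quad_bound B d.
Proof.
rewrite /quad_bound addrACA -big_split/=; apply: lerD; last exact: ler_normD.
apply: ler_sum => i _; rewrite -big_split/=; apply: ler_sum => j _.
by rewrite mxE ler_normD.
Qed.

Lemma quad_close A A' c c' p :
  `|quad A' c' (val p) - quad A c (val p)| <= quad_bound (A' - A) (c' - c).
Proof. by rewrite quadB quad_le. Qed.

Lemma quad_gradB A A' (u : 'rV[R]_3) : quad_grad A' u - quad_grad A u = quad_grad (A' - A) u.
Proof. by apply/rowP => k; rewrite !mxE -sumrB; apply: eq_bigr => j _; rewrite !mxE; ring. Qed.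

Lemma enorm_quad_grad_le A c K p : quad_bound A c <= K -> enorm (quad_grad A (val p)) <= 6 * K.
Proof.
move=> AK; apply: le_trans (enorm_quad_grad _ _) _; rewrite ler_wpM2l//.
by apply: le_trans AK; rewrite lerD2l normr0.
Qed.

(** With equal signs the indicator is a common factor [sgn]; every other factor is bounded and
    Lipschitz in the coefficients, and the difference telescopes. *)
Lemma profile_dir_close A A' c c' B B' d d' (K delta : R) p :
  quad_bound A c <= K -> quad_bound A' c' <= K ->
  quad_bound B d <= K -> quad_bound B' d' <= K ->
  quad_bound (A' - A) (c' - c) <= delta -> quad_bound (B' - B) (d' - d) <= delta ->
  (0 < quad A' c' (val p)) = (0 < quad A c (val p)) ->
  enorm (profile_dir A' c' B' d' p - profile_dir A c B d p) <=
    delta * (expR K * (6 * K ^+ 2 + 18 * K + 6)).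
Proof.
move=> AK A'K BK B'K AA BB sg.
have K0 : 0 <= K by exact: le_trans (quad_bound_ge0 A c) AK.
have d0 : 0 <= delta by exact: le_trans (quad_bound_ge0 _ _) AA.
have vK C e : quad_bound C e <= K -> quad C e (val p) <= K.
  by move=> CK; apply: le_trans (ler_norm _) (le_trans (quad_le _ _ _) CK).
have eK C e : quad_bound C e <= K -> `|expR (quad C e (val p))| <= expR K.
  by move=> CK; rewrite ger0_norm ?expR_ge0// ler_expR vK.
have mK C e : quad_bound C e <= K -> `|maxr (quad C e (val p)) 0| <= K.
  by move=> CK; rewrite ger0_norm ?max0_ge0// max0_le// (le_trans (quad_le _ _ _)).
rewrite /profile_dir sg.
set sgn : R := _%:R.
have sgn1 : `|sgn| <= 1 by rewrite /sgn; case: (0 < _); rewrite ?normr1 ?normr0.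
set e' := expR (quad B' d' (val p)); set e := expR (quad B d (val p)).
set u' := maxr (quad A' c' _) 0; set u := maxr (quad A c _) 0.
set a' := quad_grad A' _; set a := quad_grad A _; set b' := quad_grad B' _; set b := quad_grad B _.
have -> : e' *: (sgn *: a' + u' *: b') - e *: (sgn *: a + u *: b) =
  (e' - e) *: (sgn *: a' + u' *: b') +
  e *: (sgn *: (a' - a) + ((u' - u) *: b' + u *: (b' - b))).
  by apply/rowP => k; rewrite !mxE; ring.
have u'K : `|u'| <= K by exact: mK.
have uK : `|u| <= K by exact: mK.
have a'K : enorm a' <= 6 * K by exact: enorm_quad_grad_le A'K.
have b'K : enorm b' <= 6 * K by exact: enorm_quad_grad_le B'K.
have ad : enorm (a' - a) <= 6 * delta by rewrite quad_gradB; exact: enorm_quad_grad_le AA.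
have bd : enorm (b' - b) <= 6 * delta by rewrite quad_gradB; exact: enorm_quad_grad_le BB.
have ed : `|e' - e| <= expR K * delta.
  apply: le_trans (expR_lipschitz (vK _ _ B'K) (vK _ _ BK)) _.
  by rewrite ler_wpM2l ?expR_ge0// (le_trans (quad_close _ _ _ _ _)).
have ud : `|u' - u| <= delta.
  by apply: le_trans (max0_lipschitz _ _) _; rewrite (le_trans (quad_close _ _ _ _ _)).
have W' : enorm (sgn *: a' + u' *: b') <= 6 * K + K * (6 * K).
  apply: le_trans (enormD _ _) _; rewrite !enormZ; apply: lerD; last by rewrite ler_pM ?enorm_ge0.
  by rewrite -[leRHS]mul1r ler_pM ?enorm_ge0.
apply: le_trans (enormD _ _) _; rewrite !enormZ.
apply: (@le_trans _ _ (expR K * delta * (6 * K + K * (6 * K)) +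
  expR K * (6 * delta + (delta * (6 * K) + K * (6 * delta))))); last first.
  by rewrite le_eqVlt; apply/orP; left; apply/eqP; ring.
apply: lerD; first by rewrite ler_pM ?enorm_ge0.
rewrite ler_pM ?enorm_ge0//; first exact: eK.
apply: le_trans (enormD _ _) _; apply: lerD.
  by rewrite enormZ -[leRHS]mul1r ler_pM ?enorm_ge0.
apply: le_trans (enormD _ _) _; rewrite !enormZ.
by apply: lerD; rewrite ler_pM ?enorm_ge0.
Qed.

Lemma tangentB p (u v : 'rV[R]_3) : tangent p (u - v) = tangent p u - tangent p v.
Proof.
have -> : tangent p (u - v) = (u - v) - (dot u (val p) - dot v (val p)) *: val p.
  by rewrite /tangent; congr (_ - _ *: _); rewrite !dotE !mxE; ring.
by apply/rowP => k; rewrite !mxE; ring.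
Qed.

Lemma measurable_quad_small A c rho : measurable [set p : S2 | `|quad A c (val p)| <= rho].
Proof.
have := measurable_quad A c measurableT (measurable_itv `[- rho, rho]).
rewrite setTI; congr (measurable _); apply/seteqP; split => p /=;
  by rewrite in_itv/= ler_norml.
Qed.

(** Continuity of a finite measure along sets that decrease to the null zero set. *)
Lemma surface_measure_quad_small A c : (exists p : S2, quad A c (val p) != 0) ->
  forall e : R, 0 < e -> exists2 rho, 0 < rho &
    (mu [set p | (`|quad A c (val p)| <= rho)%R] <= e%:E)%E.
Proof.
move=> /surface_measure_quad0 null e e0.
pose E n := [set p : S2 | `|quad A c (val p)| <= n.+1%:R^-1].
have mE n : measurable (E n) by exact: measurable_quad_small.
have cap : \bigcap_n E n = [set p | quad A c (val p) = 0].
  apply/seteqP; split => p /=.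
    move=> h; apply/eqP/negPn/negP => q0.
    have := h (trunc `|quad A c (val p)|^-1) I; rewrite /E /= leNgt => /negP; apply.
    by rewrite -[ltRHS]invrK ltf_pV2 ?posrE ?invr_gt0 ?normr_gt0// truncnS_gt.
  by move=> /= qp n _; rewrite /E/= qp normr0.
have cv : mu \o E @ \oo --> mu (\bigcap_n E n).
  apply: nonincreasing_cvg_mu.
  - apply: le_lt_trans (le_measure mu _ _ (@subsetT _ (E 0%N))) _; rewrite ?inE//.
    by rewrite -ge0_fin_numE ?surface_measure_fin.
  - exact: mE.
  - by apply: bigcap_measurable => // n _; exact: mE.
  - move=> m n mn; apply/subsetPset => p /= qp; apply: le_trans qp _.
    by rewrite lef_pV2 ?posrE// ler_nat.
rewrite cap null in cv; have /fine_cvgP[fin cv'] := cv.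
have [n [fn ln]] := filter_ex (filterI fin (cvgr_lt _ cv' _ e0)).
exists n.+1%:R^-1; first by rewrite invr_gt0.
by rewrite -[leLHS](fineK fn) lee_fin ltW.
Qed.

(** Each conclusion serves a family of spaces: uniform closeness for L^q, the Lipschitz bound on the
    difference for interpolation in C^alpha, the gradient bounds for W^{1,q}. It matters that L is
    chosen before e. *)
Lemma profile_near A c B d : (exists p : S2, quad A c (val p) != 0) ->
  exists2 L : R, 0 <= L & forall e : R, 0 < e -> exists2 delta : R, 0 < delta &
  forall A' c' B' d', quad_bound (A' - A) (c' - c) <= delta ->
    quad_bound (B' - B) (d' - d) <= delta ->
  let D p := profile A' c' B' d' p - profile A c B d p in
  let G p := profile_grad A' c' B' d' p - profile_grad A c B d p in
  [/\ forall p, `|D p| <= e, forall p q, `|D p - D q| <= L * sdist p q,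
      forall p, enorm (G p) <= L &
      exists E : set S2, [/\ measurable E, (mu E <= e%:E)%E &
        forall p, ~ E p -> enorm (G p) <= e]].
Proof.
move=> u0.
pose K := quad_bound A c + quad_bound B d + 1.
have b0 C e := @quad_bound_ge0 R C e.
have AK : quad_bound A c <= K by have := b0 B d; rewrite /K; lra.
have BK : quad_bound B d <= K by have := b0 A c; rewrite /K; lra.
have K1 : 1 <= K by have := b0 A c; have := b0 B d; rewrite /K; lra.
have K0 : 0 <= K by lra.
have eK0 := expR_ge0 K.
pose L1 := 2 * (2 * K * expR K + 2 * K ^+ 2 * expR K).
pose L2 := 2 * (expR K * (6 * K + 6 * K ^+ 2)).
have L10 : 0 <= L1 by rewrite mulr_ge0// addr_ge0// !mulr_ge0// exprn_ge0.
have L20 : 0 <= L2 by rewrite !mulr_ge0// addr_ge0// !mulr_ge0// exprn_ge0.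
exists (L1 + L2); first by rewrite addr_ge0.
move=> e e0.
have [rho rho0 Erho] := surface_measure_quad_small u0 e0.
pose M := expR K * (6 * K ^+ 2 + 18 * K + 6).
have M6 : K * expR K + expR K <= M.
  by rewrite /M; rewrite expr2; nra.
have M0 : 0 < M by rewrite mulr_gt0 ?expR_gt0// expr2; nra.
(* delta < rho keeps the sign of the form wherever its modulus exceeds rho, delta <= 1 keeps the new
   coefficients under K, and e / M yields the closeness e. *)
pose delta := Num.min (Num.min 1 (rho / 2)) (e / M).
have d0 : 0 < delta by rewrite !lt_min ltr01 !divr_gt0.
have d1 : delta <= 1 by rewrite /delta !ge_min lexx.
have drho : delta < rho by rewrite /delta !gt_min ltr_pdivrMr// ltr_pMr// ltr1n orbT.
have de : delta * M <= e by rewrite -ler_pdivlMr// /delta !ge_min lexx !orbT.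
exists delta => // A' c' B' d' AA BB D G.
have A'K : quad_bound A' c' <= K.
  rewrite -(subrK A A') -(subrK c c'); apply: le_trans (quad_boundD _ _ _ _) _.
  by have := b0 B d; rewrite /K; lra.
have B'K : quad_bound B' d' <= K.
  rewrite -(subrK B B') -(subrK d d'); apply: le_trans (quad_boundD _ _ _ _) _.
  by have := b0 A c; rewrite /K; lra.
have nK C x p : quad_bound C x <= K -> `|quad C x (val p)| <= K.
  by move=> CK; apply: le_trans (quad_le _ _ _) CK.
have vK C x p : quad_bound C x <= K -> quad C x (val p) <= K.
  by move=> CK; apply: le_trans (ler_norm _) (nK _ _ _ CK).
have GE p : G p = tangent p (profile_dir A' c' B' d' p - profile_dir A c B d p).
  by rewrite tangentB.
split.
- move=> p; apply: le_trans (@max0_expR_lipschitz _ K _ _ _ _ _ _ _ _) _; try exact: nK; try exact: vK.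
  apply: le_trans de; apply: (@le_trans _ _ (delta * (K * expR K + expR K))); last first.
    by rewrite ler_wpM2l// ltW.
  rewrite [leRHS](_ : _ = expR K * delta + K * expR K * delta); last by ring.
  apply: lerD; rewrite ler_wpM2l ?mulr_ge0//.
    exact: le_trans (quad_close _ _ _ _ _) AA.
  exact: le_trans (quad_close _ _ _ _ _) BB.
- move=> p q; rewrite /D opprB addrACA [X in `|X|](_ : _ = (profile A' c' B' d' p - profile A' c' B' d' q) - (profile A c B d p - profile A c B d q)); last by ring.
  apply: le_trans (ler_normB _ _) _.
  apply: le_trans (lerD (profile_lipschitz A'K B'K p q) (profile_lipschitz AK BK p q)) _.
  rewrite [leLHS](_ : _ = L1 * sdist p q); last by rewrite /L1; ring.
  by rewrite ler_wpM2r ?enorm_ge0// lerDl.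
- move=> p; rewrite GE; apply: le_trans (enorm_tangent _ _) _.
  apply: le_trans (enormD _ _) _; rewrite enormN.
  apply: le_trans (lerD (enorm_profile_dir A'K B'K p) (enorm_profile_dir AK BK p)) _.
  by rewrite [leLHS](_ : _ = L2) ?lerDr// /L2; ring.
- exists [set p | `|quad A c (val p)| <= rho]; split; [exact: measurable_quad_small|exact: Erho|].
  move=> p /= /negP; rewrite -ltNge => qp; rewrite GE; apply: le_trans (enorm_tangent _ _) _.
  apply: le_trans de; apply: profile_dir_close => //.
  have := le_trans (quad_close A A' c c' p) AA.
  set x := quad A' c' _; set y := quad A c _ in qp *.
  rewrite ler_norml => /andP[h1 h2].
  case: (ltP 0 y) => y0; [rewrite gtr0_norm// in qp|rewrite ler0_norm// in qp].
    by apply/idP; lra.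
  by apply/negbTE; rewrite -leNgt; lra.
Qed.

End profile_continuity.

Section weak_gradients.
Context {R : realType}.
Notation S2 := (sphere R).
Notation mu := (@surface_measure R).
Implicit Types (f g h k : S2 -> R) (G H : S2 -> 'rV[R]_3).

Lemma Lfun1_measurable f : f \in Lfun mu 1 -> measurable_fun setT f.
Proof. exact: Lfun_measurable. Qed.

Lemma integrable_mul_bounded f (b : S2 -> R) (C : R) : f \in Lfun mu 1 -> measurable_fun setT b ->
  (forall p, `|b p| <= C) -> mu.-integrable setT (EFin \o (fun p => f p * b p)).
Proof.
move=> f1 mb bC.
have fi : mu.-integrable setT (EFin \o (fun p => C * f p)).
  by have := integrableZl measurableT C ((Lfun1_integrable mu f).1 f1).
have mfb : measurable_fun setT (EFin \o (fun p => f p * b p)).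
  apply/measurable_EFinP.
  by apply: measurable_funM; [exact: Lfun1_measurable|exact: mb].
apply: (le_integrable measurableT mfb _ fi) => p _ /=.
rewrite lee_fin !normrM mulrC ler_wpM2r//.
exact: le_trans (bC p) (ler_norm _).
Qed.

Lemma Lfun_subset1 (r : \bar R) f : (1 <= r)%E -> f \in Lfun mu r -> f \in Lfun mu 1.
Proof. by move=> r1; apply: (Lfun_subset (lexx _) r1 (@surface_measure_fin R) r1). Qed.

Lemma dot_integrable G (Phi : 'rV[R]_3 -> 'rV[R]_3) :
  (forall i, (fun p => G p 0 i) \in Lfun mu 1) -> C1_field Phi ->
  mu.-integrable setT (EFin \o (fun p => dot (G p) (Phi (val p)))).
Proof.
move=> GL C1; have [C hC] := C1_field_bounded C1.
have h i : mu.-integrable setT (EFin \o (fun p => G p 0 i * Phi (val p) 0 i)).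
  apply: (integrable_mul_bounded (GL i)); first exact: measurable_C1_field.
  by move=> p; exact: hC.
have -> : (fun p => dot (G p) (Phi (val p))) = (fun p => G p 0 0 * Phi (val p) 0 0 +
  G p 0 (0 + 1) * Phi (val p) 0 (0 + 1) + G p 0 (0 + 2%:R) * Phi (val p) 0 (0 + 2%:R)).
  by apply/funext => p; rewrite /dot (big_ord3 _ 0).
exact: (integrableD measurableT (integrableD measurableT (h 0) (h (0 + 1))) (h (0 + 2%:R))).
Qed.

Lemma div_integrable f (Phi : 'rV[R]_3 -> 'rV[R]_3) : f \in Lfun mu 1 -> C1_field Phi ->
  mu.-integrable setT (EFin \o (fun p => f p * surface_div Phi p)).
Proof.
move=> f1 C1; have [C hC] := surface_div_bounded C1.
by apply: (integrable_mul_bounded f1 _ hC); exact: measurable_surface_div.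
Qed.

Lemma Lfun1_comb f k (t : R) : f \in Lfun mu 1 -> k \in Lfun mu 1 ->
  (fun p => f p + t * k p) \in Lfun mu 1.
Proof.
move=> f1 k1; apply/Lfun1_integrable.
have := integrableD measurableT ((Lfun1_integrable mu f).1 f1)
  (integrableZl measurableT t ((Lfun1_integrable mu k).1 k1)).
exact.
Qed.

Lemma weak_gradient_comb f k G H (t : R) : f \in Lfun mu 1 -> k \in Lfun mu 1 ->
  weak_gradient f G -> weak_gradient k H ->
  weak_gradient (fun p => f p + t * k p) (fun p => G p + t *: H p).
Proof.
move=> f1 k1 [G1 Gt Gw] [H1 Ht Hw]; split.
- move=> i; rewrite (_ : (fun p => _) = (fun p => G p 0 i + t * H p 0 i)).
    exact: Lfun1_comb.
  by apply/funext => p; rewrite !mxE.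
- by apply: filterS2 Gt Ht => p Gp Hp; rewrite dotDl dotZl Gp Hp mulr0 addr0.
move=> Phi C1 tPhi.
have e1 : (fun p => (f p + t * k p) * surface_div Phi p) =
    (fun p => f p * surface_div Phi p + t * (k p * surface_div Phi p)).
  by apply/funext => p; ring.
have e2 : (fun p => dot (G p + t *: H p) (Phi (val p))) =
    (fun p => dot (G p) (Phi (val p)) + t * dot (H p) (Phi (val p))).
  by apply/funext => p; rewrite dotDl dotZl.
have comb (a b : S2 -> R) : mu.-integrable setT (EFin \o a) -> mu.-integrable setT (EFin \o b) ->
    \int[mu]_p (a p + t * b p) = \int[mu]_p a p + t * \int[mu]_p b p.
  move=> ia ib; rewrite (RintegralD measurableT ia (integrableZl measurableT t ib)).
  by rewrite RintegralZl.
rewrite (_ : \int[mu]_p _ = \int[mu]_p (f p * surface_div Phi p + t * (k p * surface_div Phi p))); last first.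
  by rewrite e1.
rewrite (_ : \int[mu]_p dot (_ + _) _ = \int[mu]_p (dot (G p) (Phi (val p)) + t * dot (H p) (Phi (val p)))); last first.
  by rewrite e2.
rewrite (comb _ _ (div_integrable f1 C1) (div_integrable k1 C1)).
rewrite (comb _ _ (dot_integrable G1 C1) (dot_integrable H1 C1)).
by rewrite Gw// Hw//; ring.
Qed.

Lemma weak_gradient_ae f h G : f \in Lfun mu 1 -> measurable_fun setT h ->
  f = h %[ae mu] -> weak_gradient f G -> weak_gradient h G.
Proof.
move=> f1 mh fh [G1 Gt Gw]; split => // Phi C1 tPhi; rewrite -Gw// /Rintegral; congr fine.
apply: ae_eq_integral; first exact: measurableT.
- apply/measurable_EFinP; apply: measurable_funM; first exact: mh.
  exact: measurable_surface_div.
- apply/measurable_EFinP; apply: measurable_funM; first exact: Lfun1_measurable.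
  exact: measurable_surface_div.
- by apply: filterS fh => p /= /(_ I) ->.
Qed.

End weak_gradients.

Section Lfun_linear.
Context d (T : measurableType d) (R : realType) (mu : {measure set T -> \bar R}).
Implicit Types (f k : T -> R) (r : \bar R).

Lemma Lfun_comb r f k (t : R) : (1 <= r)%E -> f \in Lfun mu r -> k \in Lfun mu r ->
  (fun x => f x + t * k x) \in Lfun mu r.
Proof.
move=> r1 fr kr.
have -> : (fun x => f x + t * k x) = t *: k + f by apply/funext => x; rewrite addrC.
exact: (Lfun_submod_closed mu r1).2.
Qed.

Lemma Lnorm_mono (s : R) f k : 1 <= s -> measurable_fun setT f -> measurable_fun setT k ->
  (forall x, `|f x| <= k x) -> ('N[mu]_s%:E[EFin \o f] <= 'N[mu]_s%:E[EFin \o k])%E.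
Proof.
move=> s1 mf mk fk; have s0 : 0 < s by exact: lt_le_trans s1.
rewrite unlock /Lnorm; apply: gt0_ler_poweR.
- by rewrite invr_ge0 ltW.
- by rewrite in_itv/= leey andbT; apply: integral_ge0 => x _; rewrite lee_fin powR_ge0.
- by rewrite in_itv/= leey andbT; apply: integral_ge0 => x _; rewrite lee_fin powR_ge0.
under eq_integral do rewrite -[`|_|%E]/(`|f _|%:E) poweR_EFin.
under [leRHS]eq_integral do rewrite -[`|_|%E]/(`|k _|%:E) poweR_EFin.
have mf' := measurable_powR_norm s mf; have mk' := measurable_powR_norm s mk.
apply: ge0_le_integral => //.
move=> x _; rewrite lee_fin; apply: ge0_ler_powR; [exact: ltW|by rewrite nnegrE|by rewrite nnegrE|].
exact: le_trans (fk x) (ler_norm _).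
Qed.

Lemma Lnorm_scale r k (t : R) : (1 <= r)%E -> k \in Lfun mu r ->
  ('N[mu]_r[EFin \o (fun x => t * k x)%R] = `|t|%:E * 'N[mu]_r[EFin \o k])%E.
Proof. by move=> r1 kr; have := LnormZ (Lfun_Sub r1 kr) t. Qed.

Lemma Lnorm_scale_small r k (eps : R) : (1 <= r)%E -> k \in Lfun mu r -> 0 < eps ->
  exists2 delta : R, 0 < delta & forall t : R, `|t| <= delta ->
    ('N[mu]_r[EFin \o (fun x => t * k x)%R] < eps%:E)%E.
Proof.
move=> r1 kr e0; have N0 := Lnorm_ge0 mu r (EFin \o k).
have Nfin : ('N[mu]_r[EFin \o k] \is a fin_num)%E by rewrite ge0_fin_numE//; exact: Lfun_fin.
pose N := fine ('N[mu]_r[EFin \o k])%E.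
have N1 : 0 <= N by exact: fine_ge0.
exists (eps / (N + 1)); first by rewrite divr_gt0// ltr_wpDl.
move=> t te; rewrite Lnorm_scale// -(fineK Nfin) -EFinM lte_fin -/N.
apply: (@le_lt_trans _ _ (eps / (N + 1) * N)); first by rewrite ler_wpM2r.
by rewrite mulrAC ltr_pdivrMr ?ltr_wpDl// ltr_pM2l// ltrDl.
Qed.

End Lfun_linear.

Section usual_spaces.
Context {R : realType}.
Notation S2 := (sphere R).
Notation mu := (@surface_measure R).
Implicit Types (f g h k : S2 -> R) (X : fun_space R) (eps delta t : R).

Let mufin := @surface_measure_fin R.

Lemma Lnorm1_small_of_Lnorm (r : \bar R) eps : (1 <= r)%E -> 0 < eps ->
  exists2 delta, 0 < delta & forall g, measurable_fun setT g ->
    ('N[mu]_r[EFin \o g] < delta%:E -> 'N[mu]_1[EFin \o g] < eps%:E)%E.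
Proof.
move=> r1 e0; have [C C0 hC] := Lnorm1_le mufin r1.
exists (eps / (C + 1)); first by rewrite divr_gt0// ltr_wpDl.
move=> g mg gd; apply: le_lt_trans (hC g mg) _.
have N0 := Lnorm_ge0 mu r (EFin \o g).
have Nfin : ('N[mu]_r[EFin \o g] \is a fin_num)%E by rewrite ge0_fin_numE// (lt_trans gd)// ltry.
rewrite -(fineK Nfin) lte_fin in gd; rewrite -(fineK Nfin) -EFinM lte_fin.
apply: (@le_lt_trans _ _ (C * (eps / (C + 1)))); first by rewrite ler_wpM2l// ltW.
by rewrite mulrCA gtr_pMr// ltr_pdivrMr ?mul1r ?ltrDl// ltr_wpDl.
Qed.

Lemma sup_norm_ge0 k : (0 <= sup_norm k)%E.
Proof.
apply: (@le_trans _ _ `|k point|%:E); first by rewrite lee_fin.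
by apply: ereal_sup_ubound; exists point.
Qed.

Lemma opp_sphere_subproof (p : S2) : dot (- val p) (- val p) == 1.
Proof.
have := sphere_dot p; rewrite !dotE !mxE => e; apply/eqP.
by rewrite -[RHS]e; ring.
Qed.

(** A supremum over no pairs would be -oo; a point and its antipode provide a pair of distinct
    points. *)
Lemma hoelder_seminorm_ge0 alpha k : (0 <= hoelder_seminorm alpha k)%E.
Proof.
pose q : S2 := exist (fun u : 'rV[R]_3 => is_true (dot u u == 1)) _ (opp_sphere_subproof point).
apply: (@le_trans _ _ (`|k point - k q| / sdist point q `^ alpha)%:E).
  by rewrite lee_fin divr_ge0// powR_ge0.
apply: ereal_sup_ubound; exists (point, q) => //=; apply/eqP => /(congr1 val) /= pq.
have e i : val (point : S2) 0 i = 0.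
  by move/rowP: pq => /(_ i); rewrite !mxE => h; lra.
by have := sphere_dot (point : S2); rewrite dotE !e; lra.
Qed.

Lemma hoelder_norm_ge0 alpha k : (0 <= hoelder_norm alpha k)%E.
Proof.
rewrite adde_ge0 ?sup_norm_ge0//; case: ifP => // _; exact: hoelder_seminorm_ge0.
Qed.

(** This embedding in L^1, [usual_ae], [usual_norm_ae], [usual_comb], [usual_scale],
    [usual_profile_mem] and [usual_profile_near] are the interface through which the final argument
    sees X; the three families are not distinguished afterwards. *)
Lemma usual_embed X eps : usual_space X -> 0 < eps ->
  exists2 delta, 0 < delta & forall g, measurable_fun setT g ->
    (fs_norm X g < delta%:E -> 'N[mu]_1[EFin \o g] < eps%:E)%E.
Proof.
move=> uX e0; case: uX => [r r1|alpha _|s s1] /=.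
- exact: Lnorm1_small_of_Lnorm.
- have [delta d0 hd] := @Lnorm1_small_of_Lnorm +oo%E eps (leey _) e0.
  exists (delta / 2); first by rewrite divr_gt0.
  move=> g mg /ereal_inf_lt[_ [k [ck gk] <-]] kd.
  have mk : measurable_fun setT k by exact: measurable_continuous_sphere.
  apply: hd => //; apply: (@le_lt_trans _ _ (delta / 2)%:E); last by rewrite lte_fin; lra.
  rewrite (ae_eq_Lnorm _ mg mk gk); apply: Lnorm_oo_le; first by rewrite divr_ge0// ltW.
  move=> p; rewrite -lee_fin; apply: le_trans (ltW kd).
  rewrite /hoelder_norm; apply: (@le_trans _ _ (sup_norm k)).
    by apply: ereal_sup_ubound; exists p.
  rewrite leeDl//; case: ifP => // _; exact: hoelder_seminorm_ge0.
- have [delta d0 hd] := @Lnorm1_small_of_Lnorm s%:E eps s1 e0.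
  exists delta => // g mg /ereal_inf_lt[_ [G _ <-]] gd.
  by apply: hd => //; apply: le_lt_trans gd; rewrite leeDl// Lnorm_ge0.
Qed.

Lemma usual_ae X f h : usual_space X -> measurable_fun setT h ->
  f = h %[ae mu] -> fs_mem X f -> fs_mem X h.
Proof.
move=> uX mh fh; case: uX => [r r1|alpha _|s s1] /=.
- exact: ae_eq_Lfun.
- by move=> [g [cg fg ng]]; exists g; split => //; apply: filterS2 fh fg => p /= + + _ => /(_ I) -> /(_ I).
- move=> [fs [G wG Gs]]; split; first exact: ae_eq_Lfun fs.
  exists G => //; apply: weak_gradient_ae wG => //.
  by apply: Lfun_subset1 fs; rewrite lee_fin.
Qed.

Lemma usual_norm_ae X f h : usual_space X -> f \in Lfun mu 1 -> h \in Lfun mu 1 ->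
  f = h %[ae mu] -> fs_norm X f = fs_norm X h.
Proof.
move=> uX f1 h1 fh.
have mf := Lfun_measurable f1; have mh := Lfun_measurable h1.
have hf : h = f %[ae mu] by apply: filterS fh => p /= + _ => /(_ I).
case: uX => [r r1|alpha _|s s1] /=.
- exact: ae_eq_Lnorm.
- congr (ereal_inf (_ @` _)); apply/seteqP; split => g [cg fg]; split => //.
    by apply: filterS2 fg fh => p /= + + _ => /(_ I) <- /(_ I).
  by apply: filterS2 fg fh => p /= + + _ => /(_ I) <- /(_ I).
- rewrite (ae_eq_Lnorm _ mf mh fh).
  congr (ereal_inf (_ @` _)); apply/seteqP; split => G wG.
    exact: weak_gradient_ae wG.
  exact: weak_gradient_ae wG.
Qed.

Lemma hoelder_norm_scale (alpha : R) k t :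
  (hoelder_norm alpha (fun p => t * k p)%R <= `|t|%:E * hoelder_norm alpha k)%E.
Proof.
rewrite /hoelder_norm ge0_muleDr ?sup_norm_ge0//; last first.
  by case: ifP => // _; exact: hoelder_seminorm_ge0.
apply: leeD.
  apply: ge_ereal_sup => _ [p _ <-]; rewrite normrM EFinM lee_wpmul2l//.
  by apply: ereal_sup_ubound; exists p.
case: ifP => _; first by rewrite mule0.
apply: ge_ereal_sup => _ [[p q] pq <-]; rewrite -mulrBr normrM -mulrA EFinM lee_wpmul2l//.
by apply: ereal_sup_ubound; exists (p, q).
Qed.

Lemma hoelder_normD (alpha : R) f k :
  (hoelder_norm alpha (fun p => f p + k p)%R <= hoelder_norm alpha f + hoelder_norm alpha k)%E.
Proof.
rewrite /hoelder_norm addeACA; apply: leeD.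
  apply: ge_ereal_sup => _ [p _ <-].
  apply: (@le_trans _ _ (`|f p|%:E + `|k p|%:E)%E); first by rewrite -EFinD lee_fin ler_normD.
  by apply: leeD; apply: ereal_sup_ubound; exists p.
case: ifP => _; first by rewrite adde0.
apply: ge_ereal_sup => _ [[p q] /= pq <-].
apply: (@le_trans _ _ ((`|f p - f q| / sdist p q `^ alpha)%:E + (`|k p - k q| / sdist p q `^ alpha)%:E)%E).
  rewrite -EFinD lee_fin -mulrDl ler_wpM2r ?invr_ge0 ?powR_ge0//.
  by rewrite opprD addrACA ler_normD.
by apply: leeD; apply: ereal_sup_ubound; exists (p, q).
Qed.

Lemma usual_comb X f k t : usual_space X -> fs_mem X f -> fs_mem X k ->
  fs_mem X (fun p => f p + t * k p).
Proof.
move=> uX; case: uX => [r r1|alpha /andP[a0 _]|s s1] /=.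
- exact: Lfun_comb.
- move=> [f' [cf ff nf]] [k' [ck kk nk]]; exists (fun p => f' p + t * k' p); split.
  + move=> p; have ctk : {for p, continuous (fun q => t * k' q)}.
      exact: (continuousM (@cst_continuous _ _ t p) (ck p)).
    exact: (continuousD (cf p) ctk).
  + by apply: filterS2 ff kk => p /= fp kp _; rewrite fp// kp.
  + apply: le_lt_trans (hoelder_normD _ _ _) _; rewrite lte_add_pinfty//.
    apply: le_lt_trans (hoelder_norm_scale _ _ _) _.
    by rewrite lte_mul_pinfty// lee_fin.
- move=> [fs [G wG Gs]] [ks [H wH Hs]]; split; first by apply: Lfun_comb; rewrite ?lee_fin.
  exists (fun p => G p + t *: H p).
    apply: weak_gradient_comb => //; apply: (@Lfun_subset1 _ s%:E) => //; by rewrite lee_fin.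
  have mGH : measurable_fun setT (enorm \o (fun p => G p + t *: H p)).
    apply: measurable_enorm => i.
    have [G1 _ _] := wG; have [H1 _ _] := wH.
    rewrite (_ : (fun p => _) = (fun p => G p 0 i + t * H p 0 i)).
      exact: (Lfun_measurable (Lfun1_comb t (G1 i) (H1 i))).
    by apply/funext => p; rewrite !mxE.
  apply: LfunP' => //.
  have s1' : (1 <= s%:E)%E by rewrite lee_fin.
  have sum := Lfun_comb `|t| s1' Gs Hs.
  apply: le_lt_trans (Lfun_fin sum).
  apply: (Lnorm_mono mu s1 mGH (Lfun_measurable sum)).
  move=> p /=; rewrite ger0_norm ?enorm_ge0//; apply: le_trans (enormD _ _) _.
  by rewrite enormZ.
Qed.

Lemma usual_scale X k eps : usual_space X -> fs_mem X k -> 0 < eps ->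
  exists2 delta, 0 < delta & forall t, `|t| <= delta ->
    (fs_norm X (fun p => (t * k p)%R) < eps%:E)%E.
Proof.
move=> uX; case: uX => [r r1|alpha /andP[a0 _]|s s1] /=.
- by move=> kr e0; exact: Lnorm_scale_small.
- move=> [k' [ck kk nk]] e0.
  have N0 := hoelder_norm_ge0 alpha k'.
  have Nfin : hoelder_norm alpha k' \is a fin_num by rewrite ge0_fin_numE.
  exists (eps / (fine (hoelder_norm alpha k') + 1)).
    by rewrite divr_gt0// ltr_wpDl// fine_ge0.
  move=> t te; apply: (@le_lt_trans _ _ (hoelder_norm alpha (fun p => t * k' p))).
    apply: ereal_inf_lbound; exists (fun p => t * k' p) => //; split.
      by move=> p; exact: (continuousM (@cst_continuous _ _ t p) (ck p)).
    by apply: filterS kk => p /= kp _; rewrite kp.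
  apply: le_lt_trans (hoelder_norm_scale _ _ _) _.
  rewrite -(fineK Nfin) -EFinM lte_fin; set N := fine _ in te *.
  have N1 : 0 <= N by exact: fine_ge0.
  apply: (@le_lt_trans _ _ (eps / (N + 1) * N)); first by rewrite ler_wpM2r.
  by rewrite mulrAC ltr_pdivrMr ?ltr_wpDl// ltr_pM2l// ltrDl.
- move=> [ks [H wH Hs]] e0.
  have e2 : 0 < eps / 2 by rewrite divr_gt0.
  have s1' : (1 <= s%:E)%E by rewrite lee_fin.
  have [d1 d10 h1] := Lnorm_scale_small s1' ks e2.
  have [d2 d20 h2] := Lnorm_scale_small s1' Hs e2.
  exists (Num.min d1 d2); first by rewrite lt_min d10.
  move=> t; rewrite le_min => /andP[td1 td2].
  have k1 : k \in Lfun mu 1 by exact: Lfun_subset1 ks.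
  apply: (@le_lt_trans _ _ ('N[mu]_s%:E[EFin \o (fun p => (t * k p)%R)] +
      'N[mu]_s%:E[EFin \o (fun p => (t * (enorm \o H) p)%R)])%E); last first.
    by rewrite [eps]splitr EFinD lteD// ?h1// h2.
  apply: ereal_inf_lbound; exists (fun p => t *: H p); last first.
    congr (_ + _)%E; rewrite -[RHS]Lnorm_abse -[LHS]Lnorm_abse; apply: eq_Lnorm => p /=.
    by rewrite enormZ !normrM normr_id.
  (* Combining the zero function, of zero weak gradient, with t times k gives the weak gradient of
     the multiple. *)
  have c0 : (fun=> 0 : R) \in Lfun mu 1.
    by apply: (@Lnorm_bounded_fin _ _ _ _ mufin _ _ 0) => // p; rewrite normr0.
  have w0 : weak_gradient (fun=> 0) (fun=> 0 : 'rV[R]_3).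
    split.
    - by move=> i; rewrite (_ : (fun=> _) = (fun=> 0))//; apply/funext => p; rewrite mxE.
    - by apply/aeW => p; rewrite dotE !mxE; ring.
    - move=> Phi _ _.
      rewrite (_ : (fun p => _) = (fun=> 0)); last by apply/funext => p; rewrite mul0r.
      rewrite (_ : (fun p => dot _ _) = (fun=> 0)); last first.
        by apply/funext => p; rewrite dotE !mxE; ring.
      by rewrite /Rintegral integral0 /= oppr0.
  have := weak_gradient_comb t c0 k1 w0 wH.
  rewrite (_ : (fun p => 0 + t * k p) = (fun p => t * k p)); last by apply/funext => p; rewrite add0r.
  by rewrite (_ : (fun p => 0 + t *: H p) = (fun p => t *: H p))//; apply/funext => p; rewrite add0r.
Qed.

End usual_spaces.

Section profiles_in_usual_spaces.
Context {R : realType}.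
Notation S2 := (sphere R).
Notation mu := (@surface_measure R).
Implicit Types (X : fun_space R) (A B : 'M[R]_3) (c d eps : R).

Let mufin := @surface_measure_fin R.

(* Interpolation between the supremum and the Lipschitz seminorm. *)
Lemma hoelder_norm_le (alpha M L : R) (D : S2 -> R) : 0 <= alpha < 1 -> 0 <= L ->
  (forall p, `|D p| <= M) -> (forall p q, `|D p - D q| <= L * sdist p q) ->
  (hoelder_norm alpha D <= (M + (2 * M) `^ (1 - alpha) * L `^ alpha)%:E)%E.
Proof.
move=> /andP[a0 a1] L0 DM DL; rewrite /hoelder_norm EFinD; apply: leeD.
  by apply: ge_ereal_sup => _ [p _ <-]; rewrite lee_fin.
case: ifP => _; first by rewrite lee_fin mulr_ge0// powR_ge0.
apply: ge_ereal_sup => _ [[p q] /= pq <-]; rewrite lee_fin.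
have d0 : 0 < sdist p q.
  rewrite lt_neqAle enorm_ge0 andbT eq_sym; apply: contra pq => /eqP pq.
  by apply/eqP; exact: sdist_positivity.
rewrite ler_pdivrMr ?powR_gt0// -mulrA -powRM// ?enorm_ge0//.
have M0 : 0 <= M by apply: le_trans (DM point).
apply: (@le_trans _ _ (`|D p - D q| `^ (1 - alpha) * `|D p - D q| `^ alpha)).
  by rewrite -powRD subrK ?powRr1// oner_eq0.
rewrite ler_pM ?powR_ge0//; apply: ge0_ler_powR; rewrite ?nnegrE ?subr_ge0//.
- exact: ltW.
- by rewrite mulr_ge0.
- by apply: le_trans (ler_normB _ _) _; rewrite mulr_natl mulr2n lerD.
- by rewrite mulr_ge0// ltW.
Qed.

Lemma hoelder_bound_small (alpha L eps : R) : alpha < 1 -> 0 < eps ->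
  exists2 e : R, 0 < e & e + (2 * e) `^ (1 - alpha) * L `^ alpha < eps.
Proof.
move=> a1 e0; have b0 : 0 < 1 - alpha by rewrite subr_gt0.
have La : 0 < L `^ alpha + 1 by rewrite ltr_wpDl// powR_ge0.
(* [x] is the size wanted for (2 e)^(1 - alpha). It is solved for e with the exponent 1 / (1 -
   alpha), which needs alpha < 1. *)
pose x := (eps / 2) / (L `^ alpha + 1).
have x0 : 0 < x by rewrite !divr_gt0.
pose e := Num.min (eps / 4) (x `^ (1 - alpha)^-1 / 2).
have ep : 0 < e by rewrite lt_min !divr_gt0// powR_gt0.
exists e => //.
have e1 : e <= eps / 4 by rewrite ge_min lexx.
have e2 : (2 * e) `^ (1 - alpha) <= x.
  have -> : x = (x `^ (1 - alpha)^-1) `^ (1 - alpha).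
    by rewrite -powRrM mulVf ?gt_eqF// powRr1// ltW.
  apply: ge0_ler_powR; [exact: ltW|by rewrite nnegrE mulr_ge0// ltW|by rewrite nnegrE powR_ge0|].
  by rewrite mulrC -ler_pdivlMr// ge_min lexx orbT.
have e3 : (2 * e) `^ (1 - alpha) * L `^ alpha <= eps / 2.
  apply: (@le_trans _ _ (x * (L `^ alpha + 1))).
    by rewrite ler_pM ?powR_ge0// lerDl.
  by rewrite /x divfK// gt_eqF.
lra.
Qed.

Lemma continuous_profile A c B d : continuous (profile A c B d).
Proof.
pose K := quad_bound A c + quad_bound B d.
have AK : quad_bound A c <= K by rewrite lerDl quad_bound_ge0.
have BK : quad_bound B d <= K by rewrite lerDr quad_bound_ge0.
exact: (@continuous_lipschitz_sphere _ R^o _ _ (profile_lipschitz AK BK)).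
Qed.

Lemma usual_profile_mem X A c B d : usual_space X ->
  (exists p : S2, quad A c (val p) != 0) -> fs_mem X (profile A c B d).
Proof.
move=> uX u0.
pose K := quad_bound A c + quad_bound B d.
have AK : quad_bound A c <= K by rewrite lerDl quad_bound_ge0.
have BK : quad_bound B d <= K by rewrite lerDr quad_bound_ge0.
have K0 : 0 <= K by exact: le_trans (quad_bound_ge0 A c) AK.
have mp := measurable_profile A c B d.
have Lf (r : \bar R) : (1 <= r)%E -> profile A c B d \in Lfun mu r.
  by move=> r1; exact: (Lnorm_bounded_fin mufin r1 mp (profile_le AK BK)).
case: uX => [r r1|alpha a01|s s1] /=.
- exact: Lf.
- exists (profile A c B d); split; [exact: continuous_profile|exact: aeW|].
  apply: le_lt_trans (hoelder_norm_le a01 _ (profile_le AK BK) (profile_lipschitz AK BK)) _.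
    by rewrite addr_ge0// !mulr_ge0 ?expR_ge0// exprn_ge0.
  by rewrite ltry.
- have s1' : (1 <= s%:E)%E by rewrite lee_fin.
  split; first exact: Lf.
  exists (profile_grad A c B d); first exact: profile_weak_gradient.
  apply: (Lnorm_bounded_fin mufin s1' (measurable_enorm (measurable_profile_grad A c B d))) => p /=.
  rewrite ger0_norm ?enorm_ge0//; apply: le_trans (enorm_tangent _ _) _.
  exact: enorm_profile_dir AK BK p.
Qed.

Lemma usual_profile_near X A c B d eps : usual_space X -> 0 < eps ->
  (exists p : S2, quad A c (val p) != 0) ->
  exists2 delta : R, 0 < delta & forall A' c' B' d',
    (exists p : S2, quad A' c' (val p) != 0) ->
    quad_bound (A' - A) (c' - c) <= delta -> quad_bound (B' - B) (d' - d) <= delta ->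
    (fs_norm X (profile A' c' B' d' \- profile A c B d)%R < eps%:E)%E.
Proof.
move=> uX eps0 u0; have [L L0 near] := profile_near B d u0.
have mD A' c' B' d' : measurable_fun setT (profile A' c' B' d' \- profile A c B d).
  by apply: measurable_funB; exact: measurable_profile.
(* The case of an empty exceptional set: uniform smallness gives smallness in L^s. *)
have Leb (s : R) (e0 : R) : 1 <= s -> 0 < e0 -> exists2 e : R, 0 < e & forall f : S2 -> R,
    measurable_fun setT f -> (forall p, `|f p| <= e) -> ('N[mu]_s%:E[EFin \o f] < e0%:E)%E.
  move=> s1 e00; have [e ep he] := Lnorm_small mufin s1 ler01 e00.
  exists (Num.min e 1); first by rewrite lt_min ep ltr01.
  move=> f mf fe; apply: (he f set0) => //.
  - by rewrite measure0 lee_fin ltW.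
  - by move=> p; apply: le_trans (fe p) _; rewrite ge_min lexx orbT.
  - by move=> p _; apply: le_trans (fe p) _; rewrite ge_min lexx.
case: uX => [[s| |] r1|alpha a01|s s1] //=.
- rewrite lee_fin in r1; have [e e0 he] := Leb s eps r1 eps0.
  have [delta d0 hd] := near e e0; exists delta => // A' c' B' d' _ AA BB.
  by apply: he; [exact: mD|have [] := hd _ _ _ _ AA BB].
- have e2 : 0 < eps / 2 by rewrite divr_gt0.
  have [delta d0 hd] := near _ e2; exists delta => // A' c' B' d' _ AA BB.
  apply: (@le_lt_trans _ _ (eps / 2)%:E); last by rewrite lte_fin; lra.
  apply: Lnorm_oo_le; first exact: ltW.
  by have [] := hd _ _ _ _ AA BB.
- have /andP[_ a1] := a01.
  have [e e0 he] := hoelder_bound_small L a1 eps0.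
  have [delta d0 hd] := near e e0; exists delta => // A' c' B' d' _ AA BB.
  have [De DL _ _] := hd _ _ _ _ AA BB.
  apply: (@le_lt_trans _ _ (hoelder_norm alpha (profile A' c' B' d' \- profile A c B d))); last first.
    by apply: le_lt_trans (hoelder_norm_le a01 L0 De DL) _; rewrite lte_fin.
  apply: ereal_inf_lbound; exists (profile A' c' B' d' \- profile A c B d) => //; split; last exact: aeW.
  exact: (@continuous_lipschitz_sphere _ R^o _ _ DL).
have e2 : 0 < eps / 2 by rewrite divr_gt0.
have [e1 e10 he1] := Leb s _ s1 e2.
(* For the gradients the exceptional set is genuine, and the constant L, independent of e, bounds
   them on it. *)
have [e2' e20 he2] := Lnorm_small mufin s1 L0 e2.
have e0 : 0 < Num.min e1 e2' by rewrite lt_min e10.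
have [delta d0 hd] := near _ e0; exists delta => // A' c' B' d' u0' AA BB.
have [De _ GL [E [mE Ee Ge]]] := hd _ _ _ _ AA BB.
pose G p := profile_grad A' c' B' d' p - profile_grad A c B d p.
have mG : measurable_fun setT (fun p => enorm (G p)).
  apply: measurable_enorm => k.
  rewrite (_ : (fun p => _) = (fun p => profile_grad A' c' B' d' p 0 k - profile_grad A c B d p 0 k)).
    by apply: measurable_funB; exact: measurable_profile_grad.
  by apply/funext => p; rewrite /G !mxE.
apply: (@le_lt_trans _ _ ('N[mu]_s%:E[EFin \o (profile A' c' B' d' \- profile A c B d)%R] +
  'N[mu]_s%:E[EFin \o (enorm \o G)])%E); last first.
  rewrite [eps]splitr EFinD lteD//.
    by apply: he1; [exact: mD|move=> p; apply: le_trans (De p) _; rewrite ge_min lexx].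
  apply: (he2 _ E mG mE).
  - by apply: le_trans Ee _; rewrite lee_fin ge_min lexx orbT.
  - by move=> p; rewrite ger0_norm ?enorm_ge0//; exact: GL.
  - move=> p /Ge h; rewrite ger0_norm ?enorm_ge0//; apply: le_trans h _.
    by rewrite ge_min lexx orbT.
apply: ereal_inf_lbound; exists G => //.
have s1' : (1 <= s%:E)%E by rewrite lee_fin.
have pL C x V y : (exists p : S2, quad C x (val p) != 0) -> profile C x V y \in Lfun mu 1.
  by move=> h; exact: (usual_profile_mem V y (usual_Lebesgue (lexx 1%E)) h).
have := weak_gradient_comb (-1) (pL _ _ _ _ u0') (pL _ _ _ _ u0)
  (profile_weak_gradient B' d' u0') (profile_weak_gradient B d u0).
rewrite (_ : (fun p => _ + -1 * _) = (profile A' c' B' d' \- profile A c B d)); last first.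
  by apply/funext => p; rewrite mulN1r.
by rewrite (_ : (fun p => _ + -1 *: _) = G)//; apply/funext => p; rewrite scaleN1r.
Qed.

End profiles_in_usual_spaces.

(** * Moments and entropy *)

Section moments.
Context {R : realType}.
Notation S2 := (sphere R).
Notation mu := (@surface_measure R).
Implicit Types (p q : S2) (f g h : S2 -> R) (A B M : 'M[R]_3) (c d : R).

Let mufin := @surface_measure_fin R.

Definition moments f : 'M[R]_3 := \matrix_(i, j) \int[mu]_p (f p * (val p 0 i * val p 0 j)).

Definition minner B M : R := \sum_i \sum_j B i j * M i j.

Lemma measurable_coordM i j : measurable_fun setT (fun p : S2 => val p 0 i * val p 0 j).
Proof. by apply: measurable_funM; exact: measurable_sphere_coord. Qed.

Lemma coordM_le1 p i j : `|val p 0 i * val p 0 j| <= 1.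
Proof. by rewrite normrM mulr_ile1// sphere_coord_le1. Qed.

Lemma integrable_moment f i j : f \in Lfun mu 1 ->
  mu.-integrable setT (EFin \o (fun p => f p * (val p 0 i * val p 0 j))).
Proof.
move=> f1; apply: (integrable_mul_bounded f1 (measurable_coordM i j) (C := 1)) => p.
exact: coordM_le1.
Qed.

Lemma Rintegral_sum3 (F : 'I_3 -> S2 -> R) :
  (forall i, mu.-integrable setT (EFin \o F i)) ->
  mu.-integrable setT (EFin \o (fun p => \sum_i F i p)) /\
  \int[mu]_p (\sum_i F i p) = \sum_i \int[mu]_p F i p.
Proof.
move=> iF.
have e : (fun p => \sum_i F i p) = (fun p => F 0 p + F (0 + 1) p + F (0 + 2%:R) p).
  by apply/funext => p; rewrite (big_ord3 _ 0).
have i01 := integrableD measurableT (iF 0) (iF (0 + 1)).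
split; first by rewrite e; exact: (integrableD measurableT i01 (iF (0 + 2%:R))).
rewrite (_ : \int[mu]_p _ = \int[mu]_p (F 0 p + F (0 + 1) p + F (0 + 2%:R) p)); last by rewrite e.
rewrite (RintegralD measurableT i01 (iF (0 + 2%:R))) (RintegralD measurableT (iF 0) (iF (0 + 1))).
by rewrite (big_ord3 _ 0).
Qed.

Lemma integral_quad f A c : f \in Lfun mu 1 ->
  mu.-integrable setT (EFin \o (fun p => f p * quad A c (val p))) /\
  \int[mu]_p (f p * quad A c (val p)) = minner A (moments f) + c * \int[mu]_p f p.
Proof.
move=> f1; have fi := (Lfun1_integrable mu f).1 f1.
have iF i j : mu.-integrable setT (EFin \o (fun p => A i j * (f p * (val p 0 i * val p 0 j)))).
  exact: (integrableZl measurableT (A i j) (integrable_moment i j f1)).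
have s1 i := @Rintegral_sum3 (fun j p => A i j * (f p * (val p 0 i * val p 0 j))) (iF i).
have [s2 s3] := @Rintegral_sum3 (fun i p => \sum_j A i j * (f p * (val p 0 i * val p 0 j)))
  (fun i => (s1 i).1).
have cf := integrableZl measurableT c fi.
have e : (fun p => f p * quad A c (val p)) = (fun p =>
    (\sum_i \sum_j A i j * (f p * (val p 0 i * val p 0 j))) + c * f p).
  apply/funext => p; rewrite /quad mulrDr [f p * c]mulrC mulr_sumr; congr (_ + _).
  by apply: eq_bigr => i _; rewrite mulr_sumr; apply: eq_bigr => j _; ring.
split; first by rewrite e; exact: (integrableD measurableT s2 cf).
rewrite (_ : \int[mu]_p _ = \int[mu]_p ((\sum_i \sum_j A i j * (f p * (val p 0 i * val p 0 j))) + c * f p)); last by rewrite e.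
rewrite (RintegralD measurableT s2 cf) s3 RintegralZl//; congr (_ + _).
apply: eq_bigr => i _; rewrite (s1 i).2; apply: eq_bigr => j _.
by rewrite RintegralZl ?mxE//; exact: integrable_moment.
Qed.

(** Expanding (p . q)^2 as the sum of p_i p_j q_i q_j separates the variables, so that only second
    moments of f survive the integration in q. *)
Lemma potential_quad f p : f \in Lfun mu 1 ->
  potential f p = quad (moments f) (- 3^-1 * \int[mu]_p f p) (val p).
Proof.
move=> f1; rewrite /potential.
pose A : 'M[R]_3 := \matrix_(i, j) (val p 0 i * val p 0 j).
have e q : (dot (val p) (val q) ^+ 2 - 3^-1) * f q = f q * quad A (- 3^-1) (val q).
  rewrite /quad mulrC; congr (_ * (_ - _)).
  by rewrite /dot !(big_ord3 _ 0) !mxE; ring.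
rewrite (_ : \int[mu]_q _ = \int[mu]_q (f q * quad A (- 3^-1) (val q))); last first.
  by apply: eq_Rintegral => q _; rewrite e.
rewrite (integral_quad A (- 3^-1) f1).2 /minner /quad; congr (_ + _).
by apply: eq_bigr => i _; apply: eq_bigr => j _; rewrite mxE mulrC.
Qed.

Lemma moments_sym f i j : moments f i j = moments f j i.
Proof. by rewrite !mxE; apply: eq_Rintegral => p _; rewrite [val p 0 i * _]mulrC. Qed.

Lemma quad_id c p : quad 1%:M c (val p) = 1 + c.
Proof.
rewrite /quad; congr (_ + _); rewrite -[RHS](sphere_dot p) /dot; apply: eq_bigr => i _.
rewrite (bigD1 i)//= mxE eqxx mul1r big1 ?addr0// => j ji.
by rewrite mxE eq_sym (negbTE ji) mul0r.
Qed.

Lemma moments_trace f : f \in Lfun mu 1 -> \sum_i moments f i i = \int[mu]_p f p.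
Proof.
move=> f1; have := (integral_quad 1%:M 0 f1).2; rewrite mul0r addr0 => e.
have -> : \int[mu]_p f p = \int[mu]_p (f p * quad 1%:M 0 (val p)).
  by apply: eq_Rintegral => p _; rewrite quad_id addr0 mulr1.
rewrite e /minner; apply: eq_bigr => i _.
rewrite (bigD1 i)//= [1%:M i i]mxE eqxx mul1r big1 ?addr0//.
by move=> j ji; rewrite [1%:M i j]mxE eq_sym (negbTE ji) mul0r.
Qed.

(** The constant is 1 because products of coordinates are at most 1 in modulus and the norm on
    matrices is the maximum norm. *)
Lemma moments_close f g : f \in Lfun mu 1 -> g \in Lfun mu 1 ->
  (`|moments g - moments f|%:E <= 'N[mu]_1[EFin \o (g \- f)%R])%E.
Proof.
move=> f1 g1.
have gf1 : (g \- f) \in Lfun mu 1.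
  have := Lfun1_comb (-1) g1 f1.
  by rewrite (_ : (fun p => _) = g \- f)//; apply/funext => p; rewrite mulN1r.
have N1 : ('N[mu]_1[EFin \o (g \- f)%R] \is a fin_num)%E.
  by rewrite ge0_fin_numE ?Lnorm_ge0//; exact: Lfun_fin.
rewrite -(fineK N1) lee_fin /Num.Def.normr/= mx_normrE; apply: bigmax_le.
  by rewrite fine_ge0// Lnorm_ge0.
move=> [i j] _ /=; rewrite !mxE.
have iD := integrableB measurableT (integrable_moment i j g1) (integrable_moment i j f1).
rewrite -(RintegralB measurableT (integrable_moment i j g1) (integrable_moment i j f1)).
apply: le_trans (le_normr_Rintegral measurableT iD) _.
rewrite Lnorm1 -[leRHS]/(\int[mu]_p `|g p - f p|).
apply: (le_Rintegral measurableT (integrable_norm iD)).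
  by apply: integrable_norm; exact/Lfun1_integrable.
move=> p _ /=; rewrite -mulrBl normrM -[leRHS]mulr1 ler_wpM2l//; exact: coordM_le1.
Qed.

End moments.

Section ae_integrals.
Context d (T : measurableType d) (R : realType) (mu : {measure set T -> \bar R}).
Local Open Scope ereal_scope.
Implicit Types f g : T -> \bar R.

Lemma ae_le_integral f g : measurable_fun setT f -> measurable_fun setT g ->
  (\forall x \ae mu, f x <= g x) -> \int[mu]_x f x <= \int[mu]_x g x.
Proof.
move=> mf mg fg; rewrite [leLHS]integralE [leRHS]integralE; apply: leeB.
  apply: ae_ge0_le_integral => //; [exact: measurable_funepos|exact: measurable_funepos|].
  by apply: filterS fg => x fgx _; rewrite !funeposE ge_max !le_max fgx lexx orbT.
apply: ae_ge0_le_integral => //; [exact: measurable_funeneg|exact: measurable_funeneg|].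
by apply: filterS fg => x fgx _; rewrite !funenegE ge_max !le_max leeN2 fgx lexx orbT.
Qed.

(** The lower bound makes the negative part integrable; the integral being below +oo, the positive
    part then has finite integral too. Finite energy thus becomes integrability. *)
Lemma integrable_of_lower_bound f g : measurable_fun setT f -> measurable_fun setT g ->
  mu.-integrable setT f -> (\forall x \ae mu, f x <= g x) -> \int[mu]_x g x < +oo ->
  mu.-integrable setT g.
Proof.
move=> mf mg fi fg goo.
have neg : \int[mu]_x g^\- x < +oo.
  apply: (@le_lt_trans _ _ (\int[mu]_x f^\- x)); last exact: integral_funeneg_lt_pinfty.
  apply: ae_ge0_le_integral => //; [exact: measurable_funeneg|exact: measurable_funeneg|].
  by apply: filterS fg => x fgx _; rewrite !funenegE ge_max !le_max leeN2 fgx lexx orbT.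
have neg0 : 0 <= \int[mu]_x g^\- x by apply: integral_ge0.
have pos : \int[mu]_x g^\+ x < +oo.
  rewrite integralE in goo; have nfin : \int[mu]_x g^\- x \is a fin_num by rewrite ge0_fin_numE.
  by rewrite ltNge leye_eq; apply/negP => /eqP e; move: goo; rewrite e -(fineK nfin).
apply/integrableP; split => //.
under eq_integral do rewrite -/((abse \o g) _) fune_abse.
rewrite ge0_integralD//; [|exact: measurable_funepos|exact: measurable_funeneg].
by rewrite lte_add_pinfty.
Qed.

Lemma ae_eq_of_le_integral f g : mu.-integrable setT f -> mu.-integrable setT g ->
  (\forall x \ae mu, f x <= g x) -> \int[mu]_x g x = \int[mu]_x f x ->
  \forall x \ae mu, f x = g x.
Proof.
move=> fi gi fg e.
have mf := measurable_int mu fi; have mg := measurable_int mu gi.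
have ffin := integrable_ae measurableT fi; have gfin := integrable_ae measurableT gi.
have igf := integrableB measurableT gi fi.
have mgf := measurable_int mu igf.
have : \int[mu]_x `|(g \- f) x| = 0.
  have -> : \int[mu]_x `|(g \- f) x| = \int[mu]_x (g \- f) x.
    apply: ae_eq_integral => //; first exact: measurableT_comp.
    apply: filterS3 fg ffin gfin => x fgx fx gx _; have {}fx := fx I; have {}gx := gx I.
    by rewrite gee0_abs// sube_ge0 ?gx ?fx.
  by rewrite (integralB measurableT gi fi) e subee//; exact: integrable_fin_num.
move/(ae_eq_integral_abs mu measurableT mgf).
apply: filterS3 ffin gfin => x /(_ I) fx /(_ I) gx /(_ I) /=.
by move/eqP; rewrite sube_eq// ?add0e ?fin_num_adde_defr// => /eqP ->.
Qed.

End ae_integrals.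

(** * Pointwise entropy inequalities *)

Section entropy.
Context {R : realType}.
Implicit Types x y u v : R.

(** The inequality 1 + ln t <= t at t = y / x. For x = 0 it reads - y <= 0. *)
Lemma xlnx_ge x y : 0 <= x -> 0 < y -> x - y <= x * ln x - x * ln y.
Proof.
rewrite le_eqVlt => /predU1P[<-|x0] y0; first by rewrite !mul0r subrr sub0r oppr_le0 ltW.
have := expR_ge1Dx (ln (y / x)); rewrite lnK ?posrE ?divr_gt0// ln_div ?posrE//.
by rewrite ler_pdivlMr// => ?; nra.
Qed.

Lemma xlnx_eq x y : 0 <= x -> 0 < y -> x * ln x - x * ln y = x - y -> x = y.
Proof.
rewrite le_eqVlt => /predU1P[<-|x0] y0.
  by rewrite !mul0r subrr sub0r => /eqP; rewrite eq_sym oppr_eq0 => /eqP.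
move=> e; apply/eqP/negPn/negP => xy.
have t0 : ln (y / x) != 0.
  rewrite ln_eq0 ?divr_gt0//; apply: contra xy => /eqP h.
  by rewrite -[x]mul1r -h divfK// gt_eqF.
have := expR_gt1Dx t0; rewrite lnK ?posrE ?divr_gt0// ln_div ?posrE//.
by rewrite ltr_pdivlMr// => ?; nra.
Qed.

(** Where u > 0 this is [xlnx_ge] at y = u exp v; elsewhere either x = 0 or the right side is +oo.
    The bound is affine in x, so for v a quadratic form its integral against a density depends only
    on mass and moments. *)
Lemma entropy_ge x u v : 0 <= x ->
  ((x * v + x - maxr u 0 * expR v)%:E <= (x * ln x)%:E + x%:E * neg_ln u)%E.
Proof.
move=> x0; rewrite /neg_ln; case: ltP => u0; last first.
  rewrite mul0r subr0; move: x0; rewrite le_eqVlt => /predU1P[<-|x0].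
    by rewrite !mul0r addr0 mul0e adde0.
  by rewrite gt0_muley ?lte_fin// addey ?leey.
rewrite -EFinM -EFinD lee_fin.
have := xlnx_ge x0 (mulr_gt0 u0 (expR_gt0 v)); rewrite lnM ?posrE ?expR_gt0// expRK; lra.
Qed.

Lemma entropy_eq x u v : 0 <= x ->
  ((x * v + x - maxr u 0 * expR v)%:E = (x * ln x)%:E + x%:E * neg_ln u)%E ->
  x = maxr u 0 * expR v.
Proof.
move=> x0; rewrite /neg_ln; case: ltP => u0; last first.
  rewrite mul0r subr0; move: x0; rewrite le_eqVlt => /predU1P[<-//|x0].
  by rewrite gt0_muley ?lte_fin// addey.
rewrite -EFinM -EFinD => -[e].
apply: xlnx_eq => //; first by rewrite mulr_gt0// expR_gt0.
by rewrite lnM ?posrE ?expR_gt0// expRK; lra.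
Qed.

Lemma entropy_profile u v : let x := maxr u 0 * expR v in
  ((x * ln x)%:E + x%:E * neg_ln u = (x * v)%:E)%E.
Proof.
rewrite /= /neg_ln; case: ltP => u0; last by rewrite !mul0r mul0e adde0.
by rewrite -EFinM -EFinD lnM ?posrE ?expR_gt0// expRK; congr (_%:E); ring.
Qed.

(** The supporting line at the intermediate point z, given by [xlnx_ge], is applied at x and at y,
    and its linear terms cancel. *)
Lemma xlnx_convex x y t : 0 <= x -> 0 <= y -> 0 < t < 1 ->
  ((1 - t) * x + t * y) * ln ((1 - t) * x + t * y) <= (1 - t) * (x * ln x) + t * (y * ln y).
Proof.
move=> x0 y0 /andP[t0 t1].
set z := (1 - t) * x + t * y.
have z0 : 0 <= z by apply: addr_ge0; apply: mulr_ge0 => //; rewrite ?subr_ge0 ltW.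
have [zp|z0'] := ltP 0 z; last first.
  have zz : z = 0 by apply/eqP; rewrite eq_le z0 z0'.
  have x00 : x = 0 by rewrite /z in zz; nra.
  have y00 : y = 0 by rewrite /z in zz; nra.
  by rewrite zz x00 y00 !mul0r !mulr0 addr0.
have h1 := xlnx_ge x0 zp; have h2 := xlnx_ge y0 zp.
have : (1 - t) * (x - z) + t * (y - z) <= (1 - t) * (x * ln x - x * ln z) + t * (y * ln y - y * ln z).
  by apply: lerD; apply: ler_wpM2l => //; rewrite ?subr_ge0 ltW.
rewrite (_ : (1 - t) * (x - z) + t * (y - z) = 0); last by rewrite /z; ring.
rewrite (_ : _ + _ = (1 - t) * (x * ln x) + t * (y * ln y) - z * ln z); last by rewrite /z; ring.
by rewrite subr_ge0.
Qed.

End entropy.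

Section entropy_of_densities.
Context {R : realType}.
Notation S2 := (sphere R).
Notation mu := (@surface_measure R).
Implicit Types (p q : S2) (f g h k : S2 -> R) (A B M : 'M[R]_3) (c d t u x y eta : R).

(** The integrand of the energy with the potential decoupled from g: for a fixed form A, c it is
    convex in g. *)
Definition entropy_density g A c p : \bar R :=
  ((g p * ln (g p))%:E + (g p)%:E * neg_ln (quad A c (val p)))%E.

(** The constant term of the shifted potential of a density: -1/3 from the kernel times the unit
    mass, minus eta. *)
Definition shift eta : R := - 3^-1 - eta.

Lemma energyE eta g : prob_density g ->
  energy eta g = (\int[mu]_p entropy_density g (moments g) (shift eta) p)%E.
Proof.
case=> g1 _ gm; apply: eq_integral => p _; rewrite /entropy_density (potential_quad p g1) gm.
by rewrite mulr1 /quad addrA.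
Qed.

Lemma measurable_neg_ln : measurable_fun setT (@neg_ln R).
Proof.
apply: measurable_fun_ifT; last exact: measurable_cst.
- exact: measurable_fun_ltr.
- by apply/measurable_EFinP; apply: measurableT_comp; [exact: oppr_measurable|exact: measurable_ln].
Qed.

Lemma measurable_entropy_density g A c : measurable_fun setT g ->
  measurable_fun setT (entropy_density g A c).
Proof.
move=> mg; apply: emeasurable_funD.
  apply/measurable_EFinP; apply: measurable_funM; first exact: mg.
  by apply: (measurableT_comp (@measurable_ln R)); exact: mg.
apply: emeasurable_funM; first by apply/measurable_EFinP; exact: mg.
by apply: (measurableT_comp measurable_neg_ln); exact: measurable_quad.
Qed.

Lemma profile_Lfun1 A c B d : profile A c B d \in Lfun mu 1.
Proof.
apply/(Lfun1_integrable mu).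
apply: (integrable_bounded (measurable_profile A c B d)
  (C := (quad_bound A c + quad_bound B d) * expR (quad_bound A c + quad_bound B d))).
by apply: profile_le; rewrite ?lerDl ?lerDr quad_bound_ge0.
Qed.

Lemma integrable_entropy_bound g A c B d : g \in Lfun mu 1 ->
  mu.-integrable setT (EFin \o (fun p => g p * quad B d (val p) + g p - profile A c B d p)) /\
  \int[mu]_p (g p * quad B d (val p) + g p - profile A c B d p) =
  minner B (moments g) + d * \int[mu]_p g p + \int[mu]_p g p - \int[mu]_p profile A c B d p.
Proof.
move=> g1; have [iq eq] := integral_quad B d g1.
have gi := (Lfun1_integrable mu g).1 g1.
have hi := (Lfun1_integrable mu _).1 (profile_Lfun1 A c B d).
have igq := integrableD measurableT iq gi.
split; first exact: (integrableB measurableT igq hi).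
by rewrite (RintegralB measurableT igq hi) (RintegralD measurableT iq gi) eq.
Qed.

Lemma entropy_density_ge g A c B d : (\forall p \ae mu, 0 <= g p) -> \forall p \ae mu,
  ((g p * quad B d (val p) + g p - profile A c B d p)%:E <= entropy_density g A c p)%E.
Proof. by apply: filterS => p g0; exact: entropy_ge. Qed.

Lemma entropy_density_profile A c B d p :
  entropy_density (profile A c B d) A c p = (profile A c B d p * quad B d (val p))%:E.
Proof. exact: entropy_profile. Qed.

(** Weak duality: each form B, d gives a lower bound that sees g only through its moments. A profile
    with these moments and unit mass attains it, by [energy_profile]. *)
Lemma energy_ge eta g B d : prob_density g ->
  ((minner B (moments g) + d + 1 - \int[mu]_p profile (moments g) (shift eta) B d p)%:E
   <= energy eta g)%E.
Proof.
move=> gd; rewrite (energyE eta gd); case: gd => g1 g0 gm.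
have [ib eb] := integrable_entropy_bound (moments g) (shift eta) B d g1.
rewrite gm mulr1 in eb; rewrite -eb /Rintegral fineK; last exact: integrable_fin_num ib.
apply: ae_le_integral; first exact: measurable_int ib.
  exact: measurable_entropy_density (Lfun1_measurable g1).
exact: entropy_density_ge.
Qed.

Lemma energy_profile eta M B d : prob_density (profile M (shift eta) B d) ->
  moments (profile M (shift eta) B d) = M ->
  energy eta (profile M (shift eta) B d) = (minner B M + d)%:E.
Proof.
move=> hd hM; rewrite (energyE eta hd) hM; case: hd => h1 _ hm.
have [iq eq] := integral_quad B d h1; rewrite hM hm mulr1 in eq.
rewrite -eq /Rintegral fineK; last exact: integrable_fin_num iq.
by apply: eq_integral => p _; rewrite entropy_density_profile.
Qed.

Lemma integrable_entropy_density eta g : prob_density g -> (energy eta g < +oo)%E ->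
  mu.-integrable setT (entropy_density g (moments g) (shift eta)).
Proof.
move=> gd; rewrite (energyE eta gd); case: gd => g1 g0 _.
(* With exponent 0 the lower bound is g minus the positive part of the form, which is integrable. *)
have [ib _] := integrable_entropy_bound (moments g) (shift eta) 0 0 g1.
move=> goo; apply: (integrable_of_lower_bound _ _ ib _ goo); first exact: measurable_int ib.
  exact: measurable_entropy_density (Lfun1_measurable g1).
exact: entropy_density_ge.
Qed.

Lemma energy_minimal eta g B d : prob_density g ->
  let h := profile (moments g) (shift eta) B d in
  prob_density h -> moments h = moments g -> (energy eta h <= energy eta g)%E.
Proof.
move=> gd h hd hM; rewrite /h energy_profile// -/h.
by have := energy_ge eta B d gd; have [_ _ ->] := hd; rewrite addrK.
Qed.

(** Equality of the integrals forces equality almost everywhere in [entropy_ge], and the equality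
    case of the pointwise inequality is the profile. *)
Lemma energy_minimal_eq eta g B d : prob_density g ->
  let h := profile (moments g) (shift eta) B d in
  prob_density h -> moments h = moments g -> (energy eta g <= energy eta h)%E ->
  g = h %[ae mu].
Proof.
move=> gd h hd hM gh; have hg := energy_minimal gd hd hM.
have e : energy eta g = energy eta h by apply: le_anti; apply/andP; split; [exact: gh|exact: hg].
have eh := energy_profile hd hM; have goo : (energy eta g < +oo)%E by rewrite e eh ltry.
have ig := integrable_entropy_density gd goo.
rewrite (energyE eta gd) eh in e.
have [g1 g0 gm] := gd; have [_ _ hm] := hd.
have [ib eb] := integrable_entropy_bound (moments g) (shift eta) B d g1.
rewrite gm -/h hm mulr1 addrK in eb.
have : \forall p \ae mu, ((g p * quad B d (val p) + g p - h p)%:E =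
    entropy_density g (moments g) (shift eta) p)%E.
  apply: (ae_eq_of_le_integral ib ig); first exact: entropy_density_ge.
  by rewrite e -eb /Rintegral fineK//; exact: integrable_fin_num ib.
by apply: filterS2 g0 => p gp0 ep _; exact: entropy_eq gp0 ep.
Qed.

Lemma Rintegral_comb f k (b : S2 -> R) (C t : R) : f \in Lfun mu 1 -> k \in Lfun mu 1 ->
  measurable_fun setT b -> (forall p, `|b p| <= C) ->
  \int[mu]_p ((f p + t * k p) * b p) = \int[mu]_p (f p * b p) + t * \int[mu]_p (k p * b p).
Proof.
move=> f1 k1 mb bC.
have fi := integrable_mul_bounded f1 mb bC; have ki := integrable_mul_bounded k1 mb bC.
rewrite -(RintegralZl t measurableT ki) -RintegralD//; last exact: (integrableZl measurableT t ki).
by apply: eq_Rintegral => p _; rewrite mulrDl mulrA.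
Qed.

(** With the same u at both ends the logarithmic term is linear; the cases with u <= 0 track the
    value +oo, and rule out -oo so that the sums make sense. *)
Lemma entropy_convex x y t u : 0 <= x -> 0 <= y -> 0 < t < 1 ->
  let z := x + t * (y - x) in
  ((z * ln z)%:E + z%:E * neg_ln u <=
   (1 - t)%:E * ((x * ln x)%:E + x%:E * neg_ln u) + t%:E * ((y * ln y)%:E + y%:E * neg_ln u))%E.
Proof.
move=> x0 y0 t01 /=; set z := x + _; have /andP[t0 t1] := t01.
have zE : z = (1 - t) * x + t * y by rewrite /z; ring.
rewrite /neg_ln; case: ltP => u0.
  rewrite -!EFinM -!EFinD lee_fin; have := xlnx_convex x0 y0 t01; rewrite -zE.
  have : z * ln u = (1 - t) * (x * ln u) + t * (y * ln u) by rewrite zE; ring.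
  lra.
have pos w : 0 < w -> ((w * ln w)%:E + w%:E * +oo = +oo :> \bar R)%E.
  by move=> w0; rewrite gt0_muley ?lte_fin// addey.
have t'0 : 0 < 1 - t by rewrite subr_gt0.
have nn w : 0 <= w -> ((w * ln w)%:E + w%:E * +oo != -oo :> \bar R)%E.
  rewrite le_eqVlt => /predU1P[<-|/pos ->//].
  by rewrite mul0r mul0e adde0.
have tnn s w : 0 < s -> 0 <= w -> (s%:E * ((w * ln w)%:E + w%:E * +oo) != -oo :> \bar R)%E.
  move=> s0; rewrite le_eqVlt => /predU1P[<-|/pos ->].
    by rewrite mul0r mul0e adde0 mule0.
  by rewrite gt0_muley ?lte_fin.
move: (x0); rewrite le_eqVlt => /predU1P[x00|xp]; last first.
  by rewrite (pos x)// (@gt0_muley _ (1 - t)%:E) ?lte_fin// addye ?leey// tnn.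
move: (y0); rewrite le_eqVlt => /predU1P[y00|yp]; last first.
  by rewrite (pos y)// (@gt0_muley _ t%:E) ?lte_fin// addey ?leey// tnn.
by rewrite zE -x00 -y00 !mulr0 addr0 !mul0r !mul0e !adde0 !mule0 adde0.
Qed.

Section segment.
Variables (f h : S2 -> R) (eta t : R).
Hypotheses (fd : prob_density f) (hd : prob_density h) (fhM : moments h = moments f).
Hypothesis t01 : 0 < t < 1.

Let g p := f p + t * (h p - f p).

Let hf1 : (fun p => h p - f p) \in Lfun mu 1.
Proof.
case: fd => f1 _ _; case: hd => h1 _ _.
by have := Lfun1_comb (-1) h1 f1; under eq_fun do rewrite mulN1r.
Qed.

Let integral_hf (b : S2 -> R) (C : R) : measurable_fun setT b -> (forall p, `|b p| <= C) ->
  \int[mu]_p ((h p - f p) * b p) = \int[mu]_p (h p * b p) - \int[mu]_p (f p * b p).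
Proof.
move=> mb bC; case: fd => f1 _ _; case: hd => h1 _ _.
rewrite -mulN1r -(Rintegral_comb _ h1 f1 mb bC).
by apply: eq_Rintegral => p _; rewrite mulN1r.
Qed.

Lemma segment_moments : moments g = moments f.
Proof.
case: fd => f1 _ _; apply/matrixP => i j; rewrite !mxE.
have mb := @measurable_coordM R i j; have bC p := @coordM_le1 _ p i j.
rewrite (Rintegral_comb _ f1 hf1 mb bC) (integral_hf mb bC).
by have /matrixP/(_ i j) := fhM; rewrite !mxE => ->; rewrite subrr mulr0 addr0.
Qed.

Lemma segment_density : prob_density g.
Proof.
case: fd => f1 f0 fm; case: hd => h1 h0 hm; have /andP[t0 t1] := t01.
split; first exact: Lfun1_comb.
  apply: filterS2 f0 h0 => p fp hp.
  rewrite /g (_ : _ + _ = (1 - t) * f p + t * h p); last by ring.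
  by apply: addr_ge0; apply: mulr_ge0 => //; rewrite ?subr_ge0 ltW.
have m1 : measurable_fun setT (fun _ : S2 => 1 : R) by exact: measurable_cst.
have b1 (p : S2) : `|1 : R| <= 1 by rewrite normr1.
have e k : \int[mu]_p k p = \int[mu]_p (k p * 1) by apply: eq_Rintegral => p _; rewrite mulr1.
rewrite e (Rintegral_comb _ f1 hf1 m1 b1) (integral_hf m1 b1) -!e fm hm.
by rewrite subrr mulr0 addr0.
Qed.

Lemma segment_energy : (energy eta f < +oo)%E -> (energy eta h < +oo)%E ->
  (energy eta g <= (1 - t)%:E * energy eta f + t%:E * energy eta h)%E.
Proof.
move=> foo hoo.
have fi := integrable_entropy_density fd foo; have hi := integrable_entropy_density hd hoo.
rewrite (energyE eta fd) (energyE eta hd) (energyE eta segment_density).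
rewrite -(integralZl measurableT fi) -(integralZl measurableT hi).
have fti := integrableZl measurableT (1 - t) fi; have hti := integrableZl measurableT t hi.
rewrite -(integralD measurableT fti hti); apply: ae_le_integral.
- by apply: measurable_entropy_density; case: segment_density => /Lfun1_measurable.
- exact: measurable_int (integrableD measurableT fti hti).
- case: fd => _ f0 _; case: hd => _ h0 _; apply: filterS2 f0 h0 => p fp hp.
  by rewrite segment_moments fhM; exact: entropy_convex.
Qed.

End segment.

End entropy_of_densities.

(** * The partition function and its critical points *)

Section coefficients.
Context {R : realType}.
Notation S2 := (sphere R).
Implicit Types (p : S2) (b v : 'rV[R]_5) (A B M : 'M[R]_3) (c d s : R).

(* Modulo constants on the sphere, every quadratic form there is given by exactly
   one such matrix. *)
Definition coef_mx b : 'M[R]_3 := \matrix_(i, j)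
  match nat_of_ord i, nat_of_ord j with
  | 0%N, 0%N => b 0 0 | 1%N, 1%N => b 0 1 | 0%N, 1%N => b 0 2%:R
  | 0%N, 2%N => b 0 3%:R | 1%N, 2%N => b 0 4%:R | _, _ => 0
  end.

Lemma coef_mxD b s v : coef_mx (b + s *: v) = coef_mx b + s *: coef_mx v.
Proof.
apply/matrixP => i j; rewrite !mxE.
by elim/ord3P: i; elim/ord3P: j => /=; rewrite ?mulr0 ?addr0.
Qed.

Lemma coef_mxB b v : coef_mx (b - v) = coef_mx b - coef_mx v.
Proof. by rewrite -scaleN1r coef_mxD scaleN1r. Qed.

Lemma coef_mx_le b i j : `|coef_mx b i j| <= `|b|.
Proof.
rewrite mxE; have h k : `|b 0 k| <= `|b| by exact: ler_mx_norm_coord.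
by elim/ord3P: i; elim/ord3P: j => /=; rewrite ?normr0.
Qed.

Lemma minnerDl A B M s : minner (A + s *: B) M = minner A M + s * minner B M.
Proof.
rewrite /minner mulr_sumr -big_split; apply: eq_bigr => i _.
by rewrite mulr_sumr -big_split; apply: eq_bigr => j _; rewrite !mxE /=; ring.
Qed.

Lemma minnerBl A B M : minner (A - B) M = minner A M - minner B M.
Proof. by rewrite -scaleN1r minnerDl mulN1r. Qed.

Lemma minnerBr B M M' : minner B (M - M') = minner B M - minner B M'.
Proof. by rewrite /minner !(big_ord3 _ 0) !mxE; ring. Qed.

Lemma minner_le B M (x y : R) : 0 <= x -> (forall i j, `|B i j| <= x) ->
  (forall i j, `|M i j| <= y) -> `|minner B M| <= 9 * x * y.
Proof.
move=> x0 hB hM.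
have -> : 9 * x * y = \sum_(i < 3) \sum_(j < 3) (x * y).
  by rewrite !(big_ord3 _ 0); ring.
apply: le_trans (ler_norm_sum _ _ _) _; apply: ler_sum => i _.
apply: le_trans (ler_norm_sum _ _ _) _; apply: ler_sum => j _.
by rewrite normrM ler_pM.
Qed.

Lemma minner_coef b M : minner (coef_mx b) M =
  b 0 0 * M 0 0 + b 0 1 * M 1 1 + b 0 2%:R * M 0 1 + b 0 3%:R * M 0 2%:R + b 0 4%:R * M 1 2%:R.
Proof.
have [e1 e2] : (0 + 1 = 1 :> 'I_3) /\ (0 + 2%:R = 2%:R :> 'I_3) by split; apply/val_inj.
by rewrite /minner !(big_ord3 _ 0) e1 e2 !mxE /=; ring.
Qed.

(** Six points of the sphere determine the six coefficients: the basis vectors give the squares and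
    the constant, and points from the triangle 3-4-5 isolate each mixed term with rational
    coordinates. *)
Lemma quad_coef_eq0 v c : (forall p, quad (coef_mx v) c (val p) = 0) -> v = 0.
Proof.
move=> h.
have q (x y z : R) : x ^+ 2 + y ^+ 2 + z ^+ 2 = 1 ->
    v 0 0 * x ^+ 2 + v 0 1 * y ^+ 2 + v 0 2%:R * (x * y) + v 0 3%:R * (x * z) +
    v 0 4%:R * (y * z) + c = 0.
  move=> e; pose u : 'rV[R]_3 := \row_j (if j == 0 then x else if j == 1 then y else z).
  have us : dot u u == 1 by rewrite dotE !mxE /= -!expr2 e.
  have := h (exist (fun p : 'rV[R]_3 => is_true (dot p p == 1)) u us).
  have -> : quad (coef_mx v) c u = minner (coef_mx v) (\matrix_(i, j) (u 0 i * u 0 j)) + c.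
    rewrite /quad; congr (_ + _); apply: eq_bigr => i _; apply: eq_bigr => j _.
    by rewrite [X in _ = _ * X]mxE.
  by rewrite minner_coef !mxE /= !expr2.
have := q 0 0 1; have := q 1 0 0; have := q 0 1 0.
have := q (3 / 5) (4 / 5) 0; have := q (3 / 5) 0 (4 / 5); have := q 0 (3 / 5) (4 / 5).
do 6![move=> /(_ ltac:(field)) ?].
have h0 : v 0 0 = 0 by lra.
have h1 : v 0 1 = 0 by lra.
have h2 : v 0 2%:R = 0 by lra.
have h3 : v 0 3%:R = 0 by lra.
have h4 : v 0 4%:R = 0 by lra.
apply/rowP => k; rewrite mxE.
case: k => -[|[|[|[|[|//]]]]] hk.
- by rewrite -[RHS]h0; congr (v 0 _); apply/val_inj.
- by rewrite -[RHS]h1; congr (v 0 _); apply/val_inj.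
- by rewrite -[RHS]h2; congr (v 0 _); apply/val_inj.
- by rewrite -[RHS]h3; congr (v 0 _); apply/val_inj.
- by rewrite -[RHS]h4; congr (v 0 _); apply/val_inj.
Qed.

(** The pairings read off every entry on or above the diagonal except the last diagonal one, which
    the trace supplies. *)
Lemma minner_coef_inj M M' : (forall i j, M i j = M j i) -> (forall i j, M' i j = M' j i) ->
  \sum_i M i i = \sum_i M' i i ->
  (forall v, minner (coef_mx v) M = minner (coef_mx v) M') -> M = M'.
Proof.
move=> sM sM' tr h.
have e k : minner (coef_mx (delta_mx 0 k)) M = minner (coef_mx (delta_mx 0 k)) M' by [].
have := e 0; have := e 1; have := e 2%:R; have := e 3%:R; have := e 4%:R.
rewrite !minner_coef !mxE /= !mulr1n !mulr0n !mul0r !mul1r !add0r !addr0 => h4 h3 h2 h1 h0.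
have [e1 e2] : (0 + 1 = 1 :> 'I_3) /\ (0 + 2%:R = 2%:R :> 'I_3) by split; apply/val_inj.
move: tr; rewrite !(big_ord3 _ 0) e1 e2 h0 h1 => /addrI h5.
have s10 : M 1 0 = M' 1 0 by rewrite sM sM'.
have s20 : M 2%:R 0 = M' 2%:R 0 by rewrite sM sM'.
have s21 : M 2%:R 1 = M' 2%:R 1 by rewrite sM sM'.
apply/matrixP => i j.
by elim/ord3P: i; elim/ord3P: j.
Qed.

End coefficients.

Section continuity.
Context {R : realType}.
Variables (n : nat) (F : 'rV[R]_n.+1 -> R).
Hypothesis lipF : forall rho, exists L, forall x y, `|x| <= rho -> `|y| <= rho ->
  `|F x - F y| <= L * `|x - y|.

Lemma continuous_of_lipschitz_on_balls : continuous F.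
Proof.
move=> x; have [L hL] := lipF (`|x| + 1).
apply/(@cvgrPdist_lt _ _ _ _ (nbhs_filter x)) => e e0; near=> y.
have yx : `|x - y| < 1 by near: y; apply: cvgr_dist_lt => //; exact: cvg_id.
have L0 : 0 < `|L| + 1 by rewrite ltr_wpDl.
have yx' : `|x - y| < e / (`|L| + 1).
  by near: y; apply: cvgr_dist_lt => //; exact: divr_gt0.
have y1 : `|y| <= `|x| + 1.
  rewrite -[y](subrK x) addrC; apply: le_trans (ler_normD _ _) _.
  by rewrite lerD2l distrC ltW.
apply: le_lt_trans (hL x y _ y1) _; first by rewrite lerDl.
rewrite ltr_pdivlMr// in yx'.
apply: le_lt_trans yx'; rewrite mulrC ler_wpM2l//.
by apply: le_trans (ler_norm L) _; rewrite lerDl.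
Unshelve. all: by end_near. Qed.

End continuity.

Section compactness.
Context {R : realType}.
Variables (n : nat) (F : 'rV[R]_n.+1 -> R).
Hypothesis lipF : forall rho, exists L, forall x y, `|x| <= rho -> `|y| <= rho ->
  `|F x - F y| <= L * `|x - y|.

Let continuous_distance (x : 'rV[R]_n.+1) : continuous (fun y : 'rV[R]_n.+1 => `|y - x|).
Proof.
apply: continuous_of_lipschitz_on_balls => rho; exists 1 => y z _ _; rewrite mul1r.
by apply: le_trans (ler_dist_dist _ _) _; rewrite opprB addrA subrK.
Qed.

Lemma compact_ball_rV (x : 'rV[R]_n.+1) (rho : R) : compact [set y | `|y - x| <= rho].
Proof.
apply: bounded_closed_compact.
  exists (rho + `|x|); split; first exact: num_real.
  move=> M hM y /= yx; apply: ltW; apply: le_lt_trans hM.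
  by rewrite -[y](subrK x); apply: le_trans (ler_normD _ _) _; rewrite lerD2r.
apply: (@preimage_closed _ _ (fun y : 'rV[R]_n.+1 => `|y - x|) [set r | r <= rho]); last exact: closed_le.
by move=> y _; exact: continuous_distance.
Qed.

Lemma compact_sphere_rV (x : 'rV[R]_n.+1) (rho : R) : compact [set y | `|y - x| = rho].
Proof.
apply: (@subclosed_compact _ _ [set y | `|y - x| <= rho]); last 2 first.
- exact: compact_ball_rV.
- by move=> y /= ->.
apply: (@preimage_closed _ _ (fun y : 'rV[R]_n.+1 => `|y - x|) [set r | r = rho]); last exact: closed_eq.
by move=> y _; exact: continuous_distance.
Qed.

Lemma min_on_sphere (x : 'rV[R]_n.+1) (rho : R) : 0 <= rho ->
  exists2 y, `|y - x| = rho & forall z, `|z - x| = rho -> F y <= F z.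
Proof.
move=> r0; have : [set y : 'rV[R]_n.+1 | `|y - x| = rho] !=set0.
  (* In the maximum norm the constant vector 1 is a unit vector. *)
  exists (x + rho *: const_mx 1) => /=; rewrite addrAC subrr add0r normrZ ger0_norm//.
  suff -> : `|const_mx 1 : 'rV[R]_n.+1| = 1 by rewrite mulr1.
  apply/eqP; rewrite eq_le; apply/andP; split.
    rewrite {1}/Num.Def.normr/= mx_normrE; apply/bigmax_leP; split => // i _.
    by rewrite mxE normr1.
  by have := ler_mx_norm_coord (const_mx 1 : 'rV[R]_n.+1) 0 0; rewrite mxE normr1.
move=> ne; have [y /set_mem yA hy] := EVT_min_rV ne (@compact_sphere_rV x rho)
  (continuous_subspaceT (continuous_of_lipschitz_on_balls lipF)).
by exists y => // z zr; apply: hy; exact/mem_set.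
Qed.

(** A continuous function attains its minimum on the compact ball, and the centre beats the
    boundary, so the minimiser is interior. *)
Lemma min_in_ball (x : 'rV[R]_n.+1) (rho : R) : 0 <= rho ->
  (forall y, `|y - x| = rho -> F x < F y) ->
  exists2 y, `|y - x| < rho & forall z, `|z - x| <= rho -> F y <= F z.
Proof.
move=> r0 hF; have ne : [set y : 'rV[R]_n.+1 | `|y - x| <= rho] !=set0.
  by exists x => /=; rewrite subrr normr0.
have [y /set_mem /= yr hy] := EVT_min_rV ne (@compact_ball_rV x rho)
  (continuous_subspaceT (continuous_of_lipschitz_on_balls lipF)).
exists y; last by move=> z zr; apply: hy; exact/mem_set.
rewrite lt_neqAle yr andbT; apply/eqP => /hF.
by rewrite ltNge hy//; apply/mem_set; rewrite /= subrr normr0.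
Qed.

End compactness.

Section partition_function.
Context {R : realType}.
Notation S2 := (sphere R).
Notation mu := (@surface_measure R).
Implicit Types (p q : S2) (f g h : S2 -> R) (b v w : 'rV[R]_5) (A B M : 'M[R]_3) (c d s rho m : R).

Let area : R := fine (mu setT).

Let area_ge0 : 0 <= area. Proof. exact: fine_ge0. Qed.

Lemma Rintegral_close f g (C : R) :
  mu.-integrable setT (EFin \o f) -> mu.-integrable setT (EFin \o g) ->
  (forall p, `|f p - g p| <= C) ->
  `|\int[mu]_p f p - \int[mu]_p g p| <= C * area.
Proof.
move=> fi gi fgC; rewrite -(RintegralB measurableT fi gi).
have fgi := integrableB measurableT fi gi.
apply: le_trans (le_normr_Rintegral measurableT fgi) _.
have ci : mu.-integrable setT (EFin \o (fun _ : S2 => C)).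
  by apply: (integrable_bounded (C := `|C|)) => //; exact: measurable_cst.
apply: le_trans (le_Rintegral measurableT (integrable_norm fgi) ci _) _ => [p _|]; first exact: fgC.
by have := Rintegral_cst mu measurableT C; rewrite /= => ->.
Qed.

Lemma ae_eq0_of_Rintegral f : mu.-integrable setT (EFin \o f) ->
  (\forall p \ae mu, 0 <= f p) -> \int[mu]_p f p = 0 -> \forall p \ae mu, f p = 0.
Proof.
move=> fi f0 e.
have : \forall p \ae mu, (0 : \bar R)%E = (EFin \o f) p.
  apply: (ae_eq_of_le_integral (integrable0 _ _) fi); first exact: f0.
  by rewrite integral0 -(fineK (integrable_fin_num measurableT fi)) -[fine _]/(\int[mu]_p f p) e.
by apply: filterS => p [].
Qed.

(** The additive constant that gives the form [coef_mx b] mean zero under every density with moments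
    M. Stationarity in b then says exactly that the moments match. *)
Definition centre b M : R := - minner (coef_mx b) M.

Definition tilt M b p : R := quad (coef_mx b) (centre b M) (val p).

Definition tilted M c b := profile M c (coef_mx b) (centre b M).

(** The integral of max(u, 0) exp(phi_b - <phi_b>), with < > the mean prescribed by M. Minus its
    logarithm is the best bound that [energy_ge] gives for the direction b. *)
Definition partition M c b : R := \int[mu]_p tilted M c b p.

Lemma tiltD M b s v p : tilt M (b + s *: v) p = tilt M b p + s * tilt M v p.
Proof.
rewrite /tilt /centre coef_mxD minnerDl !(quadE _ _ _ 0) !mxE; ring.
Qed.

Lemma tiltZ M s v p : tilt M (s *: v) p = s * tilt M v p.
Proof.
have := tiltD M 0 s v p; rewrite add0r => ->.
have := tiltD M 0 (-1) 0 p; rewrite scaler0 addr0 mulN1r => e.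
by rewrite (_ : tilt M 0 p = 0) ?add0r//; lra.
Qed.

Lemma tilt_neq0 M v : v != 0 -> exists p, tilt M v p != 0.
Proof.
move=> v0; apply: contrapT => /forallNP h; move/eqP: v0; apply.
by apply: (quad_coef_eq0 (c := centre v M)) => p; apply/eqP/negPn/negP; exact: h.
Qed.

Lemma ae_tilt_neq0 M v : v != 0 -> \forall p \ae mu, tilt M v p != 0.
Proof.
move=> /(tilt_neq0 M)/surface_measure_quad0 null.
exists [set p | quad (coef_mx v) (centre v M) (val p) = 0]; split => //.
  have := measurable_quad (coef_mx v) (centre v M) measurableT (measurable_set1 0).
  by rewrite setTI.
by move=> p /= /negP/negPn/eqP.
Qed.

Lemma quad_bound_entries A c (x : R) : (forall i j, `|A i j| <= x) ->
  quad_bound A c <= 9 * x + `|c|.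
Proof.
move=> Ax; rewrite lerD2r; have -> : 9 * x = \sum_(i < 3) \sum_(j < 3) x.
  by rewrite !(big_ord3 _ 0); ring.
by apply: ler_sum => i _; apply: ler_sum.
Qed.

Lemma coef_close b b' M M' m rho : `|b| <= rho -> `|M'| <= m ->
  quad_bound (coef_mx b' - coef_mx b) (centre b' M' - centre b M) <=
  9 * (1 + m) * `|b' - b| + 9 * rho * `|M' - M|.
Proof.
move=> br Mm; rewrite -coef_mxB.
have := quad_bound_entries (centre b' M' - centre b M) (coef_mx_le (b' - b)).
move/le_trans; apply.
have -> : centre b' M' - centre b M =
    - (minner (coef_mx (b' - b)) M' + minner (coef_mx b) (M' - M)).
  by rewrite /centre coef_mxB minnerBl minnerBr; ring.
rewrite normrN; have h := ler_normD (minner (coef_mx (b' - b)) M') (minner (coef_mx b) (M' - M)).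
have h1 := minner_le (normr_ge0 (b' - b)) (coef_mx_le (b' - b))
  (fun i j => le_trans (ler_mx_norm_coord M' i j) Mm).
have h2 := minner_le (le_trans (normr_ge0 b) br) (fun i j => le_trans (coef_mx_le b i j) br)
  (ler_mx_norm_coord (M' - M)).
by apply: le_trans (lerD (lexx _) h) _; lra.
Qed.

Lemma coef_mx0 : coef_mx (0 : 'rV[R]_5) = 0.
Proof. by have := coef_mxB (0 : 'rV[R]_5) 0; rewrite !subrr. Qed.

Lemma centre0 M : centre 0 M = 0.
Proof.
rewrite /centre coef_mx0 /minner big1 ?oppr0// => i _; rewrite big1// => j _.
by rewrite mxE mul0r.
Qed.

Lemma coef_bound b M m rho : `|b| <= rho -> `|M| <= m ->
  quad_bound (coef_mx b) (centre b M) <= 9 * (1 + m) * rho.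
Proof.
move=> br Mm.
have n0 : `|0 : 'rV[R]_5| <= (0 : R) by rewrite normr0.
have := coef_close b M n0 Mm.
rewrite coef_mx0 centre0 !subr0 mulr0 mul0r addr0 => /le_trans; apply.
rewrite ler_wpM2l//; apply: mulr_ge0 => //; have := le_trans (normr_ge0 M) Mm; lra.
Qed.

Lemma tilted_close c m rho : exists2 L, 0 <= L & forall M M' b b',
  `|M| <= m -> `|M'| <= m -> `|b| <= rho -> `|b'| <= rho ->
  forall p, `|tilted M' c b' p - tilted M c b p| <= L * (`|b' - b| + `|M' - M|).
Proof.
pose K := 9 * `|m| + `|c| + 9 * (1 + `|m|) * `|rho|.
have K0 : 0 <= K by rewrite /K !addr_ge0// mulr_ge0// mulr_ge0// addr_ge0.
pose a1 := expR K; pose a2 := K * expR K.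
have a10 : 0 <= a1 := expR_ge0 _.
have a20 : 0 <= a2 by exact: mulr_ge0.
exists (9 * a1 + a2 * (9 * (1 + `|m|) + 9 * `|rho|)).
  by rewrite addr_ge0// mulr_ge0// addr_ge0// mulr_ge0// addr_ge0.
move=> M M' b b' Mm Mm' br br' p.
have {}Mm := le_trans Mm (ler_norm m); have {}Mm' := le_trans Mm' (ler_norm m).
have {}br := le_trans br (ler_norm rho); have {}br' := le_trans br' (ler_norm rho).
have qK N : `|N| <= `|m| -> `|quad N c (val p)| <= K.
  move=> Nm; apply: le_trans (quad_le _ _ _) _.
  apply: le_trans (quad_bound_entries c (fun i j => le_trans (ler_mx_norm_coord N i j) Nm)) _.
  by rewrite lerDl mulr_ge0// mulr_ge0// addr_ge0.
have tK N e : `|N| <= `|m| -> `|e| <= `|rho| -> tilt N e p <= K.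
  move=> Nm er; apply: le_trans (ler_norm _) _; apply: le_trans (quad_le _ _ _) _.
  by apply: le_trans (coef_bound er Nm) _; rewrite lerDr addr_ge0// mulr_ge0.
apply: le_trans (max0_expR_lipschitz (qK _ Mm') (qK _ Mm) (tK _ _ Mm' br') (tK _ _ Mm br)) _.
have q1 : `|quad M' c (val p) - quad M c (val p)| <= 9 * `|M' - M|.
  apply: le_trans (quad_close _ _ _ _ _) _; rewrite subrr.
  by have := quad_bound_entries 0 (ler_mx_norm_coord (M' - M)); rewrite normr0 addr0.
have t1 : `|tilt M' b' p - tilt M b p| <= 9 * (1 + `|m|) * `|b' - b| + 9 * `|rho| * `|M' - M|.
  exact: le_trans (quad_close _ _ _ _ _) (coef_close b' M br Mm').
apply: le_trans (lerD (ler_wpM2l a10 q1) (ler_wpM2l a20 t1)) _; rewrite -/a1 -/a2.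
have h1 : 0 <= a1 * `|b' - b| by exact: mulr_ge0.
have h2 : 0 <= a2 * `|rho| * `|b' - b| by rewrite !mulr_ge0.
have h3 : 0 <= a2 * (1 + `|m|) * `|M' - M| by rewrite !mulr_ge0// addr_ge0.
by lra.
Qed.

Lemma integrable_tilted M c b : mu.-integrable setT (EFin \o tilted M c b).
Proof. by apply/(Lfun1_integrable mu); exact: profile_Lfun1. Qed.

Lemma partition_close c m rho : exists2 L, 0 <= L & forall M M' b b',
  `|M| <= m -> `|M'| <= m -> `|b| <= rho -> `|b'| <= rho ->
  `|partition M' c b' - partition M c b| <= L * (`|b' - b| + `|M' - M|).
Proof.
have [L L0 hL] := tilted_close c m rho; exists (L * area); first exact: mulr_ge0.
move=> M M' b b' Mm Mm' br br'; rewrite mulrAC.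
by apply: Rintegral_close; [exact: integrable_tilted|exact: integrable_tilted|exact: hL].
Qed.

Lemma partition_lipschitz M c rho : exists L, forall b b', `|b| <= rho -> `|b'| <= rho ->
  `|partition M c b - partition M c b'| <= L * `|b - b'|.
Proof.
have [L _ hL] := partition_close c `|M| rho; exists L => b b' br br'.
apply: le_trans (hL M M b' b (lexx _) (lexx _) br' br) _.
by rewrite (subrr M) normr0 addr0.
Qed.

Lemma tiltedD M c b s v p :
  tilted M c (b + s *: v) p = tilted M c b p * expR (s * tilt M v p).
Proof. by rewrite -mulrA -expRD -tiltD. Qed.

Lemma integral_tilt M c b v : let h := tilted M c b in
  mu.-integrable setT (EFin \o (fun p => h p * tilt M v p)) /\
  \int[mu]_p (h p * tilt M v p) =
  minner (coef_mx v) (moments h) - minner (coef_mx v) M * partition M c b.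
Proof.
by have := integral_quad (coef_mx v) (centre v M) (profile_Lfun1 M c (coef_mx b) (centre b M)); rewrite mulNr.
Qed.

(** At s = - I t with small t > 0 the right side is I^2 t (E t - 1), which is negative unless I =
    0. *)
Lemma eq0_of_quadratic_ge0 (I E s0 : R) : 0 < s0 -> 0 <= E ->
  (forall s, `|s| <= s0 -> 0 <= s * I + E * s ^+ 2) -> I = 0.
Proof.
move=> s00 E0 h; apply/eqP/negPn/negP => I0.
pose t := minr (s0 / (`|I| + 1)) (1 / (2 * (E + 1))).
have t0 : 0 < t by rewrite lt_min !divr_gt0// ?mulr_gt0// ?ltr_wpDl.
have tE : t * (2 * (E + 1)) <= 1.
  by rewrite -ler_pdivlMr ?mulr_gt0 ?ltr_wpDl// /t ge_min lexx orbT.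
have ts : `|- (I * t)| <= s0.
  rewrite normrN normrM (gtr0_norm t0).
  have : t * (`|I| + 1) <= s0 by rewrite -ler_pdivlMr ?ltr_wpDl// /t ge_min lexx.
  by move=> ?; nra.
have I2 : 0 < I ^+ 2 by rewrite exprn_even_gt0.
have := h _ ts; rewrite (_ : _ + _ = I ^+ 2 * t * (E * t - 1)); last by ring.
by rewrite pmulr_rge0 ?(mulr_gt0 I2 t0)// => h0; lra.
Qed.

Lemma tilt_bounded M v : exists2 C, 0 < C & forall p, `|tilt M v p| <= C.
Proof.
exists (quad_bound (coef_mx v) (centre v M) + 1); first by rewrite ltr_wpDl ?quad_bound_ge0.
by move=> p; apply: le_trans (quad_le _ _ _) _; rewrite lerDl.
Qed.

(** Instead of differentiating under the integral, the quadratic upper bound for the exponential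
    turns minimality into 0 <= s I + E s^2 for all small s, where I is the claimed derivative. *)
Lemma partition_critical M c b (delta : R) : 0 < delta ->
  (forall z, `|z - b| <= delta -> partition M c b <= partition M c z) ->
  forall v, \int[mu]_p (tilted M c b p * tilt M v p) = 0.
Proof.
move=> delta0 hb v; have [C C0 hC] := tilt_bounded M v.
have [iI _] := integral_tilt M c b v; have ih := integrable_tilted M c b.
set I := Rintegral _ _ _; pose J := partition M c b.
have J0 : 0 <= J by apply: Rintegral_ge0 => p _; exact: profile_ge0.
(* The first bound on s keeps b + s v in the ball where b is minimal, the second keeps |s tilt| <=
   1/2 as [expR_bounds] requires. *)
apply: (@eq0_of_quadratic_ge0 _ (2 * C ^+ 2 * J) (minr (delta / (`|v| + 1)) (1 / (2 * C)))).
- by rewrite lt_min !divr_gt0// ?mulr_gt0// ltr_wpDl.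
- by apply: mulr_ge0 => //; apply: mulr_ge0 => //; exact: sqr_ge0.
move=> s; rewrite le_min => /andP[s1 s2].
have {s1} : partition M c b <= partition M c (b + s *: v).
  apply: hb; rewrite addrAC subrr add0r normrZ.
  rewrite ler_pdivlMr ?ltr_wpDl// in s1.
  by apply: le_trans s1; rewrite ler_wpM2l// lerDl.
have isum : mu.-integrable setT (EFin \o (fun p => (1 + 2 * C ^+ 2 * s ^+ 2) * tilted M c b p +
    s * (tilted M c b p * tilt M v p))).
  exact: (integrableD measurableT (integrableZl measurableT _ ih) (integrableZl measurableT s iI)).
have : partition M c (b + s *: v) <= \int[mu]_p ((1 + 2 * C ^+ 2 * s ^+ 2) * tilted M c b p +
    s * (tilted M c b p * tilt M v p)).
  apply: le_Rintegral => //; first exact: integrable_tilted.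
  move=> p _; rewrite tiltedD.
  have st : `|s * tilt M v p| <= 1 / 2.
    rewrite ler_pdivlMr ?mulr_gt0// in s2.
    rewrite normrM; have := hC p; have := normr_ge0 s; nra.
  have /andP[_ e2] := expR_bounds (le_trans (ler_norm _) st).
  have t2 : tilt M v p ^+ 2 <= C ^+ 2.
    by rewrite -(real_normK (num_real _)) lerXn2r ?nnegrE// ltW.
  have t3 : (s * tilt M v p) ^+ 2 <= C ^+ 2 * s ^+ 2.
    by rewrite exprMn mulrC ler_wpM2r ?sqr_ge0.
  have h0 := profile_ge0 M c (coef_mx b) (centre b M) p.
  rewrite [leRHS](_ : _ = tilted M c b p * (1 + 2 * (C ^+ 2 * s ^+ 2) + s * tilt M v p)); last by ring.
  by rewrite ler_wpM2l//; lra.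
rewrite (RintegralD measurableT (integrableZl measurableT _ ih) (integrableZl measurableT s iI)).
rewrite (RintegralZl _ measurableT ih) (RintegralZl _ measurableT iI) -/I -/(partition M c b) -/J.
lra.
Qed.

(** Dividing by the partition function subtracts its logarithm in the exponent, so the normalised
    function is again a profile. Stationarity equates five combinations of the moments, the unit
    mass equates the traces. *)
Lemma partition_stationary M c b f : f \in Lfun mu 1 -> moments f = M -> \int[mu]_p f p = 1 ->
  0 < partition M c b ->
  (forall v, \int[mu]_p (tilted M c b p * tilt M v p) = 0) ->
  let h := profile M c (coef_mx b) (centre b M - ln (partition M c b)) in
  prob_density h /\ moments h = M.
Proof.
move=> f1 fM fm P0 crit h.
have hE p : h p = (partition M c b)^-1 * tilted M c b p.
  rewrite /h /profile (_ : quad _ (_ - _) _ = tilt M b p - ln (partition M c b)); last first.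
    by rewrite /tilt /quad addrA.
  by rewrite expRD expRN lnK ?posrE// mulrA mulrC.
have h1 : h \in Lfun mu 1 by exact: profile_Lfun1.
have ih := integrable_tilted M c b.
have hm : \int[mu]_p h p = 1.
  under eq_Rintegral do rewrite hE.
  by rewrite (RintegralZl _ measurableT ih) mulVf// gt_eqF.
split; first by split => //; apply: aeW => p; exact: profile_ge0.
apply: minner_coef_inj.
- exact: moments_sym.
- by rewrite -fM; exact: moments_sym.
- by rewrite -fM !moments_trace// hm fm.
move=> v; have [_ e] := integral_quad (coef_mx v) (centre v M) h1.
have : \int[mu]_p (h p * tilt M v p) = 0.
  under eq_Rintegral do rewrite hE -mulrA.
  by rewrite (RintegralZl _ measurableT (integral_tilt M c b v).1) crit mulr0.
by rewrite e hm mulr1 => /eqP; rewrite subr_eq0 => /eqP.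
Qed.

End partition_function.

Section stationary_points.
Context {R : realType}.
Notation S2 := (sphere R).
Notation mu := (@surface_measure R).
Implicit Types (p q : S2) (b v w : 'rV[R]_5) (M : 'M[R]_3) (c eta : R).

Definition stationary M c b :=
  forall v, \int[mu]_p (tilted M c b p * tilt M v p) = 0.

Section finite_energy.
Variables (eta : R) (g : S2 -> R).
Hypotheses (gd : prob_density g) (goo : (energy eta g < +oo)%E).
Let M := moments g.
Let c := shift eta.

(** The energy integrand is +oo wherever g > 0 and the shifted potential is not positive. This
    transfers statements on the set where the potential is positive to g. *)
Lemma finite_energy_support : \forall p \ae mu, g p = 0 \/ 0 < quad M c (val p).
Proof.
have /(integrable_ae measurableT) := integrable_entropy_density gd goo.
case: gd => _ g0 _; apply: filterS2 g0 => p g0 /(_ I).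
rewrite /entropy_density /neg_ln; case: ltP => u0; first by right.
move: g0; rewrite le_eqVlt => /predU1P[<-|g0]; first by left.
by rewrite gt0_muley ?lte_fin// addey.
Qed.

Lemma density_not_ae0 : ~ (\forall p \ae mu, g p = 0).
Proof.
case: gd => g1 _ gm g0.
have : (\int[mu]_p (EFin \o g) p = \int[mu]_p (cst 0 p))%E.
  apply: (ae_eq_integral _ _ measurableT).
  - by apply/measurable_EFinP; exact: Lfun1_measurable.
  - exact: measurable_cst.
  - by apply: filterS g0 => p /= ->.
rewrite integral0 => e; move: gm; rewrite /Rintegral [X in fine X]e => /esym/eqP.
by rewrite oner_eq0.
Qed.

Lemma finite_energy_quad_neq0 : exists p, quad M c (val p) != 0.
Proof.
apply: contrapT => /forallNP h; apply: density_not_ae0.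
apply: filterS finite_energy_support => p [//|].
by move/lt0r_neq0 => /(h p).
Qed.

Lemma partition_gt0 b : 0 < partition M c b.
Proof.
rewrite lt_neqAle Rintegral_ge0 ?andbT => [|p _]; last exact: profile_ge0.
apply/eqP => /esym e; apply: density_not_ae0.
have h0 : \forall p \ae mu, 0 <= tilted M c b p by apply: aeW => p; exact: profile_ge0.
have := ae_eq0_of_Rintegral (integrable_tilted M c b) h0 e.
apply: filterS2 finite_energy_support => p [//|u0] /eqP.
by rewrite mulf_eq0 (gt_eqF (expR_gt0 _)) orbF (max_l (ltW u0)) gt_eqF.
Qed.

(** At a stationary point the increment is the integral of h (exp t - 1 - t), where t is the tilt of
    v: the linear term has integral 0. It can vanish only if h does almost everywhere, since t is
    almost nowhere 0. *)
Lemma partition_strict b v : stationary M c b -> v != 0 ->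
  partition M c b < partition M c (b + v).
Proof.
move=> crit v0; pose h := tilted M c b.
have ih := integrable_tilted M c b; have ih' := integrable_tilted M c (b + v).
have it := (integral_tilt M c b v).1.
pose r p := tilted M c (b + v) p - h p - h p * tilt M v p.
have ir : mu.-integrable setT (EFin \o r).
  exact: (integrableB measurableT (integrableB measurableT ih' ih) it).
have rE p : r p = h p * (expR (tilt M v p) - 1 - tilt M v p).
  rewrite /r -[v in tilted _ _ (b + v)]scale1r tiltedD mul1r /h; ring.
have eg p : 0 <= expR (tilt M v p) - 1 - tilt M v p by have := expR_ge1Dx (tilt M v p); lra.
have r0 p : 0 <= r p by rewrite rE mulr_ge0//; exact: profile_ge0.
have er : \int[mu]_p r p = partition M c (b + v) - partition M c b.
  rewrite (RintegralB measurableT (integrableB measurableT ih' ih) it).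
  by rewrite (RintegralB measurableT ih' ih) crit subr0.
rewrite -subr_gt0 -er lt_neqAle Rintegral_ge0 ?andbT//; apply/eqP => /esym e.
have {e} re := ae_eq0_of_Rintegral ir (aeW mu r0) e.
have : \forall p \ae mu, h p = 0.
  apply: filterS2 (ae_tilt_neq0 M v0) re => p t0; rewrite rE => /eqP.
  rewrite mulf_eq0 => /orP[/eqP//|].
  by rewrite gt_eqF// subr_gt0 ltrBrDl; exact: expR_gt1Dx.
move=> h0; apply: density_not_ae0.
apply: filterS2 finite_energy_support h0 => p [//|u0] /eqP.
by rewrite mulf_eq0 (gt_eqF (expR_gt0 _)) orbF (max_l (ltW u0)) gt_eqF.
Qed.

(** A minorant of the tilted density, by exp t >= max(t, 0), that is positively homogeneous of
    degree one in v; coercivity reduces to its positivity on the unit sphere. *)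
Let gain v p := maxr (quad M c (val p)) 0 * maxr (tilt M v p) 0.

Let gain_ge0 v p : 0 <= gain v p.
Proof. by rewrite mulr_ge0 ?max0_ge0. Qed.

Let integrable_gain v : mu.-integrable setT (EFin \o gain v).
Proof.
apply: (integrable_bounded (C := quad_bound M c * quad_bound (coef_mx v) (centre v M))).
  by apply: measurable_funM; exact: measurable_max0_quad.
move=> p; rewrite ger0_norm ?gain_ge0// ler_pM ?max0_ge0//.
  exact: max0_le (quad_le _ _ _).
exact: max0_le (quad_le _ _ _).
Qed.

(** Were the integral 0, the tilt would be nonpositive wherever g lives. Its mean under g being 0 by
    the choice of [centre], g times the tilt would vanish almost everywhere, hence also g. *)
Let gain_gt0 v : v != 0 -> 0 < \int[mu]_p gain v p.
Proof.
move=> v0; rewrite lt_neqAle Rintegral_ge0 ?andbT//; apply/eqP => /esym e.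
have ge := ae_eq0_of_Rintegral (integrable_gain v) (aeW mu (gain_ge0 v)) e.
case: (gd) => g1 g0 gm.
have [iq eq] := integral_quad (coef_mx v) (centre v M) g1.
have {}eq : \int[mu]_p - (g p * tilt M v p) = 0.
  have -> : \int[mu]_p - (g p * tilt M v p) = \int[mu]_p (-1 * (g p * tilt M v p)).
    by apply: eq_Rintegral => p _; rewrite mulN1r.
  by rewrite (RintegralZl _ measurableT iq) eq gm mulr1 subrr mulr0.
have iqN : mu.-integrable setT (EFin \o (fun p => - (g p * tilt M v p))).
  by have := integrableN iq.
have le0 : \forall p \ae mu, 0 <= - (g p * tilt M v p).
  apply: filterS3 finite_energy_support g0 ge => p [->|u0] gp /eqP; first by rewrite mul0r oppr0.
  rewrite /gain (max_l (ltW u0)) mulf_eq0 gt_eqF//= => /eqP t0.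
  by rewrite oppr_ge0 mulr_ge0_le0// -t0 le_max lexx.
apply: density_not_ae0.
apply: filterS2 (ae_tilt_neq0 M v0) (ae_eq0_of_Rintegral iqN le0 eq) => p t0 /eqP.
by rewrite oppr_eq0 mulf_eq0 (negbTE t0) orbF => /eqP.
Qed.

Let gain_lipschitz rho : exists L, forall v w, `|v| <= rho -> `|w| <= rho ->
  `|\int[mu]_p gain v p - \int[mu]_p gain w p| <= L * `|v - w|.
Proof.
exists (quad_bound M c * (9 * (1 + `|M|)) * fine (mu setT)) => v w _ _.
rewrite mulrAC; apply: Rintegral_close; [exact: integrable_gain|exact: integrable_gain|].
move=> p; rewrite /gain -mulrBr normrM -mulrA ler_pM//.
  by rewrite ger0_norm ?max0_ge0//; exact: max0_le (quad_le _ _ _).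
apply: le_trans (max0_lipschitz _ _) _; apply: le_trans (quad_close _ _ _ _ _) _.
have := coef_close v M (lexx `|w|) (lexx `|M|).
by rewrite subrr normr0 mulr0 addr0.
Qed.

(** With k > 0 the minimum of the integrated gain on the unit sphere, the partition function is at
    least rho k on the sphere of radius rho, and this rho makes rho k equal to its value at 0 plus
    k. *)
Lemma partition_coercive : exists2 rho, 0 <= rho &
  forall b, `|b - 0| = rho -> partition M c 0 < partition M c b.
Proof.
have [v v1 hv] := min_on_sphere gain_lipschitz 0 (@ler01 R).
rewrite subr0 in v1.
have k0 : 0 < \int[mu]_p gain v p by rewrite gain_gt0// -normr_gt0 v1.
set k := Rintegral _ _ _ in k0 hv.
have P0 := partition_gt0 0.
pose rho := partition M c 0 / k + 1.
have rho0 : 0 < rho by rewrite ltr_wpDl// divr_ge0// ltW.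
exists rho; first exact: ltW.
move=> b; rewrite subr0 => br; pose w := rho^-1 *: b.
have bE : b = rho *: w by rewrite scalerA divff ?scale1r// gt_eqF.
have w1 : `|w - 0| = 1 by rewrite subr0 normrZ br gtr0_norm ?invr_gt0// mulVf// gt_eqF.
have gb p : gain b p = rho * gain w p.
  rewrite /gain bE tiltZ.
  have -> : maxr (rho * tilt M w p) 0 = rho * maxr (tilt M w p) 0.
    by rewrite maxr_pMr ?mulr0 ?(ltW rho0).
  by rewrite mulrCA.
apply: (@lt_le_trans _ _ (rho * k)).
  by rewrite /rho mulrDl mul1r divfK ?gt_eqF// ltrDl.
apply: (@le_trans _ _ (rho * \int[mu]_p gain w p)); first by rewrite ler_wpM2l ?hv// ltW.
rewrite -(RintegralZl _ measurableT (integrable_gain w)).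
apply: le_Rintegral => //.
- exact: (integrableZl measurableT rho (integrable_gain w)).
- exact: integrable_tilted.
- move=> p _; rewrite -gb ler_wpM2l ?max0_ge0// ge_max expR_ge0 andbT.
  by have := expR_ge1Dx (tilt M b p); rewrite -/(tilt M b p); lra.
Qed.

Lemma exists_stationary : exists b, stationary M c b.
Proof.
have [rho r0 hr] := partition_coercive.
have [b br hb] := min_in_ball (partition_lipschitz M c) r0 hr.
rewrite subr0 in br.
exists b; apply: (@partition_critical _ _ _ _ (rho - `|b|)); first by rewrite subr_gt0.
move=> z zb; apply: hb; rewrite subr0 -[z](subrK b).
by apply: le_trans (ler_normD _ _) _; lra.
Qed.

(** By strictness, the partition function on the sphere of radius delta about b exceeds its value at
    b by at least 2k. A change of moments that moves all values in the ball by less than k keeps the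
    boundary above the centre, so an interior minimiser exists nearby. *)
Lemma stationary_persists b (delta : R) : stationary M c b -> 0 < delta ->
  exists2 delta' : R, 0 < delta' & forall M', `|M' - M| <= delta' ->
    exists2 b', `|b' - b| <= delta & stationary M' c b'.
Proof.
move=> crit d0.
have [z zd hz] := min_on_sphere (partition_lipschitz M c) b (ltW d0).
pose k := (partition M c z - partition M c b) / 2.
have k0 : 0 < k.
  rewrite divr_gt0// subr_gt0 -[z](subrK b) [_ + b]addrC partition_strict//.
  by rewrite -normr_gt0 zd.
have [L L0 hL] := partition_close c (`|M| + 1) (`|b| + delta).
(* The first bound confines M' to the range of the constant L, the second makes L |M' - M| < k. *)
exists (minr 1 (k / (2 * (L + 1)))).
  by rewrite lt_min ltr01 divr_gt0// mulr_gt0// ltr_wpDl.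
move=> M'; rewrite le_min => /andP[M1 M2].
have M'm : `|M'| <= `|M| + 1.
  by rewrite -[M'](subrK M) addrC; apply: le_trans (ler_normD _ _) _; rewrite lerD2l.
have near x : `|x - b| <= delta -> `|partition M' c x - partition M c x| < k.
  move=> xb; have xr : `|x| <= `|b| + delta.
    by rewrite -[x](subrK b) addrC; apply: le_trans (ler_normD _ _) _; rewrite lerD2l.
  have Mm : `|M| <= `|M| + 1 by rewrite lerDl.
  apply: le_lt_trans (hL M M' x x Mm M'm xr xr) _; rewrite subrr normr0 add0r.
  rewrite ler_pdivlMr ?mulr_gt0 ?ltr_wpDl// in M2.
  have := normr_ge0 (M' - M); nra.
have hs y : `|y - b| = delta -> partition M' c b < partition M' c y.
  move=> yd; have yd' : `|y - b| <= delta by rewrite yd.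
  have /ltr_normlP[n1 n2] := near y yd'.
  have b0 : `|b - b| <= delta by rewrite subrr normr0 ltW.
  have /ltr_normlP[n3 n4] := near b b0.
  have kE : partition M c z = partition M c b + k + k by rewrite /k -addrA -splitr addrC subrK.
  have := hz y yd; rewrite kE.
  move: (partition M c b) (partition M' c b) (partition M c y) (partition M' c y) n1 n2 n3 n4.
  by move: {kE M1 M2 near hz zd} k k0 => *; lra.
have [b' b'd hb'] := min_in_ball (partition_lipschitz M' c) (ltW d0) hs.
exists b'; first exact: ltW.
apply: (@partition_critical _ _ _ _ (delta - `|b' - b|)); first by rewrite subr_gt0.
move=> y yb; apply: hb'; rewrite -[y](subrK b') -addrA.
by apply: le_trans (ler_normD _ _) _; lra.
Qed.

End finite_energy.

End stationary_points.

Section local_minimisers.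
Context {R : realType}.
Notation S2 := (sphere R).
Notation mu := (@surface_measure R).
Implicit Types (X : fun_space R) (f g h : S2 -> R) (b : 'rV[R]_5) (M : 'M[R]_3) (c eta eps x y : R).

(** The tangent inequality at both points together with y >= x / 2; keeping the factor x avoids a
    division. *)
Lemma ln_close x y : 0 < x -> `|y - x| <= x / 2 -> x * `|ln y - ln x| <= 2 * `|y - x|.
Proof.
move=> x0 yx; have := ler_norm (y - x); have := ler_norm (x - y); rewrite distrC => nx ny.
have y0 : x / 2 <= y by lra.
have yp : 0 < y by lra.
have := xlnx_ge (ltW x0) yp; have := xlnx_ge (ltW yp) x0.
move: `|y - x| (ln y) (ln x) yx nx ny => n l k yx nx ny h1 h2.
have [lk|lk] := leP 0 (l - k); [rewrite ger0_norm//|rewrite ltr0_norm//]; first by lra.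
by have := ler_wpM2r (ltW (_ : 0 < k - l)) y0; rewrite subr_gt0 -subr_lt0 => /(_ lk); lra.
Qed.

Definition stationary_profile M c b :=
  profile M c (coef_mx b) (centre b M - ln (partition M c b)).

Lemma stationary_profile_near X M c b eps : usual_space X -> 0 < eps ->
  (exists p : S2, quad M c (val p) != 0) -> 0 < partition M c b ->
  exists2 delta : R, 0 < delta & forall M' b',
    `|M' - M| <= delta -> `|b' - b| <= delta -> (exists p : S2, quad M' c (val p) != 0) ->
    (fs_norm X (stationary_profile M' c b' \- stationary_profile M c b)%R < eps%:E)%E.
Proof.
move=> uX e0 Mn P0; set P := partition M c b in P0.
have [d d0 hd] := usual_profile_near (coef_mx b) (centre b M - ln P) uX e0 Mn.
have [L L0 hL] := partition_close c (`|M| + 1) (`|b| + 1).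
(* [T] dominates the Lipschitz constants of the form u, of the exponent and of the partition
   function at once. *)
pose T := 9 * (1 + (`|M| + 1)) + 9 * `|b| + 9 + L.
have Mr0 := normr_ge0 M; have br0 := normr_ge0 b.
have T0 : 0 <= T by rewrite /T; lra.
(* The bounds on [a] serve, in turn, to leave half of [d] for the coefficients, to meet the
   hypothesis of [ln_close], and to keep the change of the logarithm below d / 2. *)
pose a := minr (d / 2) (minr (P / 2) (d * P / 4)).
have a0 : 0 < a by rewrite !lt_min !divr_gt0// mulr_gt0.
exists (minr 1 (a / (2 * (T + 1)))).
  by rewrite lt_min ltr01 divr_gt0// mulr_gt0// ltr_wpDl.
move=> M' b'; rewrite !le_min => /andP[M1 M2] /andP[b1 b2] Mn'.
have Tp : 0 < 2 * (T + 1) by rewrite mulr_gt0// ltr_wpDl.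
rewrite !ler_pdivlMr// in M2 b2.
have M'r : `|M'| <= `|M| + 1.
  by rewrite -[M'](subrK M) addrC; apply: le_trans (ler_normD _ _) _; rewrite lerD2l.
have b'r : `|b'| <= `|b| + 1.
  by rewrite -[b'](subrK b) addrC; apply: le_trans (ler_normD _ _) _; rewrite lerD2l.
have Mr : `|M| <= `|M| + 1 by rewrite lerDl.
have br : `|b| <= `|b| + 1 by rewrite lerDl.
have hP := hL M M' b b' Mr M'r br b'r.
have hB := coef_close b' M (lexx `|b|) M'r.
have hA := quad_bound_entries 0 (ler_mx_norm_coord (M' - M)).
rewrite normr0 addr0 in hA.
have x0 := normr_ge0 (b' - b); have y0 := normr_ge0 (M' - M).
have Ta : T * (`|b' - b| + `|M' - M|) <= a by lra.
have [ad [aP adP]] : a <= d / 2 /\ a <= P / 2 /\ a <= d * P / 4.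
  by rewrite /a !ge_min !lexx !orbT.
have hP' : `|partition M' c b' - P| <= a.
  apply: le_trans hP (le_trans _ Ta); rewrite ler_wpM2r ?addr_ge0// /T; lra.
have hln : `|ln (partition M' c b') - ln P| <= d / 2.
  have h := ln_close P0 (le_trans hP' aP).
  rewrite -(ler_pM2l P0); apply: le_trans h _; lra.
have hB' : quad_bound (coef_mx b' - coef_mx b) (centre b' M' - centre b M) <= a.
  apply: le_trans hB (le_trans _ Ta).
  rewrite [leRHS]mulrDr; apply: lerD; rewrite ler_wpM2r// /T; lra.
apply: hd => //.
  rewrite subrr; apply: le_trans hA _.
  have : 9 * `|M' - M| <= T * `|M' - M| by rewrite ler_wpM2r// /T; lra.
  have : 0 <= T * `|b' - b| by rewrite mulr_ge0.
  by rewrite mulrDr in Ta; lra.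
have -> : centre b' M' - ln (partition M' c b') - (centre b M - ln P) =
    (centre b' M' - centre b M) + - (ln (partition M' c b') - ln P).
  by rewrite !opprD !opprK addrACA.
rewrite -[X in quad_bound X _]addr0; apply: le_trans (quad_boundD _ _ _ _) _.
have -> : quad_bound 0 (- (ln (partition M' c b') - ln P)) = `|ln (partition M' c b') - ln P|.
  rewrite /quad_bound big1 ?add0r ?normrN// => i _; rewrite big1// => j _.
  by rewrite mxE normr0.
by lra.
Qed.

Lemma stationary_profile_density eta g b : prob_density g -> (energy eta g < +oo)%E ->
  stationary (moments g) (shift eta) b ->
  let h := stationary_profile (moments g) (shift eta) b in
  prob_density h /\ moments h = moments g.
Proof.
move=> gd goo crit; have P0 := partition_gt0 gd goo b.
by case: gd => g1 _ gm; exact: (partition_stationary g1).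
Qed.

Lemma segmentE f h (t : R) : (fun p => f p + t * (h p - f p)) \- f = (fun p => t * (h p - f p)).
Proof. by apply/funext => p /=; rewrite addrAC subrr add0r. Qed.

Lemma local_minimiser_stationary eta X f b : usual_space X -> local_minimiser eta X f ->
  stationary (moments f) (shift eta) b ->
  f = stationary_profile (moments f) (shift eta) b %[ae mu].
Proof.
move=> uX [fd fX foo [eps e0 hmin]] crit.
have [hd hM] := stationary_profile_density fd foo crit.
set h := stationary_profile _ _ _ in hd hM *.
apply: (energy_minimal_eq fd hd hM).
have hX : fs_mem X h.
  by apply: usual_profile_mem => //; exact: finite_energy_quad_neq0 fd foo.
have kX : fs_mem X (fun p => h p - f p).
  have := usual_comb (-1) uX hX fX.
  by rewrite (_ : (fun p => _) = (fun p => h p - f p))//; apply/funext => p; rewrite mulN1r.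
have [d d0 hdel] := usual_scale uX kX e0.
(* t <= d puts the point of the segment within [eps] of f in X, and t <= 1/2 keeps it strictly
   before h. From F(f) <= (1 - t) F(f) + t F(h) one then gets F(f) <= F(h). *)
pose t := minr d (1 / 2).
have t0 : 0 < t by rewrite lt_min d0 divr_gt0.
have t1 : t <= 1 / 2 by rewrite ge_min lexx orbT.
have t01 : 0 < t < 1 by rewrite t0; lra.
have gd := segment_density fd hd t01.
have gX : fs_mem X (fun p => f p + t * (h p - f p)) by exact: usual_comb.
have td : `|t| <= d by rewrite (gtr0_norm t0) ge_min lexx.
have := hmin _ gd gX; rewrite segmentE => /(_ (hdel t td)) fg.
have hE := energy_profile hd hM; rewrite -/h in hE.
have hf := energy_minimal fd hd hM; rewrite -/h in hf.
have hoo : (energy eta h < +oo)%E by rewrite hE ltry.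
have := le_trans fg (segment_energy fd hd hM t01 foo hoo).
rewrite hE in hf *; move: hf foo; case: (energy eta f) => [x| |]//.
rewrite -!EFinM -EFinD !lee_fin => _ _ h1.
by rewrite -(ler_pM2l t0); lra.
Qed.

Lemma local_minimiser_L1 eta X f : usual_space X -> local_minimiser eta X f ->
  local_minimiser eta (Lebesgue_space 1%E) f.
Proof.
move=> uX fmin; have [fd fX foo [eps e0 hmin]] := fmin.
have [b crit] := exists_stationary fd foo.
have fh := local_minimiser_stationary uX fmin crit.
set M := moments f in crit fh; set c := shift eta in crit fh.
have f1 : f \in Lfun mu 1 by case: fd.
have [k k0 hk] := stationary_profile_near uX e0 (finite_energy_quad_neq0 fd foo) (partition_gt0 fd foo b).
have [k' k'0 hk'] := stationary_persists fd foo crit k0.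
split=> //; exists (minr k k'); first by rewrite lt_min k0.
move=> g gd _ gf; have g1 : g \in Lfun mu 1 by case: gd.
have [goo|] := ltP (energy eta g) +oo%E; last by rewrite leye_eq => /eqP ->; exact: leey.
have Mg : `|moments g - M| <= minr k k'.
  by rewrite -lee_fin; apply: le_trans (moments_close f1 g1) _; exact: ltW.
have [Mk Mk'] : `|moments g - M| <= k /\ `|moments g - M| <= k'.
  by move: Mg; rewrite le_min => /andP[].
have [b' b'b crit'] := hk' _ Mk'.
have qn := finite_energy_quad_neq0 gd goo.
have near := hk _ _ Mk b'b qn.
have [hd hM] := stationary_profile_density gd goo crit'.
(* Minimality of f is tested at the profile of g and not at g, which need not belong to X. *)
apply: le_trans (energy_minimal gd hd hM).
apply: hmin => //; first exact: usual_profile_mem.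
set h' := profile _ _ _ _; set h := stationary_profile M c b in fh near.
have sub1 (u : S2 -> R) : u \in Lfun mu 1 -> (h' \- u) \in Lfun mu 1.
  move=> u1; have := Lfun1_comb (-1) (profile_Lfun1 _ _ _ _ : h' \in Lfun mu 1) u1.
  by rewrite (_ : (fun p => _) = h' \- u)//; apply/funext => p; rewrite mulN1r.
(* f equals its profile only almost everywhere, and the norm of X does not see the difference. *)
rewrite (@usual_norm_ae _ X (h' \- f) (h' \- h))//.
- exact: sub1.
- by apply: sub1; exact: profile_Lfun1.
- by apply: filterS fh => p fhp _ /=; rewrite fhp.
Qed.

(** The embedding of X in L^1 handles the competitors. That f itself belongs to X is the point that
    requires work: it agrees almost everywhere with a profile. *)
Lemma local_minimiser_of_L1 eta X f : usual_space X ->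
  local_minimiser eta (Lebesgue_space 1%E) f -> local_minimiser eta X f.
Proof.
move=> uX fmin; have [fd f1 foo [eps e0 hmin]] := fmin.
have [b crit] := exists_stationary fd foo.
have fh := local_minimiser_stationary (usual_Lebesgue (lexx 1%E)) fmin crit.
have [d d0 hd] := usual_embed uX e0.
split; [exact: fd| |exact: foo|].
  apply: (usual_ae uX (Lfun1_measurable f1) _ (f := stationary_profile (moments f) (shift eta) b)).
    by apply: filterS fh => p fhp /fhp.
  by apply: usual_profile_mem => //; exact: finite_energy_quad_neq0 fd foo.
exists d; first exact: d0.
move=> g gd gX gf; have g1 : g \in Lfun mu 1 by case: gd.
apply: (hmin _ gd g1); apply: (hd _ _ gf).
by apply: measurable_funB; exact: Lfun1_measurable.
Qed.

End local_minimisers.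

Theorem theorem4p8 (R : realType) (eta : R) :
  (forall f : sphere R -> R, prob_density f ->
     (exists2 q : R, 1 <= q & local_minimiser eta (Sobolev_space q) f) ->
     local_minimiser eta (Lebesgue_space 1%E) f) /\
  (forall X X' : fun_space R, usual_space X -> usual_space X' ->
     forall f : sphere R -> R, prob_density f ->
       (local_minimiser eta X f <-> local_minimiser eta X' f)).
Proof.
split=> [f _ [q q1]|X X' uX uX' f _].
  by apply: local_minimiser_L1; exact: usual_Sobolev.
(* L^1 is the hub through which any two spaces are compared. *)
by split=> h; apply: local_minimiser_of_L1 => //; exact: local_minimiser_L1 h.
Qed.
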